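(* Let $n=4$ and let $A=(A_1,A_2,A_3,A_4)$ be a generic quadruple of real $3\times4$ matrices (i.e. $A$ lies in the complement of a certain proper algebraic subvariety of the space of quadruples of $3\times 4$ matrices). Then the rigid multiview ideal $J_A$ is minimally generated by $1176$ polynomials in $24$ variables. Each of these generators comes from the case of three cameras, in that it involves the $u$-variables of at most three cameras and the $v$-variables of at most three cameras. Up to symmetry, the degrees of the minimal generators in the $\mathbb{Z}^8$-grading, together with the number of minimal generators in each such degree, are $$\begin{array}{llll} (1,1,0,0,0,0,0,0):1,&(2,2,0,0,1,1,1,0):3,&(2,2,0,0,2,2,0,0):9,&(2,1,1,0,2,1,1,0):1,\\ (1,1,1,0,0,0,0,0):1,&(2,1,1,0,1,1,1,0):1,&(2,2,0,0,2,1,1,0):3,&(1,1,1,0,1,1,1,0):1. \end{array}$$ Here ''up to symmetry'' means up to permuting the first four coordinates, independently permuting the last four coordinates, and exchanging the first four with the last four coordinates.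
   Context: Let $$Q(X,Y)=(X_0Y_3-Y_0X_3)^2+(X_1Y_3-Y_1X_3)^2+(X_2Y_3-Y_2X_3)^2-X_3^2Y_3^2,$$ defining a hypersurface $V(Q)\subset\mathbb{P}^3\times\mathbb{P}^3$. For cameras $A_1,\dots,A_4\in\mathbb{R}^{3\times4}$ of rank $3$, the rigid multiview variety is the Zariski closure of the image of the rational map $V(Q)\dashrightarrow(\mathbb{P}^2)^4\times(\mathbb{P}^2)^4$, $(X,Y)\mapsto\bigl((A_1X,\dots,A_4X),(A_1Y,\dots,A_4Y)\bigr)$. The rigid multiview ideal $J_A$ is its multihomogeneous prime ideal in the polynomial ring $\mathbb{R}[u,v]$ in the $24$ variables $u_{i0},u_{i1},u_{i2},v_{i0},v_{i1},v_{i2}$, $1\le i\le4$, where $(u_{i0}:u_{i1}:u_{i2})$ and $(v_{i0}:v_{i1}:v_{i2})$ are coordinates on the $i$-th factor on the left, respectively right. The ring is $\mathbb{Z}^8$-graded: the variables $u_{i*}$ have degree the $i$-th unit vector and the variables $v_{i*}$ have degree the $(4+i)$-th unit vector. *)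

(* Defs.v *)
From HB Require Import structures.
From mathcomp Require Import all_boot all_order all_algebra.
From mathcomp Require Import mpoly reals complex.

Set Implicit Arguments.
Unset Strict Implicit.
Unset Printing Implicit Defensive.

Import GRing.Theory.

Local Open Scope ring_scope.

(* The eight factors of (P^2)^4 x (P^2)^4 are indexed by 'I_(4 + 4):
   [lshift 4 i] is the factor with coordinates (u_i0 : u_i1 : u_i2), and
   [rshift 4 i] the one with coordinates (v_i0 : v_i1 : v_i2).  The j-th
   coordinate on the k-th factor is the polynomial variable of index
   [mxvec_index k j]. *)

Notation num_vars := ((4 + 4) * 3)%N.

Notation uv_ring K := {mpoly K[num_vars]}.

(* The rows of P are homogeneous coordinates for the eight factors. *)
Notation coords K := 'M[K]_(4 + 4, 3).

Definition eval_at (K : comNzRingType) (P : coords K) (f : uv_ring K) : K :=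
  f.@[mxvec P 0].

(* Monomials have nonnegative degrees, so Z^8-degrees are taken in N^8. *)
Definition multidegree (m : 'X_{1..num_vars}) : 8.-tuple nat :=
  [tuple (\sum_(j < 3) m (mxvec_index (k : 'I_(4 + 4)) j))%N | k < 8].

Definition is_multihomog (K : nzRingType) (d : 8.-tuple nat) (f : uv_ring K) :
    bool :=
  all (fun m => multidegree m == d) (msupp f).

Definition involves (K : nzRingType) (f : uv_ring K) (k : 'I_(4 + 4)) : bool :=
  has (fun m : 'X_{1..num_vars} => [exists j : 'I_3, m (mxvec_index k j) != 0%N])
      (msupp f).

Definition rigidQ (K : comNzRingType) (X Y : 'cV[K]_4) : K :=
  let x i := X i 0 in
  let y i := Y i 0 in
    (x 0 * y 3 - y 0 * x 3) ^+ 2 + (x 1 * y 3 - y 1 * x 3) ^+ 2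
  + (x 2 * y 3 - y 2 * x 3) ^+ 2 - x 3 ^+ 2 * y 3 ^+ 2.

(* Sets of points of (P^2)^4 x (P^2)^4 are predicates on [coords K] that imply
   [is_point] and do not depend on the choice of homogeneous coordinates. *)
Definition is_point (K : nzRingType) (P : coords K) : Prop :=
  forall k, row k P != 0.

(* [w] represents the same point of P^2 as the nonzero vector [z]. *)
Definition represents (K : nzRingType) (w : 'rV[K]_3) (z : 'cV[K]_3) : Prop :=
  z != 0 /\ exists2 s : K, s != 0 & w = s *: z^T.

Definition in_image (K : fieldType) (A : 'I_4 -> 'M[K]_(3, 4)) (P : coords K) :
    Prop :=
  exists X Y : 'cV[K]_4,
    [/\ X != 0, Y != 0, rigidQ X Y = 0,
        forall i, represents (row (lshift 4 i) P) (A i *m X)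
      & forall i, represents (row (rshift 4 i) P) (A i *m Y)].

Definition zariski_closure (K : fieldType) (S : coords K -> Prop)
    (P : coords K) : Prop :=
  is_point P /\
  forall (d : 8.-tuple nat) (g : uv_ring K), is_multihomog d g ->
    (forall P', S P' -> eval_at P' g = 0) -> eval_at P g = 0.

(* Varieties consist of complex points, while the cameras are real. *)
Definition rigid_multiview_variety (R : realType) (A : 'I_4 -> 'M[R]_(3, 4)) :
    coords (complex R) -> Prop :=
  zariski_closure (in_image (fun i => map_mx (real_complex R) (A i))).

(* The eight rows of P can be rescaled independently, so f belongs to
   this ideal iff each of its multihomogeneous components vanishes on the
   variety. *)
Definition rigid_multiview_ideal (R : realType) (A : 'I_4 -> 'M[R]_(3, 4))
    (f : uv_ring R) : Prop :=
  forall P, rigid_multiview_variety A P ->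
    eval_at P (map_mpoly (real_complex R) f) = 0.

Definition in_ideal_of (S : nzRingType) (G : seq S) (f : S) : Prop :=
  exists c : nat -> S, f = \sum_(i < size G) c i * G`_i.

Definition generates (S : nzRingType) (G : seq S) (J : S -> Prop) : Prop :=
  forall f, in_ideal_of G f <-> J f.

Definition minimal_generators (K : nzRingType) (G : seq (uv_ring K))
    (J : uv_ring K -> Prop) : Prop :=
  [/\ forall g, g \in G -> exists d, is_multihomog d g,
      generates G J
    & forall G', subseq G' G -> generates G' J -> G' = G].

Definition same_up_to_symmetry (d e : 8.-tuple nat) : bool :=
     perm_eq (take 4 d) (take 4 e) && perm_eq (drop 4 d) (drop 4 e)
  || perm_eq (take 4 d) (drop 4 e) && perm_eq (drop 4 d) (take 4 e).

Definition degree_table : seq (8.-tuple nat * nat) :=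
  [:: ([tuple 1; 1; 0; 0; 0; 0; 0; 0], 1);
      ([tuple 2; 2; 0; 0; 1; 1; 1; 0], 3);
      ([tuple 2; 2; 0; 0; 2; 2; 0; 0], 9);
      ([tuple 2; 1; 1; 0; 2; 1; 1; 0], 1);
      ([tuple 1; 1; 1; 0; 0; 0; 0; 0], 1);
      ([tuple 2; 1; 1; 0; 1; 1; 1; 0], 1);
      ([tuple 2; 2; 0; 0; 2; 1; 1; 0], 3);
      ([tuple 1; 1; 1; 0; 1; 1; 1; 0], 1)]%N.

Definition camera_entries (R : nzRingType) (A : 'I_4 -> 'M[R]_(3, 4)) :
    'rV[R]_(4 * (3 * 4)) :=
  mxvec (\matrix_(i < 4) mxvec (A i)).

Definition in_zero_locus (R : comNzRingType) (F : seq {mpoly R[4 * (3 * 4)]})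
    (A : 'I_4 -> 'M[R]_(3, 4)) : Prop :=
  forall p, p \in F -> p.@[camera_entries A 0] = 0.

Definition holds_generically (R : comNzRingType)
    (T : ('I_4 -> 'M[R]_(3, 4)) -> Prop) : Prop :=
  exists F : seq {mpoly R[4 * (3 * 4)]},
    (exists A, ~ in_zero_locus F A) /\
    (forall A, ~ in_zero_locus F A -> T A).

(* Main.v *)
Require Import Defs.
From HB Require Import structures.
From mathcomp Require Import all_boot all_order all_algebra.
From mathcomp Require Import mpoly reals complex zify ring.

(* Generic cameras have linearly independent centers, so in suitable coordinates
   of P^3 and of the eight image planes the i-th camera forgets the i-th
   coordinate of X: u_ij maps to t_i x_j for j != i, and the quadric becomes some
   form Q(X, Y) of bidegree (2, 2).  A polynomial lies in J_A iff Q divides the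
   image of each of its multihomogeneous components: two points of V(Q) over a
   general choice of all coordinates but x_0 kill the remainder of a
   pseudo-division by Q.  Hence J_A is an extension of two parts.
   - The kernel of the monomial map is the toric ideal of K_{4,4} minus a perfect
     matching, on each side: 6 quadrics and 4 cubics.
   - The image.  Multiplicities at the centers are additive and Q does not vanish
     identically at a (real) center, so it is Q (N (x) N), where N is the monomial
     module spanned by the x^a of row degree d with |a| = |d| - 2 and
     a_i + d_i <= |d| - 2.  It has 34 minimal generators.
   Together these are 2 * 10 + 34 ^ 2 = 1176 generators, and by Nakayama their
   degrees determine those of every minimal generating sequence. *)
Set Implicit Arguments.
Unset Strict Implicit.
Unset Printing Implicit Defensive.

Import Order.TTheory GRing.Theory Num.Theory.

Local Open Scope ring_scope.

(** * Generated ideals and the multigrading *)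


(** On each side a monomial in the variables u_ij is a 4 x 4 table of naturals with zero diagonal;
    its row sums d are its multidegree and its column sums a the exponents of its image. Row i and
    column i of such a table are disjoint, whence d_i + a_i <= |d|, and together with |a| = |d|
    these inequalities suffice for a table to exist. Multiplication by Q adds 2 to the degree on
    each side and 2 to the degree in each variable; this is the shift by 2 in N. The delicate point
    is that Q has degree 2 in every variable, that is, Q(c, Y) is not identically zero for a center
    c. This fails for a complex c with c_3 = 0 and c_0^2 + c_1^2 + c_2^2 = 0, but no real c
    satisfies these equations except 0. Independence modulo mJ splits into two problems. A binomial
    has degree 0 on one side while a lift of an element of Q (N (x) N) has positive degree on both,
    so that lifts do not disturb the coefficients that detect binomials; the monomial map then kills
    the binomials, and cancelling Q leaves N (x) N. The finite facts about the 34 generators and the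
    degree table are decided by computation on lists of naturals. *)

Section InIdeal.
Variable S : comNzRingType.
Implicit Types (G H : seq S) (f g : S).

Lemma in_ideal_of0 G : in_ideal_of G 0.
Proof. by exists (fun=> 0); rewrite big1 // => i _; rewrite mul0r. Qed.

Lemma in_ideal_ofD G f g :
  in_ideal_of G f -> in_ideal_of G g -> in_ideal_of G (f + g).
Proof.
move=> [c ->] [d ->]; exists (fun i => c i + d i).
by rewrite -big_split; apply: eq_bigr => i _; rewrite mulrDl.
Qed.

Lemma in_ideal_ofM G a f : in_ideal_of G f -> in_ideal_of G (a * f).
Proof.
move=> [c ->]; exists (fun i => a * c i).
by rewrite mulr_sumr; apply: eq_bigr => i _; rewrite mulrA.
Qed.

Lemma in_ideal_ofN G f : in_ideal_of G f -> in_ideal_of G (- f).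
Proof. by rewrite -mulN1r; apply: in_ideal_ofM. Qed.

Lemma in_ideal_of_sum (I : eqType) G (r : seq I) (P : pred I) F :
  (forall i, i \in r -> P i -> in_ideal_of G (F i)) ->
  in_ideal_of G (\sum_(i <- r | P i) F i).
Proof.
move=> IF; rewrite big_seq_cond; apply: big_ind => [||i /andP[]].
- exact: in_ideal_of0.
- by move=> f g; apply: in_ideal_ofD.
- exact: IF.
Qed.

Lemma mem_in_ideal_of G f : f \in G -> in_ideal_of G f.
Proof.
move=> Gf; pose i0 : 'I_(size G) := Ordinal (etrans (index_mem f G) Gf).
exists (fun i => (i == index f G)%:R); rewrite (bigD1 i0) //= eqxx mul1r.
rewrite nth_index // big1 ?addr0 // => i /negPf.
by rewrite -val_eqE /= => ->; rewrite mul0r.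
Qed.

Lemma in_ideal_of_trans G H f :
  (forall g, g \in G -> in_ideal_of H g) -> in_ideal_of G f -> in_ideal_of H f.
Proof.
move=> GH [c ->]; apply: in_ideal_of_sum => i _ _.
exact/in_ideal_ofM/GH/mem_nth.
Qed.

(** Pads a combination of a subsequence with zero coefficients at the omitted places, which makes it
    a relation on the full sequence as in [nakayama_free]. *)
Lemma in_ideal_of_mask (b : bitseq) G f :
    size b = size G -> in_ideal_of (mask b G) f ->
  exists2 c : nat -> S, f = \sum_(i < size G) c i * G`_i
                      & forall i, ~~ nth false b i -> c i = 0.
Proof.
elim: b G f => [|x b IHb] [|g G] f //= => [_ [c ->]|[sz_b]].
  by exists (fun=> 0); rewrite /= ?big_ord0.
have step f' : in_ideal_of (mask b G) f' -> forall a, (~~ x -> a = 0) ->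
    exists2 c : nat -> S,
      a * g + f' = \sum_(i < (size G).+1) c i * (g :: G)`_i
    & forall i, ~~ nth false (x :: b) i -> c i = 0.
  move=> /(IHb _ _ sz_b)[c -> c0] a a0.
  exists (fun i => if i is j.+1 then c j else a); first by rewrite big_ord_recl.
  by case=> [|i] //=; apply: c0.
case: x step => [|] step If.
  case: If => c; rewrite /= big_ord_recl /= => ->; apply: step => //.
  by exists (fun i => c i.+1).
by have [c Dc c0] := step _ If 0 (fun=> erefl); exists c; rewrite // -Dc mul0r add0r.
Qed.

End InIdeal.

Section Grading.
Variable K : comNzRingType.
Implicit Types (d e : 8.-tuple nat) (f g : uv_ring K).

Definition degD d e : 8.-tuple nat := [tuple (tnth d k + tnth e k)%N | k < 8].
(** Truncated subtraction, hence meaningful only together with [le_deg e d]. *)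
Definition degB d e : 8.-tuple nat := [tuple (tnth d k - tnth e k)%N | k < 8].
Definition le_deg d e : bool := [forall k, tnth d k <= tnth e k]%N.

Lemma le_degP d e : reflect (forall k, tnth d k <= tnth e k)%N (le_deg d e).
Proof. exact: forallP. Qed.

Lemma le_deg_refl d : le_deg d d.
Proof. exact/le_degP. Qed.

Lemma degB_refl d : degB d d = [tuple 0%N | k < 8].
Proof. by apply: eq_from_tnth => k; rewrite !tnth_mktuple subnn. Qed.

Lemma multidegreeE (m : 'X_{1..num_vars}) k :
  tnth (multidegree m) k = (\sum_(j < 3) m (mxvec_index (k : 'I_(4 + 4)) j))%N.
Proof. by rewrite tnth_mktuple. Qed.

Lemma multidegreeD m1 m2 :
  multidegree (m1 + m2)%MM = degD (multidegree m1) (multidegree m2).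
Proof.
apply: eq_from_tnth => k; rewrite multidegreeE tnth_mktuple !multidegreeE -big_split /=.
by apply: eq_bigr => j _; rewrite mnmDE.
Qed.

Lemma multidegree0 : multidegree 0%MM = [tuple 0%N | k < 8].
Proof.
apply: eq_from_tnth => k; rewrite multidegreeE tnth_mktuple big1 // => j _.
by rewrite mnm0E.
Qed.

Lemma degD_eq d e e' : (degD d e == e') = le_deg e e' && (d == degB e' e).
Proof.
apply/eqP/andP => [<-|[/le_degP le_e /eqP->]].
  split; first by apply/le_degP => k; rewrite tnth_mktuple leq_addl.
  by apply/eqP/eq_from_tnth => k; rewrite !tnth_mktuple addnK.
by apply: eq_from_tnth => k; rewrite !tnth_mktuple subnK.
Qed.

Lemma multidegree_eq0 m :
  (multidegree m == [tuple 0%N | k < 8]) = (m == 0%MM).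
Proof.
apply/eqP/eqP => [m0|->]; last exact: multidegree0.
apply/mnmP => e; case/mxvec_indexP: e => k j; rewrite mnm0E.
have := congr1 (fun t => tnth t k) m0; rewrite multidegreeE tnth_mktuple.
by move/eqP; rewrite sum_nat_eq0 => /forallP/(_ j)/eqP.
Qed.

Lemma degB_eq0 d e : le_deg e d -> (degB d e == [tuple 0%N | k < 8]) = (d == e).
Proof.
move/le_degP => le_ed; apply/eqP/eqP => [de0|->]; last first.
  by apply: eq_from_tnth => k; rewrite !tnth_mktuple subnn.
apply: eq_from_tnth => k; have := congr1 (fun t => tnth t k) de0.
by rewrite !tnth_mktuple => /eqP; rewrite subn_eq0 => le_de; apply/eqP; rewrite eqn_leq le_de le_ed.
Qed.

Lemma is_multihomogP d f :
  reflect (forall m, f@_m != 0 -> multidegree m = d) (is_multihomog d f).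
Proof.
apply: (iffP allP) => [hom m|hom m]; first by rewrite -mcoeff_msupp => /hom/eqP.
by rewrite mcoeff_msupp => /hom->.
Qed.

Lemma is_multihomogX m : is_multihomog (multidegree m) ('X_[m] : uv_ring K).
Proof. by apply/is_multihomogP => m'; rewrite mcoeffX; case: (m =P m') => [->|_] //; rewrite eqxx. Qed.

Lemma is_multihomogD d f g :
  is_multihomog d f -> is_multihomog d g -> is_multihomog d (f + g).
Proof.
move=> /is_multihomogP hf /is_multihomogP hg; apply/is_multihomogP => m.
rewrite mcoeffD; case: (eqVneq f@_m 0) => [->|/hf//]; rewrite add0r; exact: hg.
Qed.

Lemma is_multihomogZ d a f : is_multihomog d f -> is_multihomog d (a *: f).
Proof.
move=> /is_multihomogP hf; apply/is_multihomogP => m; rewrite mcoeffZ => af.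
by apply: hf; apply: contraNneq af => ->; rewrite mulr0.
Qed.

Lemma is_multihomogN d f : is_multihomog d f -> is_multihomog d (- f).
Proof. by rewrite -scaleN1r; apply: is_multihomogZ. Qed.

Lemma is_multihomogB d f g :
  is_multihomog d f -> is_multihomog d g -> is_multihomog d (f - g).
Proof. by move=> hf /is_multihomogN; apply: is_multihomogD. Qed.

Lemma is_multihomog0 d : is_multihomog d (0 : uv_ring K).
Proof. by apply/is_multihomogP => m; rewrite mcoeff0 eqxx. Qed.

Lemma is_multihomog_sum (I : eqType) (r : seq I) (P : pred I) d
    (F : I -> uv_ring K) :
  (forall i, i \in r -> P i -> is_multihomog d (F i)) ->
  is_multihomog d (\sum_(i <- r | P i) F i).
Proof.
move=> hF; rewrite big_seq_cond; apply: (big_ind (fun g => is_multihomog d g)) => [||i /andP[]].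
- exact: is_multihomog0.
- by move=> f g hf hg; exact: is_multihomogD.
- exact: hF.
Qed.

Lemma is_multihomogM d e f g :
  is_multihomog d f -> is_multihomog e g -> is_multihomog (degD d e) (f * g).
Proof.
move=> /is_multihomogP hf /is_multihomogP hg; apply/allP => m /msuppM_le.
case/allpairsP => -[m1 m2] /= [m1f m2g ->]; rewrite multidegreeD.
by rewrite (hf m1) -?mcoeff_msupp // (hg m2) -?mcoeff_msupp.
Qed.

Lemma is_multihomog_inj d e f :
  f != 0 -> is_multihomog d f -> is_multihomog e f -> d = e.
Proof.
move=> f0 /is_multihomogP hd /is_multihomogP he; have f0' := mlead_supp f0.
by rewrite mcoeff_msupp in f0'; rewrite -(hd _ f0') (he _ f0').
Qed.

Definition component d f : uv_ring K :=
  \sum_(m <- msupp f | multidegree m == d) f@_m *: 'X_[m].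

Lemma mcoeff_component d f m :
  (component d f)@_m = if multidegree m == d then f@_m else 0.
Proof.
rewrite /component big_mkcond raddf_sum /=.
rewrite (eq_bigr (fun m' => if m' == m then
    (if multidegree m == d then f@_m else 0) else 0)); last first.
  move=> m' _; have [->|/negPf nm] := eqVneq m' m.
    by case: ifP => _; rewrite ?mcoeff0 // mcoeffZ mcoeffX eqxx mulr1.
  by case: ifP => _; rewrite ?mcoeff0 // mcoeffZ mcoeffX nm mulr0.
case: (boolP (m \in msupp f)) => [mf|/memN_msupp_eq0->]; last first.
  by rewrite if_same big1 // => m' _; rewrite if_same.
rewrite (bigD1_seq m) ?msupp_uniq //= eqxx big1 ?addr0 // => m' /negPf->.
by [].
Qed.

Lemma componentD d : {morph component d : f g / f + g}.
Proof.
move=> f g; apply/mpolyP => m; rewrite mcoeffD !mcoeff_component mcoeffD.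
by case: ifP; rewrite ?addr0.
Qed.

Lemma component0 d : component d 0 = 0.
Proof. by apply/mpolyP => m; rewrite mcoeff_component mcoeff0 if_same. Qed.

Lemma component_sum (I : Type) (r : seq I) (P : pred I) (F : I -> uv_ring K) d :
  component d (\sum_(i <- r | P i) F i) = \sum_(i <- r | P i) component d (F i).
Proof. exact: (big_morph _ (@componentD d) (component0 d)). Qed.

Lemma componentZ d a f : component d (a *: f) = a *: component d f.
Proof.
apply/mpolyP => m; rewrite mcoeffZ !mcoeff_component mcoeffZ.
by case: ifP => //; rewrite mulr0.
Qed.

Lemma is_multihomog_component d f : is_multihomog d (component d f).
Proof. by apply/is_multihomogP => m; rewrite mcoeff_component; case: (_ =P d) => // _; rewrite eqxx. Qed.

Lemma component_id d f : is_multihomog d f -> component d f = f.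
Proof.
move/is_multihomogP => hf; apply/mpolyP => m; rewrite mcoeff_component.
by case: eqP => // /eqP; apply: contraNeq; rewrite eq_sym => /hf->.
Qed.

Lemma componentX d m :
  component d 'X_[m] = if multidegree m == d then 'X_[m] else 0 :> uv_ring K.
Proof.
apply/mpolyP => m'; rewrite mcoeff_component mcoeffX.
case: (eqVneq m m') => [->|/negPf nm]; first by case: ifP; rewrite ?mcoeffX ?eqxx ?mcoeff0.
by case: ifP; case: ifP; rewrite ?mcoeffX ?mcoeff0 ?nm.
Qed.

Lemma sum_component f :
  f = \sum_(d <- undup [seq multidegree m | m <- msupp f]) component d f.
Proof.
apply/mpolyP => m; rewrite raddf_sum /=.
rewrite (eq_bigr (fun d => if d == multidegree m then f@_m else 0)); last first.
  by move=> d _; rewrite mcoeff_component eq_sym.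
case: (boolP (m \in msupp f)) => [mf|/memN_msupp_eq0->]; last first.
  by rewrite big1 // => d _; rewrite if_same.
rewrite (bigD1_seq (multidegree m)) ?undup_uniq ?mem_undup ?map_f //= eqxx.
by rewrite big1 ?addr0 // => d /negPf->.
Qed.

Lemma component_eq0 d f :
  d \notin [seq multidegree m | m <- msupp f] -> component d f = 0.
Proof.
move=> df; apply/mpolyP => m; rewrite mcoeff_component mcoeff0; case: eqP => // dm.
by apply/eqP; rewrite mcoeff_eq0; apply: contra df => mf; rewrite -dm map_f.
Qed.

(** By linearity f may be taken to be a monomial X^m. The coefficient at m' then vanishes on both
    sides unless m divides m', and in that case degrees add. The test [le_deg e d] guards against
    the truncation in [degB]. *)
Lemma componentM d e f g : is_multihomog e g ->
  component d (f * g) = (if le_deg e d then component (degB d e) f else 0) * g.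
Proof.
move/is_multihomogP => hg; rewrite [f in LHS]mpolyE mulr_suml component_sum.
rewrite [f in RHS]mpolyE component_sum.
rewrite (_ : (if _ then _ else 0) = \sum_(m <- msupp f)
   if le_deg e d then component (degB d e) (f@_m *: 'X_[m]) else 0); last first.
  by case: ifP => // _; rewrite big1.
rewrite mulr_suml; apply: eq_bigr => m _; rewrite -scalerAl !componentZ.
rewrite (_ : (if _ then _ else 0) = f@_m *: if le_deg e d
   then component (degB d e) 'X_[m] else 0); last by case: ifP; rewrite ?scaler0.
rewrite -scalerAl; congr (_ *: _); rewrite componentX.
apply/mpolyP => m'; rewrite mcoeff_component.
have [/mnm_lepP le_m|nle] := boolP (m <= m')%MM; last first.
  have coef0 (h : uv_ring K) : ('X_[m] * h)@_m' = 0.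
    apply/eqP; rewrite mcoeff_eq0; apply/negP => /msuppM_le/allpairsP[[m1 m2] /=].
    rewrite msuppX inE => -[/eqP-> _ m'E]; case/negP: nle.
    by rewrite m'E lem_addr.
  rewrite coef0 if_same; case: ifP => _; last by rewrite mul0r mcoeff0.
  by case: ifP => _; rewrite ?mul0r ?mcoeff0 ?coef0.
have {le_m} -> : m' = (m + (m' - m))%MM.
  by rewrite addmC submK //; apply/mnm_lepP.
set m2 := (m' - m)%MM; have coefX (h : uv_ring K) : ('X_[m] * h)@_(m + m2) = h@_m2.
  by rewrite mulrC mcoeffMX.
rewrite coefX; have [g0|g0] := eqVneq g@_m2 0.
  rewrite g0 if_same; case: ifP => _; last by rewrite mul0r mcoeff0.
  by case: ifP => _; rewrite ?mul0r ?mcoeff0 ?coefX ?g0.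
rewrite multidegreeD (hg _ g0) degD_eq; case: (le_deg e d) => /=; last by rewrite mul0r mcoeff0.
by case: ifP => _; rewrite ?mul0r ?mcoeff0 ?coefX.
Qed.

Lemma component0_coef f :
  component [tuple 0%N | k < 8] f = (f@_0%MM)%:MP.
Proof.
apply/mpolyP => m; rewrite mcoeff_component multidegree_eq0 mcoeffC.
by case: (m =P 0%MM) => [->|]; rewrite ?mulr1 ?mulr0.
Qed.

End Grading.

(** * Graded Nakayama *)


Section MinimalGenerators.
Variable K : numFieldType.
Implicit Types (G H : seq (uv_ring K)) (J : uv_ring K -> Prop).

Definition homogeneous_seq G :=
  forall g, g \in G -> exists d, is_multihomog d g.

(* For homogeneous G this says that G maps to a basis of J/mJ, where J is the
   ideal generated by G and m the ideal of all the variables. *)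
Definition nakayama_free G :=
  forall c : nat -> uv_ring K, \sum_(i < size G) c i * G`_i = 0 ->
  forall i, (i < size G)%N -> (c i)@_0%MM = 0.

(** If some c_i had a nonzero constant term, the component of the relation in the degree of G_i
    would express G_i through the other generators, and G_i could be dropped. *)
Lemma minimal_generators_free G J : minimal_generators G J -> nakayama_free G.
Proof.
move=> [homG genG minG] c rel0 i lt_i; apply/eqP; apply: contraT => ci0.
have [d homd] := homG _ (mem_nth 0 lt_i).
pose G' := take i G ++ drop i.+1 G.
have inG' j : (j < size G)%N -> j != i -> G`_j \in G'.
  move=> lt_j; rewrite mem_cat neq_ltn => /orP[lt_ji|lt_ij].
    by rewrite -(nth_take 0 lt_ji) mem_nth // size_take lt_i.
  rewrite -(subnKC lt_ij) -nth_drop mem_nth ?orbT // size_drop.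
  by rewrite ltn_sub2r // (leq_trans _ lt_j).
have GiG' : in_ideal_of G' G`_i.
  (* In the degree of G_i itself, the coefficient c_i contributes exactly its constant term. *)
  have := congr1 (component d) rel0; rewrite component_sum component0.
  rewrite (bigD1 (Ordinal lt_i)) //= (componentM _ _ homd).
  rewrite le_deg_refl degB_refl component0_coef mul_mpolyC => /eqP; rewrite addr_eq0 => /eqP Di.
  rewrite -[G`_i](scalerK ci0) -mul_mpolyC Di; apply/in_ideal_ofM/in_ideal_ofN.
  apply: in_ideal_of_sum => j _ ne_ji; have [e home] := homG _ (mem_nth 0 (ltn_ord j)).
  by rewrite (componentM _ _ home); apply/in_ideal_ofM/mem_in_ideal_of/inG'.
have sG'G : subseq G' G.
  rewrite -[X in subseq _ X](cat_take_drop i G) cat_subseq //.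
  by rewrite (drop_nth 0 lt_i) (subseq_cons).
suff /(minG _ sG'G) /(congr1 size) : generates G' J.
  rewrite size_cat size_takel ?(ltnW lt_i) // size_drop.
  have aux n k : (k < n)%N -> (k + (n - k.+1))%N <> n by lia.
  by move/aux: lt_i.
move=> f; rewrite -genG; split; apply: in_ideal_of_trans => g.
  by move/(mem_subseq sG'G)/mem_in_ideal_of.
move=> Gg; rewrite -(nth_index 0 Gg); have [->//|ne] := eqVneq (index g G) i.
by apply/mem_in_ideal_of/inG'; rewrite // index_mem.
Qed.

(** If a generating subsequence omitted G_i, then G_i minus its expansion in the subsequence would
    be a relation whose i-th coefficient is 1. *)
Lemma nakayama_free_minimal G J :
  nakayama_free G -> generates G J ->
  forall G', subseq G' G -> generates G' J -> G' = G.
Proof.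
move=> freeG genG _ /subseqP[b sz_b ->] genG'.
suff : all (pred1 true) b by move/all_pred1P->; rewrite mask_true // sz_b.
apply/(all_nthP false) => i; rewrite sz_b => lt_i; apply/eqP; case: (boolP (nth _ _ _)) => // nbi.
have /genG'/in_ideal_of_mask : J G`_i by apply/genG/mem_in_ideal_of/mem_nth.
case=> // c Di c0; pose c' j := (j == i)%:R - c j.
have /freeG/(_ i lt_i) : \sum_(j < size G) c' j * G`_j = 0.
  under eq_bigr do rewrite mulrBl; rewrite sumrB -Di (bigD1 (Ordinal lt_i)) //=.
  rewrite eqxx mul1r big1 ?addr0 ?subrr // => j /negPf.
  by rewrite -val_eqE /= => ->; rewrite mul0r.
by rewrite /c' eqxx c0 // subr0 mcoeff1 eqxx => /eqP; rewrite oner_eq0.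
Qed.

Lemma nakayama_free_neq0 G i : nakayama_free G -> (i < size G)%N -> G`_i != 0.
Proof.
move=> freeG lt_i; apply/eqP => Gi0; pose c j : uv_ring K := (j == i)%:R.
have /freeG/(_ i lt_i) : \sum_(j < size G) c j * G`_j = 0.
  apply: big1 => j _; rewrite /c; case: eqP => [->|_]; last by rewrite mul0r.
  by rewrite Gi0 mulr0.
by rewrite /c eqxx mcoeff1 eqxx => /eqP; rewrite oner_eq0.
Qed.

(** Read off the leading monomial; for a nonzero multihomogeneous g any monomial gives the same
    value. *)
Definition mdegree_of (g : uv_ring K) : 8.-tuple nat := multidegree (mlead g).

Lemma mdegree_ofP g d : g != 0 -> is_multihomog d g -> mdegree_of g = d.
Proof.
move=> g0 /is_multihomogP; apply; rewrite -mcoeff_msupp; exact: mlead_supp.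
Qed.

Lemma count_homogE G d : homogeneous_seq G -> nakayama_free G ->
  count (is_multihomog d) G = \sum_(i < size G | mdegree_of G`_i == d) 1%N.
Proof.
move=> homG freeG; rewrite -sum1_count (big_nth 0) big_mkord.
apply: eq_bigl => i; have G0 := nakayama_free_neq0 freeG (ltn_ord i).
have [e home] := homG _ (mem_nth 0 (ltn_ord i)).
rewrite (mdegree_ofP G0 home); apply/idP/eqP => [/(is_multihomog_inj G0 home)//|<-//].
Qed.

(** The coefficient of H_j can be replaced by its component of degree deg G_i - deg H_j, and such a
    component has a constant term only if the two degrees agree. *)
Lemma homogeneous_expansion G H : homogeneous_seq G -> nakayama_free G ->
    homogeneous_seq H -> nakayama_free H ->
    (forall g, g \in G -> in_ideal_of H g) ->
  exists M : 'I_(size G) -> 'I_(size H) -> uv_ring K,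
    (forall i : 'I_(size G), G`_i = \sum_j M i j * H`_j) /\
    (forall (i : 'I_(size G)) (j : 'I_(size H)),
       mdegree_of G`_i != mdegree_of H`_j -> (M i j)@_0%MM = 0).
Proof.
move=> homG freeG homH freeH GH.
have deg_ofE L k : homogeneous_seq L -> nakayama_free L -> (k < size L)%N ->
    is_multihomog (mdegree_of L`_k) L`_k.
  move=> homL freeL ltk; have [e home] := homL _ (mem_nth 0 ltk).
  by rewrite (mdegree_ofP _ home) // nakayama_free_neq0.
pose P (i : 'I_(size G)) (M : 'I_(size H) -> uv_ring K) :=
  G`_i = \sum_j M j * H`_j /\
  (forall j : 'I_(size H), mdegree_of G`_i != mdegree_of H`_j -> (M j)@_0%MM = 0).
suff /fin_all_exists[M PM] : forall i, exists M, P i M.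
  by exists M; split=> i; have [] := PM i.
move=> i; have [c Dc] := GH _ (mem_nth 0 (ltn_ord i)).
pose d := mdegree_of G`_i; pose e (j : 'I_(size H)) := mdegree_of H`_j.
exists (fun j => if le_deg (e j) d then component (degB d (e j)) (c j) else 0).
split=> [|j ne]; last first.
  case: ifP => [le|]; last by rewrite mcoeff0.
  by rewrite mcoeff_component multidegree0 eq_sym degB_eq0 // (negPf ne).
rewrite -[LHS](component_id (deg_ofE _ _ homG freeG (ltn_ord i))) {2}Dc.
rewrite component_sum; apply: eq_bigr => j _.
exact/componentM/deg_ofE.
Qed.

(** Substituting one expansion into the other makes each row of MN - 1 a relation on G, so its
    constant terms vanish by freeness. Only the diagonal is stated, since only traces are
    compared. *)
Lemma expansion_inverse G H (M : 'I_(size G) -> 'I_(size H) -> uv_ring K)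
    (N : 'I_(size H) -> 'I_(size G) -> uv_ring K) :
    nakayama_free G ->
    (forall i : 'I_(size G), G`_i = \sum_j M i j * H`_j) ->
    (forall j : 'I_(size H), H`_j = \sum_i N j i * G`_i) ->
  forall i, \sum_j (M i j)@_0%MM * (N j i)@_0%MM = 1.
Proof.
move=> freeG DG DH i.
pose c' (k : 'I_(size G)) : uv_ring K := \sum_j M i j * N j k - (k == i)%:R.
(* Extends the coefficients from ordinals to all naturals, as [nakayama_free] expects. *)
pose c k := oapp c' 0 (insub k).
have cE (k : 'I_(size G)) : c k = c' k by rewrite /c valK.
have /freeG/(_ i (ltn_ord i)) : \sum_(k < size G) c k * G`_k = 0.
  under eq_bigr do rewrite cE mulrBl mulr_suml.
  rewrite sumrB [X in _ - X](bigD1 i) //= eqxx mul1r.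
  rewrite [X in _ - (_ + X)]big1 ?addr0; last by move=> k /negPf->; rewrite mul0r.
  apply/eqP; rewrite subr_eq0 [G`_i]DG; apply/eqP.
  rewrite [RHS](eq_bigr (fun j => \sum_k M i j * N j k * G`_k)) => [|j _].
    by rewrite exchange_big.
  by rewrite DH mulr_sumr; apply: eq_bigr => k _; rewrite mulrA.
rewrite cE /c' eqxx mcoeffB mcoeff1 eqxx raddf_sum /= => /eqP.
rewrite subr_eq0 => /eqP E; rewrite -[1]/(true%:R) -E; apply: eq_bigr => j _.
by rewrite rmorphM.
Qed.

(* The constant terms of the matrices expressing G in H and H in G are mutually
   inverse and preserve degrees, so that the traces of the projections to the
   generators of a given degree agree. *)
Lemma minimal_generators_count G H J (P : pred (8.-tuple nat)) :
    homogeneous_seq G -> nakayama_free G -> generates G J ->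
    homogeneous_seq H -> nakayama_free H -> generates H J ->
  (\sum_(i < size G | P (mdegree_of G`_i)) 1 =
   \sum_(j < size H | P (mdegree_of H`_j)) 1)%N.
Proof.
move=> homG freeG genG homH freeH genH.
have GH g : g \in G -> in_ideal_of H g.
  by move=> Gg; apply/genH/genG/mem_in_ideal_of.
have HG h : h \in H -> in_ideal_of G h.
  by move=> Hh; apply/genG/genH/mem_in_ideal_of.
have [M [DG M0]] := homogeneous_expansion homG freeG homH freeH GH.
have [N [DH N0]] := homogeneous_expansion homH freeH homG freeG HG.
have MN := expansion_inverse freeG DG DH; have NM := expansion_inverse freeH DH DG.
apply/eqP; rewrite -(eqr_nat K) !natr_sum.
rewrite (eq_bigr _ (fun i _ => esym (MN i))) pair_big_dep /=.
rewrite [X in _ == X](eq_bigr _ (fun i _ => esym (NM i))).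
rewrite [X in _ == X](exchange_big_dep xpredT) //= [X in _ == X]pair_big_dep /=.
rewrite (bigID (fun p : 'I_(size G) * 'I_(size H) => mdegree_of G`_p.1 == mdegree_of H`_p.2)) /=.
rewrite [X in _ + X]big1 ?addr0 => [|p /andP[_ ne]]; last by rewrite M0 ?mul0r.
rewrite [X in _ == X](bigID (fun p : 'I_(size G) * 'I_(size H) =>
  mdegree_of G`_p.1 == mdegree_of H`_p.2)) /=.
rewrite [X in _ == _ + X]big1 ?addr0 => [|p /andP[_ ne]]; last first.
  by rewrite M0 ?mulr0.
apply/eqP/eq_big => [p|p _]; last by rewrite mulrC.
by case: eqP => [->|]; rewrite ?andbF ?andbT.
Qed.

End MinimalGenerators.

(** * Vanishing polynomials and linear substitutions *)


Lemma poly_eq0_off0 (K : numFieldType) (p : {poly K}) :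
  (forall c, c != 0 -> p.[c] = 0) -> p = 0.
Proof.
move=> p0; apply: contraTeq isT => nz_p; apply/negP => _.
pose rs : seq K := [seq i.+1%:R | i <- iota 0 (size p)].
have := @max_poly_roots _ p rs nz_p; rewrite size_map size_iota ltnn => roots.
suff : false by []. apply: roots.
  by apply/allP => _ /mapP[i _ ->]; rewrite rootE p0 // pnatr_eq0.
by rewrite map_inj_uniq ?iota_uniq // => i j /eqP; rewrite eqr_nat eqSS => /eqP.
Qed.

(** The variables are separated one at a time: by induction on k, the terms of p whose first k
    exponents agree with those of m0 still sum to zero at all points of the torus. For k = n only
    the term at m0 is left. *)
Lemma mpoly_eq0_torus (K : numFieldType) n (p : {mpoly K[n]}) :
  (forall v, (forall i, v i != 0) -> p.@[v] = 0) -> p = 0.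
Proof.
move=> p0; apply/mpolyP => m0; rewrite mcoeff0.
pose agree k (m : 'X_{1..n}) := [forall i : 'I_n, (i < k)%N ==> (m i == m0 i)].
suff /(_ n (leqnn n)) /(_ (fun=> 1)) : forall k, (k <= n)%N ->
    forall v, (forall i, v i != 0) ->
    \sum_(m <- msupp p | agree k m) p@_m * \prod_i v i ^+ m i = 0.
  move=> sum0; have [m0p|/memN_msupp_eq0//] := boolP (m0 \in msupp p).
  rewrite -sum0; last by move=> _; apply: oner_neq0.
  rewrite big_mkcond (bigD1_seq m0) ?msupp_uniq //= [X in _ + X]big1 ?addr0.
    rewrite ifT; last by apply/forallP => i; rewrite eqxx implybT.
    by rewrite big1 ?mulr1 // => i _; rewrite expr1n.
  move=> m nm; rewrite ifN //; apply: contra nm => /forallP eqm.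
  by apply/eqP/mnmP => i; have := eqm i; rewrite ltn_ord => /eqP.
elim=> [_ v v0|k IHk lt_kn v v0].
  rewrite -[RHS](p0 v v0) mevalE; apply: eq_bigl => m.
  by apply/forallP.
pose ik := Ordinal lt_kn.
(* The sum for k, seen as a polynomial in the k-th coordinate alone. It vanishes off 0, hence
   identically, and its coefficient of index m0 k gives the sum for k + 1. *)
pose q : {poly K} := \sum_(m <- msupp p | agree k m)
   (p@_m * \prod_(i | i != ik) v i ^+ m i) *: 'X^(m ik).
have q0 : q = 0.
  apply: poly_eq0_off0 => c c0; pose vc i := if i == ik then c else v i.
  rewrite -[RHS](IHk (ltnW lt_kn) vc) => [|i]; last by rewrite /vc; case: ifP.
  rewrite horner_sum; apply: eq_bigr => m _.
  rewrite hornerZ hornerXn [in RHS](bigD1 ik) //= /vc eqxx -mulrA [_ * c ^+ _]mulrC.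
  by congr (_ * (_ * _)); apply: eq_bigr => i /negPf->.
have := congr1 (fun q : {poly K} => q`_(m0 ik) * v ik ^+ m0 ik) q0.
rewrite coef0 mul0r coef_sum mulr_suml => qk.
rewrite -[RHS]qk big_mkcond [RHS]big_mkcond; apply: eq_bigr => m _.
rewrite coefZ coefXn.
have -> : agree k.+1 m = agree k m && (m0 ik == m ik).
  apply/forallP/andP => [agr|[/forallP agr /eqP Em] i].
    split; last by have := agr ik; rewrite /= leqnn eq_sym.
    by apply/forallP => i; apply/implyP => lt_ik; have := agr i; rewrite ltnS ltnW.
  rewrite ltnS leq_eqVlt; apply/implyP => /orP[/eqP ei|lt_ik].
    by rewrite (_ : i = ik) ?Em //; apply: val_inj.
  by have := agr i; rewrite lt_ik.
case: (agree k m) => //=; case: eqP => [->|_]; last by rewrite mulr0 mul0r.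
by rewrite mulr1 (bigD1 ik) //= -mulrA; congr (_ * _); rewrite mulrC.
Qed.

Lemma mpoly_eq_meval (K : numFieldType) n (p q : {mpoly K[n]}) :
  (forall v, p.@[v] = q.@[v]) -> p = q.
Proof.
move=> pq; apply/eqP; rewrite -subr_eq0; apply/eqP/mpoly_eq0_torus => v _.
by rewrite mevalB pq subrr.
Qed.

Lemma big_mxvec_index (V : Type) (idx : V) (op : Monoid.com_law idx) p q
    (F : 'I_(p * q) -> V) :
  \big[op/idx]_e F e = \big[op/idx]_k \big[op/idx]_j F (mxvec_index k j).
Proof.
by rewrite (reindex _ (curry_mxvec_bij _ _)) pair_bigA; apply: eq_bigr => -[].
Qed.

(** As a function of the eight scaling factors s, the value of f at the rescaled point is a
    polynomial whose coefficient at s^d is the value at P of the component of degree d. *)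
Lemma eval_at_component (K : numFieldType) (f : uv_ring K) (P : coords K) d :
  (forall s : 'I_(4 + 4) -> K, (forall k, s k != 0) ->
     eval_at (\matrix_(k, j) (s k * P k j)) f = 0) ->
  eval_at P (component d f) = 0.
Proof.
move=> f0; pose w m := f@_m * \prod_e mxvec P 0 e ^+ m e.
pose q : {mpoly K[8]} := \sum_(m <- msupp f) w m *: 'X_[[multinom multidegree m]].
have q0 : q = 0.
  apply: mpoly_eq0_torus => s s0; rewrite -[RHS](f0 s s0) /eval_at [RHS]mevalE.
  rewrite /q raddf_sum; apply: eq_bigr => m _ /=; rewrite mevalZ mevalX -mulrA.
  congr (_ * _); rewrite !big_mxvec_index -big_split; apply: eq_bigr => k _ /=.
  rewrite mnm_tnth multidegreeE expr_sum -big_split; apply: eq_bigr => j _ /=.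
  by rewrite !mxvecE mxE exprMn mulrC.
have := congr1 (fun q => q@_[multinom d]) q0.
rewrite mcoeff0 /q raddf_sum /= => qd; rewrite -[RHS]qd /eval_at raddf_sum /=.
rewrite big_mkcond; apply: eq_bigr => m _; rewrite mcoeffZ mcoeffX.
rewrite (_ : (_ == _) = (multidegree m == d)); last first.
  by apply/eqP/eqP => [/(congr1 val)|->].
case: eqP => _; last by rewrite mulr0.
by rewrite mevalZ mevalX mulr1.
Qed.

Section MapEval.
Variables (R S : comNzRingType) (f : {rmorphism R -> S}).

Lemma meval_map_mpolyE n (v : 'I_n -> S) (p : {mpoly R[n]}) :
  (map_mpoly f p).@[v] = \sum_(m <- msupp p) f p@_m * \prod_i v i ^+ m i.
Proof.
rewrite {1}[p]mpolyE (raddf_sum (map_mpoly f)) (raddf_sum (meval v)) /=.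
apply: eq_bigr => m _.
by rewrite map_mpolyZ map_mpolyX mevalZ mevalX.
Qed.

Lemma meval_map_comp n k (v : 'I_k -> S) (t : n.-tuple {mpoly R[k]}) p :
  (map_mpoly f (p \mPo t)).@[v]
    = (map_mpoly f p).@[fun i => (map_mpoly f (tnth t i)).@[v]].
Proof.
rewrite [RHS]meval_map_mpolyE comp_mpolyEX (raddf_sum (map_mpoly f)) (raddf_sum (meval v)) /=.
apply: eq_bigr => m _.
rewrite map_mpolyZ mevalZ comp_mpolyX rmorph_prod rmorph_prod /=; congr (_ * _).
by apply: eq_bigr => i _; rewrite !rmorphXn.
Qed.

End MapEval.

(** * Linear changes of coordinates, row by row *)

Section BlockSubstitution.
Variables (R : comNzRingType) (p q : nat).
Implicit Types (M : 'I_p -> 'M[R]_q) (f : {mpoly R[p * q]}).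

Definition block_form M k j : {mpoly R[p * q]} :=
  \sum_j' M k j j' *: 'X_(mxvec_index k j').

(* f(P) becomes f(P'), where the k-th row of P' is M_k times the k-th row of P. *)
Definition block_subst M f : {mpoly R[p * q]} :=
  f \mPo [tuple mxvec (\matrix_(k, j) block_form M k j) 0 e | e < p * q].

Lemma block_substD M : {morph block_subst M : f g / f + g}.
Proof. by move=> f g; rewrite /block_subst raddfD. Qed.

Lemma block_substM M : {morph block_subst M : f g / f * g}.
Proof. by move=> f g; rewrite /block_subst rmorphM. Qed.

Lemma block_substZ M a f : block_subst M (a *: f) = a *: block_subst M f.
Proof. exact: comp_mpolyZ. Qed.

Lemma block_subst0 M : block_subst M 0 = 0.
Proof. by rewrite /block_subst raddf0. Qed.

Lemma block_subst1 M : block_subst M 1 = 1.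
Proof. by rewrite /block_subst rmorph1. Qed.

Lemma block_subst_sum M (I : Type) (r : seq I) (P : pred I) F :
  block_subst M (\sum_(i <- r | P i) F i) = \sum_(i <- r | P i) block_subst M (F i).
Proof. exact: (big_morph _ (@block_substD M) (block_subst0 M)). Qed.

Lemma block_substXU M k j : block_subst M 'X_(mxvec_index k j) = block_form M k j.
Proof. by rewrite /block_subst comp_mpolyXU -tnth_nth tnth_mktuple mxvecE mxE. Qed.

Lemma meval_block_subst (S : comNzRingType) (phi : {rmorphism R -> S}) M f
    (P : 'M[S]_(p, q)) :
  (map_mpoly phi (block_subst M f)).@[mxvec P 0]
    = (map_mpoly phi f).@[mxvec (\matrix_k (row k P *m (map_mx phi (M k))^T)) 0].
Proof.
rewrite meval_map_comp; apply: meval_eq => e; case/mxvec_indexP: e => k j.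
rewrite tnth_mktuple !mxvecE !mxE (raddf_sum (map_mpoly phi)).
rewrite (raddf_sum (meval _)) /=; apply: eq_bigr => j' _.
by rewrite map_mpolyZ mevalZ map_mpolyX mevalXU mxvecE !mxE mulrC.
Qed.

(** The substituted linear forms have no constant term. This is what lets [nakayama_free] survive a
    change of coordinates. *)
Lemma mcoeff0_block_subst M f : (block_subst M f)@_0%MM = f@_0%MM.
Proof.
rewrite {1}[f]mpolyE block_subst_sum [f in RHS]mpolyE !(raddf_sum (mcoeff _)) /=.
apply: eq_bigr => m _; rewrite block_substZ !mcoeffZ; congr (_ * _).
rewrite /block_subst comp_mpolyX mcoeffX rmorph_prod /=.
have form0 e : (tnth [tuple mxvec (\matrix_(k, j) block_form M k j) 0 e
    | e < p * q] e)@_0%MM = 0.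
  case/mxvec_indexP: e => k j; rewrite tnth_mktuple mxvecE mxE raddf_sum big1 //=.
  by move=> i _; rewrite mcoeffZ mcoeffX mnm1_eq0 mulr0.
case: eqP => [->|m0]; first by rewrite big1 // => e _; rewrite mnm0E expr0 rmorph1.
have [e me] : exists e, m e != 0%N.
  apply/existsP; apply: contra_notT m0; rewrite negb_exists => /forallP m0.
  by apply/mnmP => e; have := m0 e; rewrite negbK mnm0E => /eqP.
by rewrite (bigD1 e) //= rmorphXn /= form0 expr0n (negPf me) mul0r.
Qed.

End BlockSubstitution.

Lemma map_mpoly_id (K : comNzRingType) n (p : {mpoly K[n]}) : map_mpoly idfun p = p.
Proof. by apply/mpolyP => m; rewrite mcoeff_map_mpoly. Qed.

Lemma mpoly_eq_mxeval (K : numFieldType) p q (f g : {mpoly K[p * q]}) :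
  (forall P : 'M_(p, q), f.@[mxvec P 0] = g.@[mxvec P 0]) -> f = g.
Proof.
move=> fg; apply: mpoly_eq_meval => v; have := fg (vec_mx (\row_e v e)).
by rewrite vec_mxK !(@meval_eq _ _ _ v) // => e; rewrite mxE.
Qed.

Lemma meval_block_subst_id (K : comNzRingType) p q (M : 'I_p -> 'M[K]_q) f
    (P : 'M[K]_(p, q)) :
  (block_subst M f).@[mxvec P 0] = f.@[mxvec (\matrix_k (row k P *m (M k)^T)) 0].
Proof.
rewrite -[block_subst M f]map_mpoly_id -[in RHS](map_mpoly_id f).
rewrite (meval_block_subst idfun); apply: meval_eq => e.
congr (fun_of_matrix (mxvec _) 0 e); apply/row_matrixP => k; rewrite !rowK.
by rewrite map_mx_id.
Qed.

(** Both sides are compared at all points, where a substitution multiplies each row by a transposed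
    matrix; this gives the order [N k *m M k]. *)
Lemma block_subst_comp (K : numFieldType) p q (M N : 'I_p -> 'M[K]_q)
    (f : {mpoly K[p * q]}) :
  block_subst M (block_subst N f) = block_subst (fun k => N k *m M k) f.
Proof.
apply: mpoly_eq_mxeval => P; rewrite !meval_block_subst_id; apply: meval_eq => e.
congr (fun_of_matrix (mxvec _) 0 e); apply/row_matrixP => k; rewrite !rowK.
by rewrite trmx_mul mulmxA.
Qed.

Lemma block_substK (K : numFieldType) p q (M N : 'I_p -> 'M[K]_q) :
  (forall k, N k *m M k = 1%:M) -> cancel (block_subst N) (block_subst M).
Proof.
move=> NM f; rewrite block_subst_comp; apply: mpoly_eq_mxeval => P.
rewrite meval_block_subst_id; apply: meval_eq => e.
congr (fun_of_matrix (mxvec _) 0 e); apply/row_matrixP => k.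
by rewrite rowK NM trmx1 mulmx1.
Qed.

Lemma mxvec_index_inj p q (k k' : 'I_p) (j j' : 'I_q) :
  mxvec_index k j = mxvec_index k' j' -> (k, j) = (k', j').
Proof. by move/cast_ord_inj/enum_rank_inj. Qed.

Section BlockSubstGraded.
Variable K : comNzRingType.
Implicit Types (M : 'I_(4 + 4) -> 'M[K]_3) (f : uv_ring K).

Lemma multidegree_var (k : 'I_(4 + 4)) j :
  multidegree U_(mxvec_index k j)%MM = [tuple (k == l :> nat) : nat | l < 8].
Proof.
apply: eq_from_tnth => l; rewrite multidegreeE tnth_mktuple.
rewrite (eq_bigr (fun j' => ((k == l :> nat) && (j == j')) : nat)).
  rewrite (bigD1 j) //= eqxx andbT big1 ?addn0 // => j' /negPf.
  by rewrite eq_sym => ->; rewrite andbF.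
move=> j' _; rewrite mnm1E; congr nat_of_bool.
apply/eqP/andP => [/mxvec_index_inj[-> ->] //|[/eqP kl /eqP->]].
by congr mxvec_index; apply: val_inj.
Qed.

Lemma is_multihomog1 : is_multihomog [tuple 0%N | k < 8] (1 : uv_ring K).
Proof.
apply/is_multihomogP => m; rewrite mcoeff1; case: (m =P 0%MM) => [->|_].
  by rewrite multidegree0.
by rewrite eqxx.
Qed.

Lemma is_multihomog_block_subst M d f :
  is_multihomog d f -> is_multihomog d (block_subst M f).
Proof.
move/is_multihomogP => homf; rewrite [f]mpolyE block_subst_sum.
apply: is_multihomog_sum => m; rewrite mcoeff_msupp => /homf <- _.
rewrite block_substZ; apply: is_multihomogZ.
have [n] := ubnP (mdeg m); elim: n m => // n IHn m lt_mn.
have [->|nz_m] := eqVneq m 0%MM.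
  by rewrite mpolyX0 block_subst1 multidegree0 is_multihomog1.
have [e me] : exists e, m e != 0%N.
  apply/existsP; apply: contraR nz_m; rewrite negb_exists => /forallP m0.
  by apply/eqP/mnmP => e; have := m0 e; rewrite negbK mnm0E => /eqP.
have /submK Dm : (U_(e) <= m)%MM by rewrite lep1mP.
rewrite -Dm addmC mpolyXD multidegreeD block_substM.
apply: is_multihomogM; last first.
  by apply: IHn; move: lt_mn; rewrite -{1}Dm mdegD mdeg1 addn1.
case/mxvec_indexP: e {me Dm} => k j; rewrite block_substXU.
apply: is_multihomog_sum => j' _ _; apply: is_multihomogZ.
by rewrite multidegree_var -(multidegree_var k j') is_multihomogX.
Qed.

Lemma component_block_subst M d f :
  component d (block_subst M f) = block_subst M (component d f).
Proof.
rewrite {1}[f]sum_component block_subst_sum component_sum.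
set s := undup _; transitivity (\sum_(e <- s) if e == d
    then block_subst M (component d f) else 0).
  apply: eq_bigr => e _; have homMf := is_multihomog_block_subst M (is_multihomog_component e f).
  case: eqP homMf => [->|ne] homMf; first exact: component_id.
  apply/mpolyP => m; rewrite mcoeff_component mcoeff0; case: eqP => // dm.
  by apply/eqP; apply: contra_notT ne => /(is_multihomogP _ _ homMf) <-.
case: (boolP (d \in s)) => [ds|].
  by rewrite (bigD1_seq d) ?undup_uniq //= eqxx big1 ?addr0 // => e /negPf->.
by rewrite mem_undup => /component_eq0->; rewrite block_subst0 big1 // => e; rewrite if_same.
Qed.

End BlockSubstGraded.

(** * The ideal of the quadric *)


Section SetVariableToZero.
Variables (R : comNzRingType) (n : nat) (i : 'I_n).
Implicit Types p : {mpoly R[n]}.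

Definition set_var0 p : {mpoly R[n]} :=
  p \mPo [tuple if j == i then 0 else 'X_j | j < n].

Lemma set_var0D : {morph set_var0 : p q / p + q}.
Proof. by move=> p q; rewrite /set_var0 raddfD. Qed.

Lemma set_var0M : {morph set_var0 : p q / p * q}.
Proof. by move=> p q; rewrite /set_var0 rmorphM. Qed.

Lemma set_var0X j : set_var0 'X_j = if j == i then 0 else 'X_j.
Proof. by rewrite /set_var0 comp_mpolyXU -tnth_nth tnth_mktuple. Qed.

Lemma meval_set_var0 (S : comNzRingType) (phi : {rmorphism R -> S}) v p :
  (map_mpoly phi (set_var0 p)).@[v]
    = (map_mpoly phi p).@[fun j => if j == i then 0 else v j].
Proof.
rewrite meval_map_comp; apply: meval_eq => j; rewrite tnth_mktuple.
by case: eqP => _; rewrite ?rmorph0 ?meval0 // map_mpolyX mevalXU.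
Qed.

Lemma set_var0_dvd p : exists q, p = set_var0 p + 'X_i * q.
Proof.
elim/mpolyind: p => [|c m p _ _ [q IHp]].
  by exists 0; rewrite /set_var0 raddf0 mulr0 addr0.
suff [r Dr] : exists r, 'X_[m] = set_var0 'X_[m] + 'X_i * r.
  exists (c *: r + q); rewrite set_var0D {1}IHp {1}Dr /set_var0 comp_mpolyZ.
  by rewrite scalerDr -!mul_mpolyC; ring.
have [mi0|mi] := eqVneq (m i) 0%N.
  exists 0; rewrite mulr0 addr0 /set_var0 comp_mpolyX [LHS]mpolyXE_id.
  apply: eq_bigr => j _; rewrite tnth_mktuple; case: eqP => // ->.
  by rewrite mi0 !expr0.
exists 'X_[m - U_(i)]; rewrite /set_var0 comp_mpolyX (bigD1 i) //= tnth_mktuple.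
rewrite eqxx expr0n (negPf mi) mul0r add0r -mpolyXD addmC submK //.
by rewrite lep1mP.
Qed.

(** Independence of X_i as invariance under X_i := 0, a form that passes to sums and products
    because [set_var0] is a ring morphism. *)
Definition var_free p := set_var0 p = p.

Lemma var_freeD p q : var_free p -> var_free q -> var_free (p + q).
Proof. by rewrite /var_free set_var0D => -> ->. Qed.

Lemma var_freeM p q : var_free p -> var_free q -> var_free (p * q).
Proof. by rewrite /var_free set_var0M => -> ->. Qed.

Lemma var_freeC c : var_free c%:MP.
Proof. exact: comp_mpolyC. Qed.

Lemma var_freeN p : var_free p -> var_free (- p).
Proof. by rewrite /var_free /set_var0 raddfN /= => ->. Qed.

Lemma var_freeB p q : var_free p -> var_free q -> var_free (p - q).
Proof. by move=> fp fq; apply: var_freeD (var_freeN fq). Qed.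

Lemma var_freeX j : j != i -> var_free 'X_j.
Proof. by rewrite /var_free set_var0X => /negPf->. Qed.

Lemma var_free_exp p k : var_free p -> var_free (p ^+ k).
Proof.
move=> fp; elim: k => [|k IHk]; first by rewrite expr0 -mpolyC1; apply: var_freeC.
by rewrite exprS; apply: var_freeM.
Qed.

Lemma meval_var_free (S : comNzRingType) (phi : {rmorphism R -> S}) v w p :
  var_free p -> (forall j, j != i -> v j = w j) ->
  (map_mpoly phi p).@[v] = (map_mpoly phi p).@[w].
Proof.
move=> <- vw; rewrite !meval_set_var0; apply: meval_eq => j.
by case: eqP => // /eqP /vw.
Qed.

End SetVariableToZero.

(** Setting X_i to 0 shows that X_i divides H, as Q stays nonzero; one factor X_i is cancelled at a
    time. *)
Lemma mpolyX_cancel (K : fieldType) n (i : 'I_n) k (F Q H : {mpoly K[n]}) :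
  set_var0 i Q != 0 -> 'X_i ^+ k * F = Q * H -> exists H', F = Q * H'.
Proof.
move=> Q0; elim: k H => [|k IHk] H; first by rewrite expr0 mul1r; exists H.
rewrite exprS -mulrA => E.
have : set_var0 i (Q * H) = 0 by rewrite -E set_var0M set_var0X eqxx mul0r.
rewrite set_var0M => /eqP; rewrite mulf_eq0 (negPf Q0) /= => /eqP H0.
have [H' DH] := set_var0_dvd i H; rewrite H0 add0r in DH.
apply: (IHk H'); apply: (@mulfI _ 'X_i).
  by apply/eqP => /(congr1 (mcoeff U_(i))); rewrite mcoeffX mcoeff0 eqxx => /eqP; rewrite oner_eq0.
by rewrite E DH mulrCA.
Qed.

Definition Xv (R : nzRingType) i : {mpoly R[2 * 4]} := 'X_(mxvec_index 0 i).
Definition Yv (R : nzRingType) i : {mpoly R[2 * 4]} := 'X_(mxvec_index 1 i).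

Definition rigid_poly (R : comNzRingType) : {mpoly R[2 * 4]} :=
  rigidQ (\col_i Xv R i) (\col_i Yv R i).

Lemma rigidQ_rmorph (R S : comNzRingType) (phi : {rmorphism R -> S}) X Y :
  phi (rigidQ X Y) = rigidQ (map_mx phi X) (map_mx phi Y).
Proof. by rewrite /rigidQ !mxE !(rmorphB, rmorphD, rmorphXn, rmorphM). Qed.

Lemma meval_rigid_poly (R S : comNzRingType) (phi : {rmorphism R -> S})
    (P : 'M[S]_(2, 4)) :
  (map_mpoly phi (rigid_poly R)).@[mxvec P 0] = rigidQ (row 0 P)^T (row 1 P)^T.
Proof.
rewrite !rigidQ_rmorph; congr rigidQ; apply/colP => i.
  by rewrite !mxE /Xv /= map_mpolyX mevalXU mxvecE.
by rewrite !mxE /Yv /= map_mpolyX mevalXU mxvecE.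
Qed.

Section PseudoDivision.
Variable R : comNzRingType.
Local Notation x := (Xv R). Local Notation y := (Yv R).
Local Notation x0free := (@var_free R (2 * 4) (mxvec_index 0 0)).

(** The discriminant of Q in x_0 up to the factor 4 y_3^2: the roots of Q are x_0 = (y_0 x_3 + s) /
    y_3 with s^2 equal to this polynomial. *)
Definition x0_coef : {mpoly R[2 * 4]} :=
  x 3 ^+ 2 * y 3 ^+ 2 - (x 1 * y 3 - y 1 * x 3) ^+ 2 - (x 2 * y 3 - y 2 * x 3) ^+ 2.

Lemma rigid_polyE : rigid_poly R = (x 0 * y 3 - y 0 * x 3) ^+ 2 - x0_coef.
Proof. by rewrite /rigid_poly /rigidQ !mxE /x0_coef; ring. Qed.

Lemma x0free_var s l : (s, l) != (0, 0) -> x0free 'X_(mxvec_index s l).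
Proof.
move=> sl; apply: var_freeX; apply: contraNneq sl => /mxvec_index_inj.
by case=> -> ->.
Qed.

Lemma x0free_coef : x0free x0_coef.
Proof.
by do ![apply: var_freeB | apply: var_freeM | apply: var_free_exp | apply: x0free_var].
Qed.

(* x0 occurs in Q with leading term y3^2 x0^2 *)
Lemma pseudo_division F : exists k H r1 r0,
  [/\ y 3 ^+ k * F = rigid_poly R * H + r1 * x 0 + r0, x0free r1 & x0free r0].
Proof.
have freey i : x0free (y i) by apply: x0free_var.
have freex i : i != 0 -> x0free (x i) by move=> i0; apply: x0free_var.
pose P F := exists k H r1 r0,
  [/\ y 3 ^+ k * F = rigid_poly R * H + r1 * x 0 + r0, x0free r1 & x0free r0].
have PC c : P c%:MP.
  exists 0%N, 0, 0, c%:MP; rewrite expr0; split; last exact: var_freeC.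
    by ring.
  by rewrite -mpolyC0; apply: var_freeC.
have PD F1 F2 : P F1 -> P F2 -> P (F1 + F2).
  move=> [k [H [r1 [r0 [E fr1 fr0]]]]] [k' [H' [r1' [r0' [E' fr1' fr0']]]]].
  exists (k + k')%N, (y 3 ^+ k' * H + y 3 ^+ k * H').
  exists (y 3 ^+ k' * r1 + y 3 ^+ k * r1'), (y 3 ^+ k' * r0 + y 3 ^+ k * r0').
  split; try by do ![apply: var_freeD | apply: var_freeM | apply: var_free_exp].
  rewrite exprD mulrDr [_ * F1]mulrAC E -[_ * _ * F2]mulrA E'; ring.
have PM e F1 : P F1 -> P ('X_e * F1).
  move=> [k [H [r1 [r0 [E fr1 fr0]]]]].
  have [->|ne] := eqVneq e (mxvec_index 0 0); last first.
    exists k, ('X_e * H), ('X_e * r1), ('X_e * r0).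
    have fe := var_freeX R ne.
    split; try exact: var_freeM.
    by rewrite mulrCA E; ring.
  (* The product of x_0 with r1 x_0 + r0 is brought back to degree 1 by y_3^2 x_0^2 = Q + 2 y_0 x_3
     y_3 x_0 + [x0_coef] - (y_0 x_3)^2, at the price of two more factors y_3. *)
  exists k.+2, (y 3 ^+ 2 * x 0 * H + r1).
  exists (2%:R * y 0 * x 3 * y 3 * r1 + y 3 ^+ 2 * r0).
  exists (r1 * (x0_coef - (y 0 * x 3) ^+ 2)).
  have free2 : x0free 2%:R by rewrite -mpolyC_nat; apply: var_freeC.
  split; first last.
  - by do ![apply: var_freeM => // | apply: var_freeB | apply: var_free_exp
             | apply: freex | apply: x0free_coef].
  - by do ![apply: var_freeD | apply: var_freeM => // | apply: var_free_exp | apply: freex].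
  transitivity (y 3 ^+ 2 * x 0 * (y 3 ^+ k * F1)); first by rewrite !exprS /x; ring.
  rewrite E rigid_polyE /x; ring.
rewrite -/(P F); elim/mpolyind: F => [|c m F _ _ PF].
  by rewrite -mpolyC0; apply: PC.
apply: PD PF; rewrite -mul_mpolyC mulrC mpolyXE_id.
elim: (index_enum _) => [|e r IHr]; first by rewrite big_nil mul1r; apply: PC.
rewrite big_cons -mulrA; elim: (m e) => [|k IHk]; first by rewrite expr0 mul1r.
by rewrite exprS -mulrA; apply: PM.
Qed.

End PseudoDivision.


Lemma meval_map_point (R S : comNzRingType) (phi : {rmorphism R -> S}) p q f
    (P : 'M[R]_(p, q)) :
  (map_mpoly phi f).@[mxvec (map_mx phi P) 0] = phi f.@[mxvec P 0].
Proof.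
rewrite meval_map_mpolyE mevalE rmorph_sum; apply: eq_bigr => m _.
rewrite rmorphM rmorph_prod; congr (_ * _); apply: eq_bigr => e _.
by rewrite rmorphXn -map_mxvec mxE.
Qed.

(** The polynomial g cuts out the points of V(Q) at which nothing is known about F. It must not
    involve x_0, so that both points over a choice of the other coordinates satisfy the hypothesis
    at once. These points may be complex even when the other coordinates are real. *)
Lemma rigid_nullstellensatz (R : rcfType) (F g : {mpoly R[2 * 4]}) :
    g != 0 -> var_free (mxvec_index 0 0) g ->
    (forall P : 'M[complex R]_(2, 4), rigidQ (row 0 P)^T (row 1 P)^T = 0 ->
       (map_mpoly (real_complex R) g).@[mxvec P 0] != 0 ->
       (map_mpoly (real_complex R) F).@[mxvec P 0] = 0) ->
  exists H, F = rigid_poly R * H.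
Proof.
move=> g0 freeg F0; pose phi : {rmorphism R -> complex R} := real_complex R.
pose ev (P : 'M[complex R]_(2, 4)) p := (map_mpoly phi p).@[mxvec P 0].
have [k [H [r1 [r0 [E fr1 fr0]]]]] := pseudo_division F.
(* Where h does not vanish, the equation can be solved for x_0, its two roots are distinct, and g is
   nonzero at both points. *)
pose h := Yv R 3 * x0_coef R * g.
have h0 : h != 0.
  rewrite !mulf_neq0 //.
    by apply/eqP => /(congr1 (mcoeff U_(mxvec_index 1 3)));
      rewrite mcoeffX mcoeff0 eqxx => /eqP; rewrite oner_eq0.
  (* At X = Y = e_3 the polynomial [x0_coef] has the value 1. *)
  pose P : 'M[R]_(2, 4) := \matrix_(s, l) (l == 3)%:R.
  apply/eqP => /(congr1 (meval (mxvec P 0))).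
  rewrite !(mevalB, mevalM, rmorphXn) /= !mevalXU !mxvecE !mxE meval0 /=.
  by move/eqP; rewrite !(mulr0, mulr1, mul0r, expr1n, subr0, expr0n) oner_eq0.
suff r0_van : r1 = 0 /\ r0 = 0.
  move: E; rewrite r0_van.1 r0_van.2 mul0r !addr0; apply: mpolyX_cancel.
  (* The powers of y_3 can be cancelled because Q is nonzero modulo y_3: it has the value 1 at X =
     e_3, Y = e_0. *)
  pose P : 'M[R]_(2, 4) := \matrix_(s, l) if s == 0 then (l == 3)%:R else (l == 0)%:R.
  apply/eqP => /(congr1 (fun p => (map_mpoly idfun p).@[mxvec P 0])).
  rewrite (meval_set_var0 _ idfun) raddf0 meval0.
  rewrite (@meval_eq _ _ _ (mxvec P 0)) => [|e]; last first.
    by case: eqP => // ->; rewrite mxvecE mxE.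
  rewrite (meval_rigid_poly idfun) /rigidQ !mxE /= => /eqP.
  by rewrite !(mulr0, mulr1, mul0r, sub0r, sqrrN, expr1n, subr0, oppr0, expr0n, addr0) oner_eq0.
have r_van (W : 'M[R]_(2, 4)) : h.@[mxvec W 0] != 0 ->
    r1.@[mxvec W 0] = 0 /\ r0.@[mxvec W 0] = 0.
  rewrite /h !mevalM !mulf_eq0 !negb_or => /andP[/andP[y0 c0] gW0].
  pose P z : 'M[complex R]_(2, 4) :=
    \matrix_(s, l) if (s, l) == (0, 0) then z else phi (W s l).
  have evfree z p : var_free (mxvec_index 0 0) p -> ev (P z) p = phi p.@[mxvec W 0].
    move=> fp; rewrite -meval_map_point; apply: meval_var_free fp _ => e.
    case/mxvec_indexP: e => s l ne; rewrite !mxvecE !mxE.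
    by case: ((s, l) =P (0, 0)) ne => [[-> ->]|//]; rewrite eqxx.
  have evX z : ev (P z) (Xv R 0) = z.
    by rewrite /ev /Xv map_mpolyX mevalXU mxvecE mxE eqxx.
  have freey i : var_free (mxvec_index 0 0) (Yv R i) by apply: x0free_var.
  have freex i : i != 0 -> var_free (mxvec_index 0 0) (Xv R i).
    by move=> i0; apply: x0free_var; rewrite xpair_eqE.
  have evM z p q : ev (P z) (p * q) = ev (P z) p * ev (P z) q.
    by rewrite /ev !rmorphM.
  have evD z p q : ev (P z) (p + q) = ev (P z) p + ev (P z) q.
    by rewrite /ev !rmorphD.
  have evB z p q : ev (P z) (p - q) = ev (P z) p - ev (P z) q.
    by rewrite /ev !rmorphB.
  have evXn z p n : ev (P z) (p ^+ n) = ev (P z) p ^+ n by rewrite /ev !rmorphXn.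
  pose a := phi (Yv R 3).@[mxvec W 0]; pose b := phi (Yv R 0 * Xv R 3).@[mxvec W 0].
  pose c := phi (x0_coef R).@[mxvec W 0].
  have a0 : a != 0 by rewrite fmorph_eq0.
  have c0' : c != 0 by rewrite fmorph_eq0.
  have root_eq z : (z * a - b) ^+ 2 = c ->
      phi r1.@[mxvec W 0] * z + phi r0.@[mxvec W 0] = 0.
    move=> zc; have Q0 : ev (P z) (rigid_poly R) = 0.
      rewrite rigid_polyE evB evXn evB evM evX (evfree _ _ (freey 3)).
      rewrite (evfree _ (Yv R 0 * _)); last by apply: var_freeM => //; apply: freex.
      by rewrite (evfree _ _ (x0free_coef R)) zc subrr.
    have FP0 : ev (P z) F = 0.
      apply: F0; first by rewrite -(meval_rigid_poly phi).
      by rewrite [X in X != 0](evfree z g freeg) fmorph_eq0.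
    have /(congr1 (ev (P z))) := E; rewrite evM FP0 mulr0 !evD !evM Q0 mul0r add0r.
    by rewrite evX !evfree.
  (* The linear remainder vanishes at (b + s) / a and (b - s) / a; the difference of the two values
     is 2 s / a times its leading coefficient. *)
  pose s := sqrtC c; have s0 : s != 0 by rewrite sqrtC_eq0.
  have ra := root_eq ((b + s) / a); have rb := root_eq ((b - s) / a).
  have {ra} := ra _; rewrite divfK // [b + s]addrC addrK sqrtCK => /(_ erefl) ra.
  have {rb} := rb _; rewrite divfK // [b - s]addrC addrK sqrrN sqrtCK => /(_ erefl) rb.
  have r10 : phi r1.@[mxvec W 0] = 0.
    have /eqP : phi r1.@[mxvec W 0] * (2%:R * s / a) = 0.
      by rewrite -[RHS](subrr 0) -{1}ra -rb; field.
    rewrite mulf_eq0 => /orP[/eqP//|].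
    by rewrite !mulf_eq0 invr_eq0 pnatr_eq0 (negPf s0) (negPf a0).
  move: ra; rewrite r10 mul0r add0r => /eqP; rewrite fmorph_eq0 => /eqP->.
  by move/eqP: r10; rewrite fmorph_eq0 => /eqP->.
split.
  suff /eqP : r1 * h = 0 by rewrite mulf_eq0 (negPf h0) orbF => /eqP.
  apply: mpoly_eq_mxeval => W; rewrite mevalM meval0.
  by have [->|/r_van[->]] := eqVneq h.@[mxvec W 0] 0; rewrite ?mulr0 ?mul0r.
suff /eqP : r0 * h = 0 by rewrite mulf_eq0 (negPf h0) orbF => /eqP.
apply: mpoly_eq_mxeval => W; rewrite mevalM meval0.
by have [->|/r_van[_ ->]] := eqVneq h.@[mxvec W 0] 0; rewrite ?mulr0 ?mul0r.
Qed.

(** * The rigid multiview ideal in camera coordinates *)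


Definition side (k : 'I_(4 + 4)) : 'I_2 := if split k is inl _ then 0 else 1.
Definition cam (k : 'I_(4 + 4)) : 'I_4 := match split k with inl i | inr i => i end.

Lemma side_lshift i : side (lshift 4 i) = 0.
Proof. by rewrite /side; case: splitP => // j /= E; have := ltn_ord i; lia. Qed.

Lemma side_rshift i : side (rshift 4 i) = 1.
Proof. by rewrite /side; case: splitP => // j /= E; have := ltn_ord j; lia. Qed.

Lemma cam_lshift i : cam (lshift 4 i) = i.
Proof.
rewrite /cam; case: splitP => j /= E; first exact/val_inj.
by have := ltn_ord i; lia.
Qed.

Lemma cam_rshift i : cam (rshift 4 i) = i.
Proof.
rewrite /cam; case: splitP => j /= E; first by have := ltn_ord j; lia.
by apply/val_inj => /=; lia.
Qed.

Definition tgt k j : 'I_(2 * 4) := mxvec_index (side k) (lift (cam k) j).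

(* The i-th camera X |-> (X_l)_(l != i) has its center at the i-th unit vector. *)
Definition coord_map (R : comNzRingType) (f : uv_ring R) : {mpoly R[2 * 4]} :=
  f \mPo [tuple mxvec (\matrix_(k, j) 'X_(tgt k j)) 0 e | e < num_vars].

Lemma meval_coord_map (R S : comNzRingType) (phi : {rmorphism R -> S}) f
    (P : 'M[S]_(2, 4)) :
  (map_mpoly phi (coord_map f)).@[mxvec P 0] =
  (map_mpoly phi f).@[mxvec (\matrix_(k, j) P (side k) (lift (cam k) j)) 0].
Proof.
rewrite meval_map_comp; apply: meval_eq => e; case/mxvec_indexP: e => k j.
by rewrite tnth_mktuple !mxvecE !mxE map_mpolyX mevalXU mxvecE.
Qed.

Lemma eval_at_scale (K : comNzRingType) d (f : uv_ring K) (P : coords K)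
    (s : 'I_(4 + 4) -> K) : is_multihomog d f ->
  eval_at (\matrix_(k, j) (s k * P k j)) f
    = (\prod_k s k ^+ tnth d (k : 'I_8)) * eval_at P f.
Proof.
move/is_multihomogP => homf; rewrite /eval_at !mevalE mulr_sumr.
apply: eq_big_seq => m; rewrite mcoeff_msupp => /homf <-.
rewrite mulrCA; congr (_ * _); rewrite !big_mxvec_index -big_split.
apply: eq_bigr => k _ /=; rewrite multidegreeE expr_sum -big_split.
by apply: eq_bigr => j _ /=; rewrite !mxvecE mxE exprMn.
Qed.

Lemma map_component (R S : comNzRingType) (phi : {rmorphism R -> S}) d f :
  map_mpoly phi (component d f) = component d (map_mpoly phi f).
Proof.
apply/mpolyP => m; rewrite mcoeff_component !mcoeff_map_mpoly mcoeff_component.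
by case: ifP => _; rewrite /= ?mcoeff_map_mpoly ?(rmorph0 phi).
Qed.

Definition linear_form (R : comNzRingType) s (l : 'rV[R]_4) : {mpoly R[2 * 4]} :=
  \sum_i l 0 i *: 'X_(mxvec_index s i).

Lemma linear_form_neq0 (R : comNzRingType) s (l : 'rV[R]_4) :
  l != 0 -> linear_form s l != 0.
Proof.
apply: contraNneq => /mpolyP l0; apply/eqP/rowP => i; rewrite mxE.
have := l0 U_(mxvec_index s i)%MM; rewrite mcoeff0 raddf_sum /= => <-.
rewrite (bigD1 i) //= mcoeffZ mcoeffX eqxx mulr1 big1 ?addr0 // => j ne.
rewrite mcoeffZ mcoeffX eq_mnm1; case: eqP => [/mxvec_index_inj[e]|_]; last by rewrite mulr0.
by rewrite e eqxx in ne.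
Qed.

Lemma meval_linear_form (R S : comNzRingType) (phi : {rmorphism R -> S}) s l
    (P : 'M[S]_(2, 4)) :
  (map_mpoly phi (linear_form s l)).@[mxvec P 0]
    = (map_mx phi l *m (row s P)^T) 0 0.
Proof.
rewrite mxE (raddf_sum (map_mpoly phi)) (raddf_sum (meval _)) /=.
by apply: eq_bigr => i _; rewrite map_mpolyZ mevalZ map_mpolyX mevalXU mxvecE !mxE.
Qed.

Lemma x0free_linear_form (R : comNzRingType) s (l : 'rV[R]_4) :
  l 0 0 = 0 -> var_free (mxvec_index 0 0) (linear_form s l).
Proof.
move=> l0; apply: big_ind => [|p q|i _]; first by rewrite -mpolyC0; apply: var_freeC.
  exact: var_freeD.
have [->|i0] := eqVneq i 0; first by rewrite l0 scale0r -mpolyC0; apply: var_freeC.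
rewrite -mul_mpolyC; apply: var_freeM; first exact: var_freeC.
by apply: x0free_var; rewrite xpair_eqE (negPf i0) andbF.
Qed.

(** Two linear conditions on four coefficients. For a camera center c, a point where the form l is
    nonzero is not a multiple of c, hence has an image under the camera; l_0 = 0 makes the form
    admissible as a factor of g in [rigid_nullstellensatz]. *)
Lemma orthogonal_row (R : fieldType) (c : 'cV[R]_4) :
  exists l : 'rV[R]_4, [/\ l != 0, l 0 0 = 0 & l *m c = 0].
Proof.
have [c1|c1] := eqVneq (c 1 0) 0.
  exists (delta_mx 0 1); rewrite mxE; split=> //.
    by apply/eqP => /rowP/(_ 1); rewrite !mxE => /eqP; rewrite oner_eq0.
  by rewrite -rowE; apply/rowP => i; rewrite !mxE ord1.
exists (c 2 0 *: delta_mx 0 1 - c 1 0 *: delta_mx 0 2); split.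
- apply/eqP => /rowP/(_ 2); rewrite !mxE /= mulr0 mulr1 sub0r => /eqP.
  by rewrite oppr_eq0 (negPf c1).
- by rewrite !mxE /= !mulr0 subr0.
rewrite mulmxBl -!scalemxAl -!rowE; apply/rowP => i; rewrite !mxE ord1.
by rewrite mulrC subrr.
Qed.

Lemma meval_mapM (R S : comNzRingType) (phi : {rmorphism R -> S}) n v
    (p q : {mpoly R[n]}) :
  (map_mpoly phi (p * q)).@[v] = (map_mpoly phi p).@[v] * (map_mpoly phi q).@[v].
Proof. by rewrite rmorphM mevalM. Qed.

Section RigidIdeal.
Variables (R : realType) (A : 'I_4 -> 'M[R]_(3, 4)) (C : 'M[R]_4)
  (G : 'I_4 -> 'M[R]_3).
Hypotheses (unitC : C \in unitmx) (unitG : forall i, G i \in unitmx).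
Hypothesis ACE : forall i, A i *m C = G i *m row' i 1%:M.

Local Notation phi := (real_complex R : {rmorphism R -> complex R}).

(* The images of X = C X' and Y = C Y', where the rows of P are X' and Y'. *)
Definition camera_point (P : 'M[complex R]_(2, 4)) : coords (complex R) :=
  \matrix_k (row (side k) P *m (map_mx phi (A (cam k) *m C))^T).

Lemma row_camera_point k P : row k (camera_point P)
  = (map_mx phi (A (cam k)) *m (map_mx phi C *m (row (side k) P)^T))^T.
Proof. by rewrite rowK map_mxM !trmx_mul trmxK mulmxA. Qed.

Lemma meval_coord_map_subst f P :
  (map_mpoly phi (coord_map (block_subst (G \o cam) f))).@[mxvec P 0]
    = eval_at (camera_point P) (map_mpoly phi f).
Proof.
rewrite (meval_coord_map phi) (meval_block_subst phi); apply: meval_eq => e.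
congr (fun_of_matrix (mxvec _) 0 e); apply/row_matrixP => k; rewrite !rowK.
rewrite ACE map_mxM trmx_mul mulmxA; congr (_ *m _); apply/rowP => j.
rewrite !mxE (bigD1 (lift (cam k) j)) //= !mxE eqxx rmorph1 mulr1.
rewrite big1 ?addr0 // => i ne; rewrite !mxE eq_sym (negPf ne).
by rewrite rmorph0 mulr0.
Qed.

Lemma meval_rigid_subst P :
  (map_mpoly phi (block_subst (fun=> C) (rigid_poly R))).@[mxvec P 0]
    = rigidQ (map_mx phi C *m (row 0 P)^T) (map_mx phi C *m (row 1 P)^T).
Proof.
rewrite (meval_block_subst phi) (meval_rigid_poly phi).
by rewrite !rowK !trmx_mul !trmxK.
Qed.

(** Backwards, every point of the image is a rescaled [camera_point], and the value there has Q as a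
    factor. Forwards, f vanishes at every rescaling of the image of a point of V(Q) outside the
    locus of an auxiliary g; this isolates the component of degree d, and the divisibility criterion
    applies. *)
Lemma rigid_idealP f :
  rigid_multiview_ideal A f <->
  forall d, exists H, coord_map (block_subst (G \o cam) (component d f))
                        = block_subst (fun=> C) (rigid_poly R) * H.
Proof.
split=> [Jf d|Jf P varP]; last first.
  rewrite [f]sum_component (raddf_sum (map_mpoly _)) /eval_at (raddf_sum (meval _)).
  apply: big1 => d _ /=; apply: (varP.2 d) => [|P' [X [Y [X0 Y0 XY imX imY]]]].
    by rewrite map_component is_multihomog_component.
  pose iC := invmx (map_mx phi C).
  have unitC' : map_mx phi C \in unitmx by rewrite map_unitmx.
  have [Q [rowQ0 rowQ1]] : exists Q : 'M[complex R]_(2, 4),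
      (row 0 Q)^T = iC *m X /\ (row 1 Q)^T = iC *m Y.
    exists (\matrix_(s, l) if s == 0 then (iC *m X) l 0 else (iC *m Y) l 0).
    by split; apply/colP => l; rewrite !mxE.
  have exs k : exists s, row k P' = s *: row k (camera_point Q).
    rewrite row_camera_point; case: (splitP k) => i Dk.
      have {Dk} -> : k = lshift 4 i by apply: val_inj.
      have [_ [s _ ->]] := imX i; exists s; congr (_ *: _).
      by rewrite side_lshift cam_lshift rowQ0 mulKVmx.
    have {Dk} -> : k = rshift 4 i by apply: val_inj.
    have [_ [s _ ->]] := imY i; exists s; congr (_ *: _).
    by rewrite side_rshift cam_rshift rowQ1 mulKVmx.
  have /fin_all_exists[s Ds] := exs.
  have -> : P' = \matrix_(k, j) (s k * camera_point Q k j).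
    by apply/matrixP => k j; have /rowP/(_ j) := Ds k; rewrite !mxE.
  have homf : is_multihomog d (map_mpoly phi (component d f)).
    by rewrite map_component is_multihomog_component.
  rewrite (eval_at_scale _ _ homf) -meval_coord_map_subst.
  rewrite [X in _ * X](_ : _ = 0) ?mulr0 //; have [H ->] := Jf d.
  apply: etrans (meval_mapM _ _ _ _) _.
  apply: etrans (congr1 (fun z => z * _) (meval_rigid_subst Q)) _.
  by rewrite rowQ0 rowQ1 !mulKVmx // XY mul0r.
pose F' := coord_map (block_subst (G \o cam) (component d f)).
(* Back in the original coordinates of space, where the quadric is [rigid_poly] itself. *)
pose F := block_subst (fun=> invmx C) F'.
have exl i : exists l : 'rV[R]_4, [/\ l != 0, l 0 0 = 0 & l *m col i C = 0].
  exact: orthogonal_row.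
have /fin_all_exists[l lP] := exl.
pose g := \prod_s \prod_i linear_form s (l i).
have [H DF] : exists H, F = rigid_poly R * H; last first.
  exists (block_subst (fun=> C) H); rewrite -block_substM -DF.
  by rewrite [RHS]block_substK // => _; rewrite mulVmx.
apply: (@rigid_nullstellensatz R F g) => [||P PQ gP].
- apply/prodf_neq0 => s _; apply/prodf_neq0 => i _.
  by apply: linear_form_neq0; have [] := lP i.
- apply: big_ind => [|p q|s _]; first by rewrite -mpolyC1; apply: var_freeC.
    exact: var_freeM.
  apply: big_ind => [|p q|i _]; first by rewrite -mpolyC1; apply: var_freeC.
    exact: var_freeM.
  by apply: x0free_linear_form; have [] := lP i.
have camP_neq0 s i : map_mx phi (A i) *m (row s P)^T != 0.
  have : (map_mpoly phi (linear_form s (l i))).@[mxvec P 0] != 0.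
    apply: contraNneq gP => gi0; rewrite /g (bigD1 s) //= (bigD1 i) //=.
    by rewrite !rmorphM /= -!mulrA [X in X * _](gi0) mul0r.
  apply: contraNneq => AP0; rewrite meval_linear_form.
  have unitC' : map_mx phi C \in unitmx by rewrite map_unitmx.
  have [l0 l00 lC] := lP i.
  have [X' DX] : exists X', (row s P)^T = map_mx phi C *m X'.
    by exists (invmx (map_mx phi C) *m (row s P)^T); rewrite mulKVmx.
  (* Since A_i C X' is G_i applied to X' without its i-th entry, a point without image is a multiple
     of the i-th column of C, and the form l_i vanishes there. *)
  have X'0 j : j != i -> X' j 0 = 0.
    move=> ji; move: AP0; rewrite DX mulmxA -map_mxM ACE map_mxM -mulmxA.
    move/(congr1 (mulmx (invmx (map_mx phi (G i))))).
    rewrite mulKmx ?map_unitmx // mulmx0.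
    have /unlift_some[j' Dj _] : i != j by rewrite eq_sym.
    move/matrixP/(_ j' 0); rewrite !mxE (bigD1 j) //= !mxE -Dj eqxx rmorph1 mul1r.
    rewrite big1 ?addr0 // => j2 ne.
    by rewrite !mxE -Dj eq_sym (negPf ne) rmorph0 mul0r.
  have -> : (row s P)^T = X' i 0 *: map_mx phi (col i C).
    rewrite DX; apply/colP => j; rewrite mxE (bigD1 i) //= big1 => [|j2 /X'0->].
      by rewrite addr0 !mxE mulrC.
    by rewrite mulr0.
  by rewrite -scalemxAr -map_mxM lC map_mx0 scaler0 mxE.
pose Pc : 'M[complex R]_(2, 4) := \matrix_s (row s P *m (map_mx phi (invmx C))^T).
have camE k : row k (camera_point Pc) = (map_mx phi (A (cam k)) *m (row (side k) P)^T)^T.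
  rewrite row_camera_point; congr (_ *m _)^T; rewrite rowK trmx_mul trmxK map_invmx mulKVmx //.
  by rewrite map_unitmx.
change ((map_mpoly phi F).@[mxvec P 0] = 0).
rewrite (meval_block_subst phi) -/Pc meval_coord_map_subst map_component.
(* Rescaling the eight rows does not change the point of the variety, so f vanishes at all
   rescalings. *)
apply: eval_at_component => s s0; apply: Jf.
pose P' := \matrix_(k, j) (s k * camera_point Pc k j).
suff imP : in_image (fun i => map_mx (real_complex R) (A i)) P'.
  split=> [k|e h _ ]; last by move/(_ _ imP).
  have -> : row k P' = s k *: row k (camera_point Pc) by apply/rowP => j; rewrite !mxE.
  rewrite scaler_eq0 (negPf (s0 k)) camE.
  by apply: contraNneq (camP_neq0 (side k) (cam k)) => /(congr1 trmx); rewrite trmxK trmx0 => ->.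
have nzrow t : (row t P)^T != 0.
  by apply: contraNneq (camP_neq0 t 0) => ->; rewrite mulmx0.
exists (row 0 P)^T, (row 1 P)^T; split=> // i; split; try exact: camP_neq0.
  exists (s (lshift 4 i)) => //.
  have := camE (lshift 4 i); rewrite side_lshift cam_lshift => <-.
  by apply/rowP => j; rewrite !mxE.
exists (s (rshift 4 i)) => //.
have := camE (rshift 4 i); rewrite side_rshift cam_rshift => <-.
by apply/rowP => j; rewrite !mxE.
Qed.

End RigidIdeal.

(** * The toric ideal *)


Definition node (s : 'I_2) (i : 'I_4) : 'I_(4 + 4) :=
  if s == 0 then lshift 4 i else rshift 4 i.

Lemma ord2P (s : 'I_2) : {s = 0} + {s = 1}.
Proof. by case: s => -[|[|//]] lt; [left | right]; apply: val_inj. Qed.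

Lemma side_node s i : side (node s i) = s.
Proof. by case: (ord2P s) => ->; rewrite /node /= ?side_lshift ?side_rshift. Qed.

Lemma cam_node s i : cam (node s i) = i.
Proof. by case: (ord2P s) => ->; rewrite /node /= ?cam_lshift ?cam_rshift. Qed.

Lemma nodeK k : node (side k) (cam k) = k.
Proof.
rewrite /node /side /cam; case: splitP => j Dj; apply: val_inj; exact/esym/Dj.
Qed.

Lemma big_node (V : Type) (idx : V) (op : Monoid.com_law idx) F :
  \big[op/idx]_k F k = op (\big[op/idx]_i F (node 0 i)) (\big[op/idx]_i F (node 1 i)).
Proof. exact: big_split_ord. Qed.

Lemma sum_ord3 (F : 'I_3 -> nat) :
  (\sum_j F j = F (inord 0) + F (inord 1) + F (inord 2))%N.
Proof.
rewrite !big_ord_recl big_ord0 addn0 addnA.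
by congr (F _ + F _ + F _)%N; apply: val_inj; rewrite /= inordK.
Qed.

Lemma sum_ord4 (F : 'I_4 -> nat) :
  (\sum_j F j = F (inord 0) + F (inord 1) + F (inord 2) + F (inord 3))%N.
Proof.
rewrite !big_ord_recl big_ord0 addn0 !addnA.
by congr (F _ + F _ + F _ + F _)%N; apply: val_inj; rewrite /= inordK.
Qed.

Definition tgtv : 'I_num_vars -> 'I_(2 * 4) := mxvec (\matrix_(k, j) tgt k j) 0.

Lemma tgtvE k j : tgtv (mxvec_index k j) = tgt k j.
Proof. by rewrite /tgtv mxvecE mxE. Qed.

Definition coord_mnm (m : 'X_{1..num_vars}) : 'X_{1..2 * 4} :=
  (\sum_e U_(tgtv e) *+ m e)%MM.

Lemma coord_mapX (R : comNzRingType) m :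
  coord_map ('X_[m] : uv_ring R) = 'X_[coord_mnm m].
Proof.
rewrite /coord_map comp_mpolyX /coord_mnm -mprodXnE; apply: eq_bigr => e _.
rewrite tnth_mktuple; congr (_ ^+ _); case/mxvec_indexP: e => k j.
by rewrite mxvecE mxE tgtvE.
Qed.

Lemma coord_mnmD m m' : coord_mnm (m + m') = (coord_mnm m + coord_mnm m')%MM.
Proof.
apply/mnmP => l; rewrite mnmDE !mnm_sumE -big_split; apply: eq_bigr => e _ /=.
by rewrite !mulmnE mnmDE mulnDr.
Qed.

Lemma coord_mnm0 : coord_mnm 0 = 0%MM.
Proof. by apply/mnmP => l; rewrite mnm_sumE mnm0E big1 // => e _; rewrite mulmnE mnm0E muln0. Qed.

Lemma coord_mnmU e : coord_mnm U_(e) = U_(tgtv e)%MM.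
Proof.
apply/mnmP => l; rewrite mnm_sumE (bigD1 e) //= big1 => [|e' ne].
  by rewrite addn0 mulmnE !mnm1E eqxx muln1.
by rewrite mulmnE (mnm1E e e') eq_sym (negPf ne) muln0.
Qed.

Definition code := (nat * nat * nat)%type.

(* The code (s, i, j) with i != j stands for the variable that maps to
   t_i x_j on the side s. *)
Definition edge (c : code) : 'I_num_vars :=
  let: (s, i, j) := c in mxvec_index (node (inord s) (inord i)) (inord (unbump i j)).

Definition valid (c : code) : bool :=
  let: (s, i, j) := c in [&& (s < 2)%N, (i < 4)%N, (j < 4)%N & i != j].

Lemma valid_unbump s i j : valid (s, i, j) -> (unbump i j < 3)%N.
Proof. by case/and4P => _ lt_i lt_j ne; rewrite /unbump; lia. Qed.

Lemma edge_inj : {in valid &, injective edge}.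
Proof.
move=> [[s i] j] [[s' i'] j'] v v' /mxvec_index_inj[En Ej].
have /and4P[ls li lj ne] := v; have /and4P[ls' li' lj' ne'] := v'.
have := congr1 side En; rewrite !side_node => /(congr1 val); rewrite /= !inordK // => Es.
have := congr1 cam En; rewrite !cam_node => /(congr1 val); rewrite /= !inordK // => Ei.
move/(congr1 val): Ej; rewrite /= !inordK ?(valid_unbump v) ?(valid_unbump v') //.
rewrite -{}Es -{}Ei in ne' *; rewrite /unbump => E; congr (_, _); lia.
Qed.

Lemma edge_surj e : exists2 c, valid c & e = edge c.
Proof.
case/mxvec_indexP: e => k j; exists (side k : nat, cam k : nat, bump (cam k) j).
  rewrite /= !ltn_ord neq_bump andbT /= /bump; have := ltn_ord j; lia.
by rewrite /= bumpK !inord_val nodeK.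
Qed.

Lemma tgtv_edge s i j : valid (s, i, j) -> tgtv (edge (s, i, j)) = mxvec_index (inord s) (inord j).
Proof.
move=> v; have /and4P[ls li lj ne] := v.
rewrite /edge tgtvE /tgt side_node cam_node; congr mxvec_index.
apply: val_inj; rewrite /= !inordK ?(valid_unbump v) // unbumpK //=.
by rewrite inE eq_sym.
Qed.

Lemma multidegree_node m s i :
  tnth (multidegree m) (node s i) = (\sum_j m (mxvec_index (node s i) j))%N.
Proof. exact: multidegreeE. Qed.

Lemma coord_mnmE m s l : coord_mnm m (mxvec_index s l) =
  (\sum_i \sum_j (lift i j == l) * m (mxvec_index (node s i) j))%N.
Proof.
rewrite mnm_sumE big_mxvec_index big_node.
have E t : (\sum_i \sum_j (U_(tgtv (mxvec_index (node t i) j))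
       *+ m (mxvec_index (node t i) j))%MM (mxvec_index s l) =
    (t == s) * \sum_i \sum_j (lift i j == l) * m (mxvec_index (node s i) j))%N.
  rewrite big_distrr; apply: eq_bigr => i _; rewrite big_distrr /=.
  apply: eq_bigr => j _; rewrite mulmnE mnm1E tgtvE /tgt side_node cam_node.
  case: (t =P s) => [->|ts]; last first.
    by case: eqP => [/mxvec_index_inj[/ts]|] //; rewrite !mul0n.
  rewrite mul1n; congr (nat_of_bool _ * _)%N.
  by apply/eqP/eqP => [/mxvec_index_inj[]//|->].
by rewrite !E; case: (ord2P s) => ->; rewrite /= ?mul1n ?addn0.
Qed.

Definition distinct4 (i j k p : nat) : bool :=
  uniq [:: i; j; k; p] && all (fun a => a < 4)%N [:: i; j; k; p].

(** Row sums of the table of exponents of m on the side s; [col_sum] gives its column sums. Any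
    ordering of the indices is allowed, so that later arguments can name them freely. *)
Lemma row_sum m s i j k p : distinct4 i j k p ->
  tnth (multidegree m) (node (inord s) (inord i)) =
    (m (edge (s, i, j)) + m (edge (s, i, k)) + m (edge (s, i, p)))%N.
Proof.
move=> ijkp; rewrite multidegree_node sum_ord3 /edge.
pose F a := m (mxvec_index (node (inord s) (inord i)) (inord a)).
have FE a : m (mxvec_index (node (inord s) (inord i)) (inord a)) = F a by [].
rewrite !FE; move: F {FE} => F.
case/andP: ijkp => u4 /and5P[lti ltj ltk ltp _]; move: lti ltj ltk ltp u4.
by case: i => [|[|[|[|//]]]] _; case: j => [|[|[|[|//]]]] _;
   case: k => [|[|[|[|//]]]] _; case: p => [|[|[|[|//]]]] _ // _;
   cbv -[addn muln]; lia.
Qed.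

Lemma col_sum m s i j k p : distinct4 i j k p ->
  coord_mnm m (mxvec_index (inord s) (inord j)) =
    (m (edge (s, i, j)) + m (edge (s, k, j)) + m (edge (s, p, j)))%N.
Proof.
rewrite coord_mnmE => ijkp.
have lt_j : (j < 4)%N by case/andP: ijkp => _ /and4P[].
pose F i b := m (mxvec_index (node (inord s) (inord i)) (inord b)).
transitivity (\sum_(i < 4) ((i != j :> nat) * F i (unbump i j)))%N.
  apply: eq_bigr => a _; have [aj|aj] := eqVneq (a : nat) j.
    rewrite mul0n big1 // => b _; rewrite -val_eqE /= inordK // -aj.
    by rewrite eq_sym (negPf (neq_bump _ _)).
  have /unlift_some[b Db _] : a != inord j by rewrite -val_eqE /= inordK.
  rewrite mul1n (bigD1 b) //= -Db eqxx mul1n big1 ?addn0 => [|b' ne]; last first.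
    by rewrite Db (inj_eq lift_inj) (negPf ne).
  have <- : b = unbump a j :> nat by rewrite -(@inordK 3 j) // Db /= bumpK.
  by rewrite /F !inord_val.
have FE a b : m (mxvec_index (node (inord s) (inord a)) (inord b)) = F a b by [].
rewrite sum_ord4 /= !inordK // /edge !FE; move: F {FE lt_j} => F.
case/andP: ijkp => u4 /and5P[lti ltj ltk ltp _]; move: lti ltj ltk ltp u4.
by case: i => [|[|[|[|//]]]] _; case: j => [|[|[|[|//]]]] _;
   case: k => [|[|[|[|//]]]] _; case: p => [|[|[|[|//]]]] _ // _;
   cbv -[addn muln]; lia.
Qed.

Definition mon (l : seq code) : 'X_{1..num_vars} := (\sum_(c <- l) U_(edge c))%MM.

Lemma mon_cons c l : mon (c :: l) = (U_(edge c) + mon l)%MM.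
Proof. exact: big_cons. Qed.

Lemma perm_mon l l' : perm_eq l l' -> mon l = mon l'.
Proof. exact: perm_big. Qed.

Lemma monE l c : all valid l -> valid c -> mon l (edge c) = count_mem c l.
Proof.
elim: l => [|c' l IHl] /= => [_ _|/andP[vc' vl] vc].
  by rewrite /mon big_nil mnm0E.
rewrite mon_cons mnmDE mnm1E IHl //; congr (_ + _)%N.
by rewrite (inj_in_eq edge_inj).
Qed.

Lemma le_mon l (m : 'X_{1..num_vars}) : uniq l -> all valid l -> all (fun c => 0 < m (edge c))%N l ->
  (mon l <= m)%MM.
Proof.
move=> uniql vl /allP posl; apply/mnm_lepP => e; have [c vc ->] := edge_surj e.
rewrite monE // count_uniq_mem //; case: (boolP (c \in l)) => //; exact: posl.
Qed.

(** Entries (i, k, j, l) with rows i, k and columns j, l: since the diagonal is missing, the columns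
    are the complement of the rows, and there is one quadric per pair of rows. *)
Definition quad_index : seq (nat * nat * nat * nat) :=
  [:: (0, 1, 2, 3); (0, 2, 1, 3); (0, 3, 1, 2);
      (1, 2, 0, 3); (1, 3, 0, 2); (2, 3, 0, 1)]%N.

(** A hexagon uses the same three indices as rows and as columns and is traversed off the
    diagonal. *)
Definition cubic_index : seq (nat * nat * nat) :=
  [:: (0, 1, 2); (0, 1, 3); (0, 2, 3); (1, 2, 3)]%N.

Definition quad (s i k j l : nat) : seq code * seq code :=
  ([:: (s, i, j); (s, k, l)], [:: (s, i, l); (s, k, j)]).

Definition cubic (s i j k : nat) : seq code * seq code :=
  ([:: (s, i, j); (s, j, k); (s, k, i)], [:: (s, i, k); (s, k, j); (s, j, i)]).

(* The 4-cycles and the chordless 6-cycles of the bipartite graph with edges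
   u_ij, i != j. *)
Definition binomial_codes : seq (seq code * seq code) :=
  [seq let: (i, k, j, l) := x in quad s i k j l | s <- iota 0 2, x <- quad_index]
  ++ [seq let: (i, j, k) := x in cubic s i j k | s <- iota 0 2, x <- cubic_index].

Definition code_binomial (R : nzRingType) (b : seq code * seq code) : uv_ring R :=
  'X_[mon b.1] - 'X_[mon b.2].

Definition binomials (R : nzRingType) : seq (uv_ring R) :=
  [seq code_binomial R b | b <- binomial_codes].

Definition same_binomial (b b' : seq code * seq code) : bool :=
  perm_eq b.1 b'.1 && perm_eq b.2 b'.2 || perm_eq b.1 b'.2 && perm_eq b.2 b'.1.

Definition all4 (P : nat -> bool) := all P (iota 0 4).

(** The list contains one binomial per set of indices; any other naming of the indices gives a
    listed binomial up to sign. *)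
Lemma all_quad : all (fun s => all4 (fun i => all4 (fun k => all4 (fun j => all4 (fun l =>
  distinct4 i k j l ==> has (same_binomial (quad s i k j l)) binomial_codes)))))
  (iota 0 2).
Proof. by vm_compute. Qed.

Lemma all_cubic : all (fun s => all4 (fun i => all4 (fun j => all4 (fun k =>
  uniq [:: i; j; k] ==> has (same_binomial (cubic s i j k)) binomial_codes))))
  (iota 0 2).
Proof. by vm_compute. Qed.

Lemma in_binomials (R : comNzRingType) b : has (same_binomial b) binomial_codes ->
  in_ideal_of (binomials R) (code_binomial R b).
Proof.
case/hasP => b' Bb' /orP[]/andP[p1 p2].
  by apply/mem_in_ideal_of/mapP; exists b'; rewrite // /code_binomial (perm_mon p1) (perm_mon p2).
rewrite /code_binomial (perm_mon p1) (perm_mon p2) -opprB.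
exact/in_ideal_ofN/mem_in_ideal_of/(map_f (code_binomial R) Bb').
Qed.

Lemma quad_in_binomials (R : comNzRingType) s i k j l :
  (s < 2)%N -> distinct4 i k j l ->
  in_ideal_of (binomials R) (code_binomial R (quad s i k j l)).
Proof.
move=> lt_s d4; apply: in_binomials; have := d4.
case/andP => _ /and5P[lti ltk ltj ltl _].
have mem4 a : (a < 4)%N -> a \in iota 0 4 by rewrite mem_iota.
have /allP/(_ s) := all_quad; rewrite mem_iota => /(_ lt_s).
move=> /allP/(_ i (mem4 _ lti))/allP/(_ k (mem4 _ ltk)).
by move=> /allP/(_ j (mem4 _ ltj))/allP/(_ l (mem4 _ ltl)); rewrite d4.
Qed.

Lemma cubic_in_binomials (R : comNzRingType) s i j k p :
  (s < 2)%N -> distinct4 i j k p ->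
  in_ideal_of (binomials R) (code_binomial R (cubic s i j k)).
Proof.
move=> lt_s d4; apply: in_binomials; have := d4.
case/andP => u4 /and5P[lti ltj ltk _ _].
have u3 : uniq [:: i; j; k].
  by apply: subseq_uniq u4; rewrite (prefix_subseq [:: i; j; k] [:: p]).
have mem4 a : (a < 4)%N -> a \in iota 0 4 by rewrite mem_iota.
have /allP/(_ s) := all_cubic; rewrite mem_iota => /(_ lt_s).
move=> /allP/(_ i (mem4 _ lti))/allP/(_ j (mem4 _ ltj)).
by move=> /allP/(_ k (mem4 _ ltk)); rewrite u3.
Qed.


(** * Connectivity of the fibers of the monomial map *)

Section FiberConnectivity.
Variable R : comNzRingType.
Implicit Types m n : 'X_{1..num_vars}.

Definition same_fiber m n : Prop :=
  multidegree m = multidegree n /\ coord_mnm m = coord_mnm n.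

Definition linked m n : Prop :=
  same_fiber m n /\ in_ideal_of (binomials R) ('X_[m] - 'X_[n]).

Lemma linked_refl m : linked m m.
Proof. by split=> //; rewrite subrr; apply: in_ideal_of0. Qed.

Lemma linked_sym m n : linked m n -> linked n m.
Proof. by move=> [[e1 e2] /in_ideal_ofN]; rewrite opprB. Qed.

Lemma linked_trans m n p : linked m n -> linked n p -> linked m p.
Proof.
move=> [[e1 e2] If] [[e3 e4] Ig]; split; first by split; [rewrite e1 | rewrite e2].
by have := in_ideal_ofD If Ig; rewrite addrA subrK.
Qed.

Lemma linked_add m n p : linked m n -> linked (p + m)%MM (p + n)%MM.
Proof.
move=> [[e1 e2] If]; split; last by rewrite !mpolyXD -mulrBr; apply: in_ideal_ofM.
by split; rewrite ?multidegreeD ?e1 // !coord_mnmD e2.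
Qed.

Lemma multidegree_edge c : valid c ->
  forall s i, tnth (multidegree U_(edge c)) (node s i) =
    ((c.1.1 == s) && (c.1.2 == i) : nat).
Proof.
case: c => [[s' i'] j'] /and4P[ls li lj ne] s i.
rewrite /edge multidegree_var tnth_mktuple; congr nat_of_bool.
apply/eqP/andP => [/val_inj E|[/eqP Es /eqP Ei]] /=.
  have := congr1 side E; rewrite !side_node => <-.
  by have := congr1 cam E; rewrite !cam_node => <-; rewrite !inordK.
by congr (node _ _ : nat); apply: val_inj; rewrite /= inordK.
Qed.

Lemma same_fiber_cat (l l' : seq code) : all valid l -> all valid l' ->
  perm_eq [seq c.1 | c <- l] [seq c.1 | c <- l'] ->
  perm_eq [seq (c.1.1, c.2) | c <- l] [seq (c.1.1, c.2) | c <- l'] ->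
  same_fiber (mon l) (mon l').
Proof.
move=> vl vl' rows cols; split.
  have degE r : all valid r -> multidegree (mon r) =
      [tuple (\sum_(x <- [seq c.1 | c <- r]) ((x.1 == side k) && (x.2 == cam k) : nat))%N
         | k < 8].
    elim: r => [_|c r IHr /= /andP[vc vr]].
      by rewrite /mon big_nil multidegree0; apply: eq_from_tnth => k; rewrite !tnth_mktuple big_nil.
    rewrite mon_cons multidegreeD (IHr vr); apply: eq_from_tnth => k.
    have := multidegree_edge vc (side k) (cam k); rewrite nodeK => degU.
    by rewrite [LHS]tnth_mktuple degU !tnth_mktuple big_cons.
  by rewrite !degE //; apply: eq_from_tnth => k; rewrite !tnth_mktuple (perm_big _ rows).
have coordE r : all valid r -> coord_mnm (mon r) =
    (\sum_(x <- [seq (c.1.1, c.2) | c <- r]) U_(mxvec_index (inord x.1) (inord x.2)))%MM.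
  elim: r => [_|[[s i] j] r IHr /= /andP[vc vr]]; first by rewrite /mon !big_nil coord_mnm0.
  by rewrite mon_cons coord_mnmD (IHr vr) coord_mnmU (tgtv_edge vc) big_cons.
by rewrite !coordE // (perm_big _ cols).
Qed.

Lemma linked_binomial (l l' : seq code) m : all valid l -> all valid l' -> uniq l ->
  perm_eq [seq c.1 | c <- l] [seq c.1 | c <- l'] ->
  perm_eq [seq (c.1.1, c.2) | c <- l] [seq (c.1.1, c.2) | c <- l'] ->
  in_ideal_of (binomials R) (code_binomial R (l, l')) ->
  all (fun c => 0 < m (edge c))%N l ->
  exists2 n, linked m n & all (fun c => 0 < n (edge c))%N l'.
Proof.
move=> vl vl' ul rows cols Ib posl; have lem := le_mon ul vl posl.
exists (m - mon l + mon l')%MM.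
  rewrite -{1}(submK lem); apply: linked_add; split=> //.
  exact: same_fiber_cat.
apply/allP => c cl'; rewrite mnmDE monE //; last exact: (allP vl').
by rewrite addn_gt0 orbC -has_count has_pred1 cl'.
Qed.

Lemma linked_quad m s i k j l : (s < 2)%N -> distinct4 i k j l ->
  (0 < m (edge (s, i, j)))%N -> (0 < m (edge (s, k, l)))%N ->
  exists2 n, linked m n &
    (0 < n (edge (s, i, l)))%N && (0 < n (edge (s, k, j)))%N.
Proof.
move=> lt_s d4 pos1 pos2; have Ib := quad_in_binomials R lt_s d4.
have /andP[/= u4 /and5P[lti ltk ltj ltl _]] := d4.
have ne : [/\ i != k, i != j, i != l, k != j & k != l] /\ j != l.
  move: u4; rewrite !inE !negb_or andbT => /and3P[/and3P[-> -> ->] /andP[-> ->] ->].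
  by [].
case: ne => -[ik ij il kj kl] jl.
have [||||||n Ln] := linked_binomial _ _ _ _ _ Ib (m := m) => //=.
- by rewrite lt_s lti ltk ltj ltl ij kl.
- by rewrite lt_s lti ltk ltj ltl il kj.
- by rewrite inE !xpair_eqE (negPf ik) andbF.
- by apply/permP => a /=; lia.
- by rewrite pos1 pos2.
by rewrite andbT; exists n.
Qed.

Lemma linked_cubic m s i j k p : (s < 2)%N -> distinct4 i j k p ->
  (0 < m (edge (s, i, j)))%N -> (0 < m (edge (s, j, k)))%N ->
  (0 < m (edge (s, k, i)))%N ->
  exists2 n, linked m n & (0 < n (edge (s, i, k)))%N.
Proof.
move=> lt_s d4 pos1 pos2 pos3; have Ib := cubic_in_binomials R lt_s d4.
have /andP[/= u4 /and5P[lti ltj ltk _ _]] := d4.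
have [ij ik jk] : [/\ i != j, i != k & j != k].
  by move: u4; rewrite !inE !negb_or andbT => /and3P[/and3P[-> -> _] /andP[-> _] _].
have [||||||n Ln] := linked_binomial _ _ _ _ _ Ib (m := m) => //=.
- by rewrite lt_s lti ltj ltk ij jk eq_sym ik.
- by rewrite lt_s lti ltj ltk ik (eq_sym k) jk (eq_sym j) ij.
- by rewrite !inE !xpair_eqE (negPf ij) (negPf ik) (negPf jk) !andbF.
- by apply/permP => a /=; lia.
- by apply/permP => a /=; lia.
- by rewrite pos1 pos2 pos3.
by case/and3P => posn _ _; exists n.
Qed.


Lemma distinct4_complete i j : (i < 4)%N -> (j < 4)%N -> i != j ->
  exists k p, distinct4 i j k p.
Proof.
case: i => [|[|[|[|//]]]] _; case: j => [|[|[|[|//]]]] _ // _;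
  by [exists 0%N, 1%N | exists 0%N, 2%N | exists 0%N, 3%N
     | exists 1%N, 2%N | exists 1%N, 3%N | exists 2%N, 3%N].
Qed.

Lemma distinct4_perm i j k p i' j' k' p' :
  (forall f : nat -> nat, f i' + f j' + f k' + f p' = f i + f j + f k + f p)%N ->
  distinct4 i j k p -> distinct4 i' j' k' p'.
Proof.
move=> e; have pe : perm_eq [:: i'; j'; k'; p'] [:: i; j; k; p].
  by apply/permP => a; have := e (nat_of_bool \o a); rewrite /= !addn0 !addnA.
by rewrite /distinct4 (perm_uniq pe) (perm_all _ pe).
Qed.

(** Once two monomials of a fiber have been moved so as to share a variable, this variable can be
    cancelled. This lowers the degree and drives the induction in [same_fiber_linked]. *)
Definition common_step m n :=
  exists m1 n1 e, [/\ linked m m1, linked n n1, (0 < m1 e)%N & (0 < n1 e)%N].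

Lemma common_step_sym m n : common_step m n -> common_step n m.
Proof. by move=> [m1 [n1 [e [H1 H2 H3 H4]]]]; exists n1, m1, e. Qed.

(* (i, j) has more of m and (i, k) more of n; each of the first three cases
   below exchanges two variables of m or of n, and if none applies then m
   contains the hexagon (i, j), (j, k), (k, i). *)
Lemma common_step_row m n s i j k p : (s < 2)%N -> distinct4 i j k p ->
  same_fiber m n ->
  (n (edge (s, i, j)) < m (edge (s, i, j)))%N ->
  (m (edge (s, i, k)) < n (edge (s, i, k)))%N -> common_step m n.
Proof.
move=> lt_s d4 [degE crdE] lt_ij lt_ik.
have colE a b c d : distinct4 a b c d ->
    (m (edge (s, a, b)) + m (edge (s, c, b)) + m (edge (s, d, b)) =
     n (edge (s, a, b)) + n (edge (s, c, b)) + n (edge (s, d, b)))%N.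
  by move=> d4'; rewrite -!(col_sum _ _ d4') crdE.
have rowE a b c d : distinct4 a b c d ->
    (m (edge (s, a, b)) + m (edge (s, a, c)) + m (edge (s, a, d)) =
     n (edge (s, a, b)) + n (edge (s, a, c)) + n (edge (s, a, d)))%N.
  by move=> d4'; rewrite -!(row_sum _ _ d4') degE.
have d_ijkp : distinct4 i j k p by [].
have d_ikjp : distinct4 i k j p by apply: distinct4_perm d4 => f; lia.
have d_kjip : distinct4 k j i p by apply: distinct4_perm d4 => f; lia.
have [lt_pj|le_pj] := ltnP (m (edge (s, p, j))) (n (edge (s, p, j))).
  have d_ipkj : distinct4 i p k j by apply: distinct4_perm d4 => f; lia.
  (* In n, the pair (i, k), (p, j) is exchanged for (i, j), (p, k), and (i, j) occurs in m. *)
  have [||n1 Ln1 /andP[pos _]] := linked_quad (m := n) lt_s d_ipkj; try lia.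
  exists m, n1, (edge (s, i, j)); split=> //; [exact: linked_refl | lia].
have [lt_pk|le_pk] := ltnP (n (edge (s, p, k))) (m (edge (s, p, k))).
  have d_ipjk : distinct4 i p j k by apply: distinct4_perm d4 => f; lia.
  (* In m, the pair (i, j), (p, k) is exchanged for (i, k), (p, j), and (i, k) occurs in n. *)
  have [||m1 Lm1 /andP[pos _]] := linked_quad (m := m) lt_s d_ipjk; try lia.
  exists m1, n, (edge (s, i, k)); split=> //; [exact: linked_refl | lia].
have [lt_kp|le_kp] := ltnP (n (edge (s, k, p))) (m (edge (s, k, p))).
  have d_ikjp' : distinct4 i k j p by [].
  (* In m, the pair (i, j), (k, p) is exchanged for (i, p), (k, j). By the sum of column j, where m
     has the larger entry in row i and no smaller one in row p, (k, j) occurs in n. *)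
  have [||m1 Lm1 /andP[_ pos]] := linked_quad (m := m) lt_s d_ikjp'; try lia.
  have := colE _ _ _ _ d_ijkp => Ej.
  exists m1, n, (edge (s, k, j)); split=> //; [exact: linked_refl | lia].
(* Column j gives n more of (k, j), then row k gives m more of (k, i), and column k gives m more of
   (j, k). *)
have := colE _ _ _ _ d_ijkp; have := colE _ _ _ _ d_ikjp; have := rowE _ _ _ _ d_kjip.
move=> Ek Eck Ecj.
have [|||m1 Lm1 pos] := linked_cubic (m := m) lt_s d_ijkp; try lia.
exists m1, n, (edge (s, i, k)); split=> //; [exact: linked_refl | lia].
Qed.

(** In a row where m has a larger entry than n, equality of the row sums forces a smaller one. *)
Lemma common_stepP m n : same_fiber m n -> m != n -> common_step m n.
Proof.
move=> fib ne.
wlog [e lt_e] : m n fib ne / exists e, (n e < m e)%N.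
  move=> IH; have [/existsP|/existsPn le_mn] := boolP [exists e, (n e < m e)%N].
    exact: IH.
  apply: common_step_sym; apply: IH; first by case: fib => e1 e2; split.
    by rewrite eq_sym.
  apply/existsP; apply: contraR ne => /existsPn le_nm; apply/eqP/mnmP => e.
  by apply/eqP; rewrite eqn_leq leqNgt le_mn leqNgt le_nm.
have [[[s i] j] /and4P[lt_s lt_i lt_j ij] De] := edge_surj e; subst e.
have [k [p d4]] := distinct4_complete lt_i lt_j ij.
have d4' : distinct4 i j p k by apply: distinct4_perm d4 => f; lia.
have := row_sum m s d4; rewrite fib.1 (row_sum n s d4) => rowE.
have [lt_ik|le_ik] := ltnP (m (edge (s, i, k))) (n (edge (s, i, k))).
  exact: common_step_row lt_s d4 fib lt_e lt_ik.
have lt_ip : (m (edge (s, i, p)) < n (edge (s, i, p)))%N.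
  by move: rowE lt_e le_ik; clear; lia.
exact: common_step_row lt_s d4' fib lt_e lt_ip.
Qed.

Lemma mdeg_multidegree m : mdeg m = (\sum_k tnth (multidegree m) k)%N.
Proof.
rewrite mdegE big_mxvec_index; apply: eq_bigr => k _; exact/esym/multidegreeE.
Qed.

Lemma same_fiber_linked m n : same_fiber m n -> linked m n.
Proof.
have [b] := ubnP (mdeg m); elim: b m n => // b IHb m n lt_mb fib.
have [->|ne] := eqVneq m n; first exact: linked_refl.
have [m1 [n1 [e [Lm Ln pm pn]]]] := common_stepP fib ne.
have [[dm1 cm1] _] := Lm; have [[dn1 cn1] _] := Ln; case: fib => dmn cmn.
apply: linked_trans Lm _; apply: linked_trans (linked_sym Ln).
have [m2 Dm] : exists m2, m1 = (U_(e) + m2)%MM.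
  by exists (m1 - U_(e))%MM; rewrite addmC submK // lep1mP -lt0n.
have [n2 Dn] : exists n2, n1 = (U_(e) + n2)%MM.
  by exists (n1 - U_(e))%MM; rewrite addmC submK // lep1mP -lt0n.
rewrite Dm Dn; apply: linked_add; apply: IHb.
  have : mdeg m1 = mdeg m by rewrite !mdeg_multidegree dm1.
  by rewrite Dm mdegD mdeg1 add1n => E; move: lt_mb; rewrite -E.
have degE : multidegree m1 = multidegree n1 by rewrite -dm1 dmn dn1.
have crdE : coord_mnm m1 = coord_mnm n1 by rewrite -cm1 cmn cn1.
split.
  apply: eq_from_tnth => k; have := congr1 (fun t => tnth t k) degE.
  by rewrite /= Dm Dn !multidegreeD [LHS]tnth_mktuple [RHS]tnth_mktuple => /addnI.
by move: crdE; rewrite Dm Dn !coord_mnmD => /addmI.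
Qed.

End FiberConnectivity.

Lemma coord_map_additive (R : comNzRingType) : {morph @coord_map R : f g / f + g}.
Proof. by move=> f g; rewrite /coord_map raddfD. Qed.

Lemma coord_map0 (R : comNzRingType) : @coord_map R 0 = 0.
Proof. by rewrite /coord_map raddf0. Qed.

Lemma coord_mapM (R : comNzRingType) : {morph @coord_map R : f g / f * g}.
Proof. by move=> f g; rewrite /coord_map rmorphM. Qed.

Lemma coord_mapZ (R : comNzRingType) a (f : uv_ring R) :
  coord_map (a *: f) = a *: coord_map f.
Proof. exact: comp_mpolyZ. Qed.

Lemma coord_map_sum (R : comNzRingType) (I : Type) (r : seq I) (P : pred I)
    (F : I -> uv_ring R) :
  coord_map (\sum_(i <- r | P i) F i) = \sum_(i <- r | P i) coord_map (F i).
Proof. exact: (big_morph _ (@coord_map_additive R) (@coord_map0 R)). Qed.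

Lemma coord_mapB (R : comNzRingType) : {morph @coord_map R : f g / f - g}.
Proof. by move=> f g; rewrite /coord_map raddfB. Qed.

Lemma coord_mapE (R : comNzRingType) (f : uv_ring R) :
  coord_map f = \sum_(m <- msupp f) f@_m *: 'X_[coord_mnm m].
Proof.
rewrite {1}[f]mpolyE coord_map_sum; apply: eq_bigr => m _.
by rewrite coord_mapZ coord_mapX.
Qed.

Lemma mcoeff_coord_map_neq0 (R : comNzRingType) (f : uv_ring R) l :
  (coord_map f)@_l != 0 -> exists2 m, m \in msupp f & coord_mnm m = l.
Proof.
move=> fl; have [/hasP[m mf /eqP <-]|/hasPn nol] :=
  boolP (has (fun m => coord_mnm m == l) (msupp f)); first by exists m.
case/eqP: fl; rewrite coord_mapE raddf_sum big_seq big1 // => m /nol/negPf nm.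
by rewrite /= mcoeffZ mcoeffX nm mulr0.
Qed.

(** The image of the first monomial of h must cancel against that of another one, which lies in the
    same fiber. Subtracting a multiple of their difference, which is in the ideal of the binomials,
    shrinks the support. *)
Lemma coord_map_kernel (R : comNzRingType) d (h : uv_ring R) :
  is_multihomog d h -> coord_map h = 0 -> in_ideal_of (binomials R) h.
Proof.
have [b] := ubnP (size (msupp h)); elim: b h => // b IHb h lt_hb homh h0.
case Dh : (msupp h) => [|m r].
  have -> : h = 0 by apply/eqP; rewrite -msupp_eq0 Dh.
  exact: in_ideal_of0.
have mh : m \in msupp h by rewrite Dh mem_head.
have hm : h@_m != 0 by rewrite -mcoeff_msupp.
have [/hasP[m' m'r /eqP mm']|/hasPn nom] :=
  boolP (has (fun m' => coord_mnm m' == coord_mnm m) r); last first.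
  have := congr1 (mcoeff (coord_mnm m)) h0.
  rewrite coord_mapE Dh big_cons mcoeffD mcoeffZ mcoeffX eqxx mulr1 mcoeff0.
  rewrite raddf_sum big_seq big1 /= ?addr0; first by move/eqP; rewrite (negPf hm).
  by move=> m' /nom/negPf nm; rewrite /= mcoeffZ mcoeffX nm mulr0.
have m'h : m' \in msupp h by rewrite Dh inE m'r orbT.
have ne : m' != m.
  by apply: contraTneq m'r => ->; have := msupp_uniq h; rewrite Dh => /andP[].
have hm' : h@_m' != 0 by rewrite -mcoeff_msupp.
have degE : multidegree m = multidegree m'.
  by move/is_multihomogP: homh => homh; rewrite !homh.
pose g := h@_m *: ('X_[m] - 'X_[m'] : uv_ring R).
rewrite -[h](subrK g); apply: in_ideal_ofD; last first.
  rewrite /g -mul_mpolyC; apply: in_ideal_ofM.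
  by have [] : linked R m m' by apply: same_fiber_linked.
have sub_supp m2 : m2 \in msupp (h - g) -> m2 \in r.
  rewrite mcoeff_msupp mcoeffB mcoeffZ mcoeffB !mcoeffX.
  have [<-|nm] := eqVneq m m2.
    by rewrite (negPf ne) subr0 mulr1 subrr eqxx.
  have [<- //|nm'] := eqVneq m' m2.
  by rewrite subrr mulr0 subr0 -mcoeff_msupp Dh inE eq_sym (negPf nm).
have homP := is_multihomogP _ _ homh; apply: IHb.
- apply: leq_ltn_trans (_ : (size r < b)%N); last by move: lt_hb; rewrite Dh.
  exact: uniq_leq_size (msupp_uniq _) sub_supp.
- apply: is_multihomogB homh _; apply: is_multihomogZ; apply: is_multihomogB.
    by rewrite -(homP m hm) is_multihomogX.
  by rewrite -(homP m' hm') is_multihomogX.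
by rewrite coord_mapB h0 /g coord_mapZ coord_mapB !coord_mapX mm' subrr scaler0 subr0.
Qed.

(** * The monomial module *)


Section Transport.
Local Open Scope nat_scope.
Implicit Types d a : nat -> nat.

Lemma distinct4_iota i j k p : distinct4 i j k p -> perm_eq (iota 0 4) [:: i; j; k; p].
Proof.
case/andP => u4 lt4; have sub : {subset [:: i; j; k; p] <= iota 0 4}.
  by move=> x /(allP lt4); rewrite mem_iota.
have [_ e] := uniq_min_size u4 sub (leqnn _).
by rewrite perm_sym; apply: uniq_perm u4 (iota_uniq _ _) e.
Qed.

Lemma all4_distinct (P : nat -> bool) i j k p : distinct4 i j k p ->
  all4 P = [&& P i, P j, P k & P p].
Proof. by move=> /distinct4_iota e; rewrite /all4 (perm_all _ e) /= andbT. Qed.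

Definition sum4 d := d 0 + d 1 + d 2 + d 3.

Lemma sum4E d : sum4 d = \sum_(i <- iota 0 4) d i.
Proof. by rewrite !big_cons big_nil addn0 !addnA. Qed.

Lemma sum4_distinct d i j k p : distinct4 i j k p ->
  sum4 d = d i + d j + d k + d p.
Proof.
move=> /distinct4_iota e; rewrite sum4E (perm_big _ e) /=.
by rewrite !big_cons big_nil addn0 !addnA.
Qed.

(* [in_cone 0 d a]: some product of the variables u_ij, j != i, has row degrees
   d and column degrees a.  [in_cone 2 d a]: x^a Q has the degree and the
   multiplicities of the elements of row degree d. *)
Definition in_cone (q : nat) d a : bool :=
  (sum4 a + q == sum4 d) && all4 (fun i => d i + a i + q <= sum4 d).

(** Removing u_ij lowers |d| by 1, and lowers d_k + a_k only for k = i and k = j. The inequalities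
    at the two other indices must therefore be strict. *)
Definition can_remove (q : nat) d a (i j : nat) : bool :=
  [&& 0 < d i, 0 < a j, i != j
    & all4 (fun k => [|| k == i, k == j | d k + a k + q < sum4 d])].

Definition pred_at (i : nat) (d : nat -> nat) k := d k - (k == i).

Lemma distinct4P i j k p : distinct4 i j k p ->
  [/\ i < 4, j < 4, k < 4 & p < 4] /\
  [/\ i != j, i != k, i != p, j != k & j != p] /\ k != p.
Proof.
case/andP => /= u4 /and5P[-> -> -> -> _]; split=> //; move: u4.
by rewrite !inE !negb_or andbT => /and3P[/and3P[-> -> ->] /andP[-> ->] ->].
Qed.

Lemma in_cone_remove q d a i j : i < 4 -> j < 4 ->
  in_cone q d a -> can_remove q d a i j -> in_cone q (pred_at i d) (pred_at j a).
Proof.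
move=> lt_i lt_j + /and4P[di aj ij].
have [k [p d4]] := distinct4_complete lt_i lt_j ij.
have [_ [[_ ik ip jk jp] kp]] := distinct4P d4.
rewrite /in_cone !(all4_distinct _ d4) !(sum4_distinct _ d4) /pred_at !eqxx /=.
rewrite !(eq_sym j i) !(eq_sym k) !(eq_sym p).
rewrite (negPf ij) (negPf ik) (negPf ip) (negPf jk) (negPf jp) /=.
move: (d i) (d j) (d k) (d p) (a i) (a j) (a k) (a p) di aj.
clear; lia.
Qed.

(** Cases are distinguished by the indices at which the inequality is tight: with none, any
    admissible position works; a single tight i must be the row or the column removed; two tight
    indices i and j force (i, j) or (j, i). *)
Lemma some_removable q d a : q = 0 /\ 0 < sum4 d \/ q = 2 /\ 4 < sum4 d ->
  in_cone q d a -> exists i j, [/\ i < 4, j < 4 & can_remove q d a i j].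
Proof.
move=> q_d /andP[/eqP Eda leda].
have remove i j k p : distinct4 i j k p -> 0 < d i -> 0 < a j ->
    d k + a k + q < sum4 d -> d p + a p + q < sum4 d ->
    exists i j, [/\ i < 4, j < 4 & can_remove q d a i j].
  move=> d4 di aj ltk ltp; have [[lti ltj _ _] [[ij _ _ _ _] _]] := distinct4P d4.
  exists i, j; split=> //; rewrite /can_remove di aj ij (all4_distinct _ d4) !eqxx.
  by rewrite ltk ltp !orbT.
have split4 i : i < 4 -> exists j k p, distinct4 i j k p.
  case: i => [|[|[|[|//]]]] _; by [exists 1, 2, 3|exists 0, 2, 3|exists 0, 1, 3|exists 0, 1, 2].
pose tight i := d i + a i + q == sum4 d.
have ltS i : i < 4 -> ~~ tight i -> d i + a i + q < sum4 d.
  by move=> lt_i nt; rewrite ltn_neqAle nt (allP leda) // mem_iota.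
have [/hasP[i + ti]|/hasPn notight] := boolP (has tight (iota 0 4)); last first.
  have {}ltS i : i < 4 -> d i + a i + q < sum4 d.
    by move=> lt_i; apply: ltS => //; apply: notight; rewrite mem_iota.
  have [/hasP[i + di]|/hasPn d0] := boolP (has (fun i => 0 < d i) (iota 0 4)); last first.
    have : sum4 d = 0.
      by rewrite sum4E big1_seq // => i /andP[_ /d0]; rewrite lt0n negbK => /eqP.
    by move: q_d => /[swap] ->; lia.
  rewrite mem_iota /= => lt_i; have [j [k [p d4]]] := split4 i lt_i.
  have [[_ ltj ltk ltp] _] := distinct4P d4.
  have [aj|aj] := ltnP 0 (a j); first by apply: (remove i j k p); auto.
  have [ak|ak] := ltnP 0 (a k).
    by apply: (remove i k j p); auto; apply: distinct4_perm d4 => f; lia.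
  apply: (remove i p j k); auto; first by apply: distinct4_perm d4 => f; lia.
  have := ltS i lt_i; move: Eda; rewrite !(sum4_distinct _ d4).
  by move: di aj ak; clear; lia.
rewrite mem_iota /= => lt_i.
have [/hasP[j + /andP[ji tj]]|/hasPn notight] := boolP (has (fun j => (j != i) && tight j) (iota 0 4)).
  rewrite mem_iota /= => lt_j.
  have [k [p d4]] : exists k p, distinct4 i j k p by apply: distinct4_complete; rewrite // eq_sym.
  move: ti tj; rewrite /tight => /eqP ti /eqP tj.
  (* The sum of all d_k + a_k is 2|d| - q, so two tight indices leave exactly q for the other two.
     Each of these then has left side at most 2q, which is where the bound 4 for q = 2 comes
     from. *)
  have [lt_k lt_p] : d k + a k + q < sum4 d /\ d p + a p + q < sum4 d.
    move: ti tj Eda q_d; rewrite !(sum4_distinct _ d4).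
    move: (d i) (d j) (d k) (d p) (a i) (a j) (a k) (a p); clear; lia.
  have [/andP[di aj]|nij] := boolP ((0 < d i) && (0 < a j)).
    exact: (remove i j k p).
  have d4' : distinct4 j i k p by apply: distinct4_perm d4 => f; lia.
  have [dj ai] : 0 < d j /\ 0 < a i.
    move: ti tj Eda q_d nij; rewrite !(sum4_distinct _ d4).
    move: (d i) (d j) (d k) (d p) (a i) (a j) (a k) (a p); clear; lia.
  exact: (remove j i k p).
have {}ltS j : j < 4 -> i != j -> d j + a j + q < sum4 d.
  move=> lt_j ij; apply: ltS => //; have := notight j; rewrite mem_iota lt_j.
  by rewrite eq_sym ij; apply.
have [j [k [p d4]]] := split4 i lt_i.
have d4k : distinct4 i k j p by apply: distinct4_perm d4 => f; lia.
have d4p : distinct4 i p j k by apply: distinct4_perm d4 => f; lia.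
have d4j' : distinct4 j i k p by apply: distinct4_perm d4 => f; lia.
have d4k' : distinct4 k i j p by apply: distinct4_perm d4 => f; lia.
have d4p' : distinct4 p i j k by apply: distinct4_perm d4 => f; lia.
have [[_ ltj ltk ltp] [[ij ik ip _ _] _]] := distinct4P d4.
have [Lj Lk Lp] := And3 (ltS j ltj ij) (ltS k ltk ik) (ltS p ltp ip).
move/eqP: ti => ti; have [di|di] := ltnP 0 (d i).
  have [aj|aj] := ltnP 0 (a j); first exact: (remove i j k p).
  have [ak|ak] := ltnP 0 (a k); first exact: (remove i k j p).
  apply: (remove i p j k) => //.
  move: ti Eda di aj ak q_d; rewrite !(sum4_distinct _ d4).
  move: (d i) (d j) (d k) (d p) (a i) (a j) (a k) (a p); clear; lia.
have ai : 0 < a i.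
  move: ti di q_d; move: (d i) (a i) (sum4 d); clear; lia.
have [dj|dj] := ltnP 0 (d j); first exact: (remove j i k p).
have [dk|dk] := ltnP 0 (d k); first exact: (remove k i j p).
apply: (remove p i j k) => //.
move: ti Eda di dj dk q_d; rewrite !(sum4_distinct _ d4).
move: (d i) (d j) (d k) (d p) (a i) (a j) (a k) (a p); clear; lia.
Qed.

Definition rows (l : seq code) i := count_mem i [seq c.1.2 | c <- l].
Definition cols (l : seq code) j := count_mem j [seq c.2 | c <- l].

Definition on_side s : pred code := fun c => valid c && (c.1.1 == s).

Definition reducible q d a :=
  has (fun i => has (can_remove q d a i) (iota 0 4)) (iota 0 4).

(** Variables are removed as long as possible; l records them. *)
Lemma cone_descent q s d a : s < 2 -> in_cone q d a ->
  exists d' a' l, [/\ in_cone q d' a', ~~ reducible q d' a', all (on_side s) l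
    & forall i, i < 4 -> d i = d' i + rows l i /\ a i = a' i + cols l i].
Proof.
move=> lt_s; have [n] := ubnP (sum4 d); elim: n d a => // n IHn d a lt_dn Nda.
have [/hasP[i + /hasP[j + rem]]|irr] := boolP (reducible q d a); last first.
  by exists d, a, [::]; split=> // i _; rewrite !addn0.
rewrite !mem_iota /= => lt_i lt_j; have N' := in_cone_remove lt_i lt_j Nda rem.
have /and4P[di aj ij _] := rem.
have [|d' [a' [l [N'' irr sl Dl]]]] := IHn _ _ _ N'.
  have [k [p d4]] := distinct4_complete lt_i lt_j ij.
  have [_ [[_ ik ip jk jp] kp]] := distinct4P d4.
  move: lt_dn; rewrite !(sum4_distinct _ d4) /pred_at eqxx !(eq_sym _ i).
  by move: di; move: (d i) (d j) (d k) (d p); clear; lia.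
exists d', a', ((s, i, j) :: l); split=> //=.
  by rewrite sl /on_side /= lt_s lt_i lt_j ij eqxx.
move=> m lt_m; have [] := Dl m lt_m; rewrite /pred_at /rows /cols /=.
rewrite (eq_sym i) (eq_sym j) => Ed Ea.
have : (m == i) <= d m by case: eqP => // ->.
have : (m == j) <= a m by case: eqP => // ->.
by move: (d m) (a m) (d' m) (a' m) (count _ _) (count _ _) Ed Ea; clear; lia.
Qed.

(** For q = 0 the descent only stops at d = 0. Hence the inequalities suffice for a zero-diagonal
    table with row sums d and column sums a. *)
Lemma cone_codes s d a : s < 2 -> in_cone 0 d a ->
  exists2 l, all (on_side s) l & forall i, i < 4 -> rows l i = d i /\ cols l i = a i.
Proof.
move=> lt_s /(cone_descent lt_s)[d' [a' [l [N' irr sl Dl]]]]; exists l => // i lt_i.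
have [d0|d_gt0] := posnP (sum4 d'); last first.
  have [|i' [j' [lt_i' lt_j' rem]]] := some_removable _ N'; first by left.
  case/negP: irr; apply/hasP; exists i'; first by rewrite mem_iota.
  by apply/hasP; exists j'; first by rewrite mem_iota.
have [-> ->] := Dl i lt_i.
have := all4_distinct _; case/andP: N' => _ /allP/(_ i); rewrite mem_iota => /(_ lt_i).
by rewrite d0; move: (d' i) (a' i); clear; lia.
Qed.

Definition words (n b : nat) : seq (seq nat) :=
  iter n (fun ws => [seq x :: w | x <- iota 0 b, w <- ws]) [:: [::]].

Definition entry (w : seq nat) (i : nat) : nat := nth 0 w i.

(* The 34 minimal generators of N, as pairs (d, a); [some_removable] bounds |d|
   by 4, hence the entries by 2. *)
Definition module_gens : seq (seq nat * seq nat) := Eval vm_compute in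
  [seq p <- [seq (v, w) | v <- words 4 3, w <- words 4 3]
     | in_cone 2 (entry p.1) (entry p.2) && ~~ reducible 2 (entry p.1) (entry p.2)].

Definition tuple4 (d : nat -> nat) : seq nat := [:: d 0; d 1; d 2; d 3].

Lemma mem_words w n b : (w \in words n b) = (size w == n) && all (fun x => x < b) w.
Proof.
elim: n w => [|n IHn] [|x w] //=; rewrite ?inE //.
  by apply/negP => /allpairsP[[y v] []].
apply/allpairsP/andP => [[[y v] /= [yb + [-> ->]]]|[sz /andP[xb wb]]].
  by rewrite IHn => /andP[/eqP-> vb]; move: yb; rewrite mem_iota add0n /= => ->.
by exists (x, w); rewrite IHn mem_iota /= add0n xb wb -eqSS sz.
Qed.

Lemma module_codes s d a : s < 2 -> in_cone 2 d a ->
  exists p l, [/\ p \in module_gens, all (on_side s) l & forall i, i < 4 ->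
    d i = entry p.1 i + rows l i /\ a i = entry p.2 i + cols l i].
Proof.
move=> lt_s /(cone_descent lt_s)[d' [a' [l [N' irr sl Dl]]]].
exists (tuple4 d', tuple4 a'), l; split=> // [|i lt_i]; last first.
  by have := Dl i lt_i; case: i lt_i => [|[|[|[|]]]].
have le4 : sum4 d' <= 4.
  rewrite leqNgt; apply: contra irr => lt4.
  have [|i' [j' [lt_i' lt_j' rem]]] := some_removable _ N'; first by right.
  apply/hasP; exists i'; first by rewrite mem_iota.
  by apply/hasP; exists j'; first by rewrite mem_iota.
have -> : module_gens = [seq p <- [seq (v, w) | v <- words 4 3, w <- words 4 3]
     | in_cone 2 (entry p.1) (entry p.2) && ~~ reducible 2 (entry p.1) (entry p.2)].
  by vm_compute.
rewrite mem_filter; apply/andP; split; first by rewrite [in_cone _ _ _]N'.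
apply/allpairsP; exists (tuple4 d', tuple4 a').
rewrite !mem_words /=; case/andP: N' => _ /= /and5P[]; rewrite /sum4 in le4 *.
move: (d' 0) (d' 1) (d' 2) (d' 3) (a' 0) (a' 1) (a' 2) (a' 3) le4; clear.
by move=> *; split; rewrite // andbT; apply/and4P; split; lia.
Qed.

End Transport.

(** * The 1176 generators *)


Definition deg_at (d : 8.-tuple nat) (s i : nat) : nat :=
  tnth d (node (inord s) (inord i)).

Definition exp_at (n : 'X_{1..2 * 4}) (s j : nat) : nat :=
  n (mxvec_index (inord s) (inord j)).

Lemma eq_deg_at d e :
  (forall s i, (s < 2)%N -> (i < 4)%N -> deg_at d s i = deg_at e s i) -> d = e.
Proof.
move=> de; apply: eq_from_tnth => k; rewrite -(nodeK k).
by have := de (side k) (cam k) (ltn_ord _) (ltn_ord _); rewrite /deg_at !inord_val.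
Qed.

Lemma eq_exp_at n n' :
  (forall s i, (s < 2)%N -> (i < 4)%N -> exp_at n s i = exp_at n' s i) -> n = n'.
Proof.
move=> nn'; apply/mnmP => e; case/mxvec_indexP: e => s l.
by have := nn' s l (ltn_ord _) (ltn_ord _); rewrite /exp_at !inord_val.
Qed.

Lemma deg_atD d e s i : deg_at (degD d e) s i = (deg_at d s i + deg_at e s i)%N.
Proof. by rewrite /deg_at [LHS]tnth_mktuple. Qed.

Lemma deg_atB d e s i : deg_at (degB d e) s i = (deg_at d s i - deg_at e s i)%N.
Proof. by rewrite /deg_at [LHS]tnth_mktuple. Qed.

Lemma exp_atD m n s i : exp_at (m + n) s i = (exp_at m s i + exp_at n s i)%N.
Proof. exact: mnmDE. Qed.

Lemma exp_atB m n s i : exp_at (m - n) s i = (exp_at m s i - exp_at n s i)%N.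
Proof. exact: mnmBE. Qed.

(** The inequalities are necessary as well, because row i and column i share no variable. *)
Lemma cone_of_mnm m s :
  in_cone 0 (deg_at (multidegree m) s) (exp_at (coord_mnm m) s).
Proof.
rewrite /in_cone /all4 /= /sum4 /deg_at /exp_at.
have d0 : distinct4 0 1 2 3 by [].
have d1 : distinct4 1 0 2 3 by [].
have d2 : distinct4 2 0 1 3 by [].
have d3 : distinct4 3 0 1 2 by [].
rewrite (row_sum _ _ d0) (row_sum _ _ d1) (row_sum _ _ d2) (row_sum _ _ d3).
have c0 : distinct4 1 0 2 3 by [].
have c1 : distinct4 0 1 2 3 by [].
have c2 : distinct4 0 2 1 3 by [].
have c3 : distinct4 0 3 1 2 by [].
rewrite (col_sum _ _ c0) (col_sum _ _ c1) (col_sum _ _ c2) (col_sum _ _ c3).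
pose x i j := m (edge (s, i, j)).
have xE i j : m (edge (s, i, j)) = x i j by [].
rewrite !xE; move: x {xE} => x.
move: (x 0 1)%N (x 0 2)%N (x 0 3)%N (x 1 0)%N (x 1 2)%N (x 1 3)%N
  (x 2 0)%N (x 2 1)%N (x 2 3)%N (x 3 0)%N (x 3 1)%N (x 3 2)%N; clear.
by move=> *; apply/andP; split; first lia; rewrite andbT; apply/and4P; split; lia.
Qed.

Lemma mon_cat l l' : mon (l ++ l') = (mon l + mon l')%MM.
Proof. exact: big_cat. Qed.

Lemma deg_at_mon l s t i : (t < 2)%N -> (i < 4)%N -> all (on_side s) l ->
  deg_at (multidegree (mon l)) t i = if t == s then rows l i else 0%N.
Proof.
move=> lt_t lt_i; elim: l => [_|c l IHl /= /andP[/andP[vc /eqP sc] sl]].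
  by rewrite /mon big_nil multidegree0 /deg_at tnth_mktuple if_same.
rewrite mon_cons multidegreeD deg_atD IHl // /deg_at multidegree_edge // sc !inordK //.
by rewrite /rows /= (eq_sym s); case: eqP.
Qed.

Lemma exp_at_mon l s t i : (t < 2)%N -> (i < 4)%N -> all (on_side s) l ->
  exp_at (coord_mnm (mon l)) t i = if t == s then cols l i else 0%N.
Proof.
move=> lt_t lt_i; elim: l => [_|[[s' i'] j'] l IHl /= /andP[/andP[vc /eqP sc] sl]].
  by rewrite /mon big_nil coord_mnm0 /exp_at mnm0E if_same.
rewrite mon_cons coord_mnmD exp_atD IHl // coord_mnmU (tgtv_edge vc) /exp_at mnm1E.
have /and4P[ls li lj ne] := vc; move: sc => /= sc; rewrite -{}sc {s} in sl IHl *.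
rewrite /cols /= (eq_sym t); case: (s' =P t) => [->|nst].
  congr (nat_of_bool _ + _)%N; apply/eqP/eqP => [/mxvec_index_inj[/(congr1 val)]|-> //].
  by rewrite /= !inordK.
case: eqP => [/mxvec_index_inj[/(congr1 val)]|//].
by rewrite /= !inordK // => /nst.
Qed.

Definition merge_codes (l : nat -> seq code) := l 0%N ++ l 1%N.

Lemma merge_codesP (l : nat -> seq code) t i : (t < 2)%N -> (i < 4)%N ->
  (forall s, (s < 2)%N -> all (on_side s) (l s)) ->
  deg_at (multidegree (mon (merge_codes l))) t i = rows (l t) i /\
  exp_at (coord_mnm (mon (merge_codes l))) t i = cols (l t) i.
Proof.
move=> lt_t lt_i sl; have s0 := sl 0%N isT; have s1 := sl 1%N isT.
rewrite mon_cat multidegreeD coord_mnmD deg_atD exp_atD.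
rewrite (deg_at_mon lt_t lt_i s0) (deg_at_mon lt_t lt_i s1).
rewrite (exp_at_mon lt_t lt_i s0) (exp_at_mon lt_t lt_i s1).
by case: t lt_t => [|[|//]] _ /=; rewrite ?addn0.
Qed.

Lemma nat2_choice (T : Type) (x0 : T) (P : nat -> T -> Prop) :
  (forall s, (s < 2)%N -> exists x, P s x) ->
  exists f, forall s, (s < 2)%N -> P s (f s).
Proof.
move=> ex; have [x Px] := ex 0%N isT; have [y Py] := ex 1%N isT.
by exists (fun s => if s == 0%N then x else y) => -[|[|]].
Qed.

Lemma seq_choice (S : eqType) (T : Type) (x0 : T) (P : S -> T -> Prop) (r : seq S) :
  (forall s, s \in r -> exists x, P s x) -> exists f, forall s, s \in r -> P s (f s).
Proof.
elim: r => [_|s r IHr ex]; first by exists (fun=> x0).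
have [|f Pf] := IHr; first by move=> t rt; apply: ex; rewrite inE rt orbT.
have [x Px] := ex s (mem_head _ _).
exists (fun t => if t == s then x else f t) => t; rewrite inE.
by case: eqP => [->|_] //=; apply: Pf.
Qed.

Lemma mnm_lift d n :
  (forall s, (s < 2)%N -> in_cone 0 (deg_at d s) (exp_at n s)) ->
  exists m, multidegree m = d /\ coord_mnm m = n.
Proof.
move=> cone; pose P s l := all (on_side s) l /\ forall i, (i < 4)%N ->
  rows l i = deg_at d s i /\ cols l i = exp_at n s i.
have /(nat2_choice [::])[l Pl] : forall s, (s < 2)%N -> exists l, P s l.
  by move=> s lt_s; have [l sl Dl] := cone_codes lt_s (cone s lt_s); exists l.
have sl s : (s < 2)%N -> all (on_side s) (l s) by move/Pl => [].
exists (mon (merge_codes l)); split.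
  apply: eq_deg_at => s i lt_s lt_i; have [-> _] := merge_codesP lt_s lt_i sl.
  by have [_ /(_ i lt_i)[]] := Pl s lt_s.
apply: eq_exp_at => s i lt_s lt_i; have [_ ->] := merge_codesP lt_s lt_i sl.
by have [_ /(_ i lt_i)[]] := Pl s lt_s.
Qed.

Notation gen_pair := ((seq nat * seq nat) * (seq nat * seq nat))%type.

Definition pick_side (T : Type) (x y : T) (s : nat) : T := if s == 0%N then x else y.

Definition gen_degree (x : gen_pair) : 8.-tuple nat :=
  [tuple entry (pick_side x.1.1 x.2.1 (side k)) (cam k) | k < 8].

Definition gen_exponent (x : gen_pair) : 'X_{1..2 * 4} :=
  [multinom mxvec (\matrix_(s, l) entry (pick_side x.1.2 x.2.2 s) l) ord0 e | e < 2 * 4].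

Lemma deg_at_gen x s i : (s < 2)%N -> (i < 4)%N ->
  deg_at (gen_degree x) s i = entry (pick_side x.1.1 x.2.1 s) i.
Proof. by move=> lt_s lt_i; rewrite /deg_at tnth_mktuple side_node cam_node !inordK. Qed.

Lemma exp_at_gen x s i : (s < 2)%N -> (i < 4)%N ->
  exp_at (gen_exponent x) s i = entry (pick_side x.1.2 x.2.2 s) i.
Proof. by move=> lt_s lt_i; rewrite /exp_at mnmE mxvecE mxE !inordK. Qed.

Lemma eq_in_cone q d a d' a' :
  (forall i, (i < 4)%N -> d i = d' i /\ a i = a' i) -> in_cone q d a = in_cone q d' a'.
Proof.
move=> e; have [d0 a0] := e 0%N isT; have [d1 a1] := e 1%N isT.
have [d2 a2] := e 2%N isT; have [d3 a3] := e 3%N isT.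
by rewrite /in_cone /all4 /= /sum4 d0 d1 d2 d3 a0 a1 a2 a3.
Qed.

Lemma module_gens_cone p : p \in module_gens -> in_cone 2 (entry p.1) (entry p.2).
Proof.
have /allP : all (fun p => in_cone 2 (entry p.1) (entry p.2)) module_gens by vm_compute.
exact.
Qed.

Definition gen_pairs : seq gen_pair := [seq (p, p') | p <- module_gens, p' <- module_gens].

Lemma mem_gen_pairs x : (x \in gen_pairs) = (x.1 \in module_gens) && (x.2 \in module_gens).
Proof.
case: x => p p'; apply/allpairsP/andP => [[[q q'] /= [? ? [-> ->]]]|[]] //.
by exists (p, p').
Qed.

Lemma gen_pair_side x s : x \in gen_pairs -> pick_side x.1 x.2 s \in module_gens.
Proof. by rewrite mem_gen_pairs /pick_side; case: (s == _) => /andP[]. Qed.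

Lemma gen_pair_cone x s : x \in gen_pairs ->
  in_cone 2 (entry (pick_side x.1.1 x.2.1 s)) (entry (pick_side x.1.2 x.2.2 s)).
Proof.
move/(gen_pair_side s)/module_gens_cone.
by rewrite /pick_side; case: (s == _).
Qed.

(** * Degrees of the factors of a product *)

Section Weights.
Variables (K : idomainType) (n : nat) (w : 'I_n -> nat).
Implicit Types p q h : {mpoly K[n]}.

Definition weight (m : 'X_{1..n}) : nat := \sum_e w e * m e.

(* The substitution X_e := z^(w e) X_e turns weights into degrees in z. *)
Definition grade p :=
  mmap (polyC \o @mpolyC n K) (fun e => ('X_e)%:P * 'X^(w e)) p.

Lemma gradeM : {morph grade : p q / p * q}.
Proof. by move=> p q; rewrite /grade rmorphM. Qed.

Lemma mcoeff_grade p k m : (grade p)`_k@_m = if weight m == k then p@_m else 0.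
Proof.
have gradeX m' : mmap1 (fun e => ('X_e : {mpoly K[n]})%:P * 'X^(w e)) m'
      = ('X_[m'])%:P * 'X^(weight m').
  rewrite /mmap1 mpolyXE_id /weight.
  elim/big_rec3: _ => [|e a b c _ ->]; first by rewrite expr0 mulr1.
  by rewrite exprMn -exprM exprD polyCM polyC_exp mulrACA.
rewrite /grade /mmap coef_sum raddf_sum /=.
rewrite (eq_bigr (fun m' => if m' == m then (if weight m == k then p@_m else 0) else 0)).
  have [mp|/memN_msupp_eq0->] := boolP (m \in msupp p); last first.
    by rewrite if_same big1 // => m' _; rewrite if_same.
  by rewrite (bigD1_seq m) ?msupp_uniq //= eqxx big1 ?addr0 // => m' /negPf->.
move=> m' _; rewrite gradeX mulrA -polyCM coefCM coefXn mul_mpolyC eq_sym.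
case: (m' =P m) => [->|/eqP/negPf nm].
  case: eqP => _; last by rewrite mulr0 mcoeff0.
  by rewrite mulr1 mcoeffZ mcoeffX eqxx mulr1.
case: eqP => _; last by rewrite mulr0 mcoeff0.
by rewrite mulr1 mcoeffZ mcoeffX nm mulr0.
Qed.

Lemma grade_neq0 p m : p@_m != 0 -> (weight m < size (grade p))%N.
Proof.
move=> pm; rewrite ltnNge; apply/negP => le_sz; case/eqP: pm.
have := mcoeff_grade p (weight m) m; rewrite eqxx => <-.
by rewrite nth_default // mcoeff0.
Qed.

Lemma grade_homog p k : (forall m, p@_m != 0 -> weight m = k) ->
  grade p = p%:P * 'X^k.
Proof.
move=> pk; apply/polyP => j; apply/mpolyP => m; rewrite mcoeff_grade coefCM coefXn.
have [p0|/pk->] := eqVneq p@_m 0.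
  by rewrite p0 if_same; case: eqP => _; rewrite ?mulr1 ?mulr0 ?mcoeff0.
by rewrite eq_sym; case: eqP => _; rewrite ?mulr1 ?mulr0 ?mcoeff0.
Qed.

Lemma size_grade p b : (forall m, p@_m != 0 -> (weight m <= b)%N) ->
  (size (grade p) <= b.+1)%N.
Proof.
move=> pb; apply/leq_sizeP => j lt_j; apply/mpolyP => m; rewrite mcoeff_grade mcoeff0.
case: eqP => // wj; apply/eqP; apply: contraLR lt_j => /pb.
by rewrite wj -leqNgt.
Qed.

(** A cofactor of homogeneous polynomials is homogeneous: from q z^k [grade h] = p z^l and p = q h,
    cancelling q leaves z^k [grade h] = h z^l. *)
Lemma weight_factor p q h k l :
  q * h = p -> q != 0 -> (forall m, q@_m != 0 -> weight m = k) ->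
  (forall m, p@_m != 0 -> weight m = l) ->
  forall m, h@_m != 0 -> (weight m + k)%N = l.
Proof.
move=> qh q0 qk pl m hm; pose j := (weight m + k)%N.
have F : (q%:P * 'X^k) * grade h = p%:P * 'X^l.
  by rewrite -(grade_homog qk) -(grade_homog pl) -qh; apply/esym/gradeM.
have : q * ('X^k * grade h)`_j = q * (h%:P * 'X^l)`_j.
  by rewrite -!coefCM !mulrA -polyCM qh F.
move/(mulfI q0); rewrite coefXnM /j ltnNge leq_addl addnK coefCM coefXn.
move/mpolyP/(_ m); rewrite mcoeff_grade eqxx; case: (_ =P l) => // _.
by rewrite mulr0 mcoeff0 => /eqP; rewrite (negPf hm).
Qed.

(** Over a domain the degree in z of a product is the sum of the degrees of its factors. *)
Lemma weight_factor_le p q h m0 b :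
  q * h = p -> q@_m0 != 0 -> (forall m, p@_m != 0 -> (weight m <= b)%N) ->
  forall m, h@_m != 0 -> (weight m0 + weight m <= b)%N.
Proof.
move=> qh qm0 /size_grade pb m hm; move: pb; rewrite -qh gradeM.
have ltq := grade_neq0 qm0; have lth := grade_neq0 hm.
rewrite size_mul -?size_poly_gt0; [|exact: leq_ltn_trans ltq|exact: leq_ltn_trans lth].
have aux (x y u v c : nat) : (x < u -> y < v -> (u + v).-1 <= c.+1 -> x + y <= c)%N.
  by clear; lia.
exact: aux ltq lth.
Qed.

End Weights.


Definition side_weight (s : nat) : 'I_(2 * 4) -> nat :=
  mxvec (\matrix_(t < 2, l < 4) (t == s :> nat : nat)) ord0.

Lemma weight_side s m : (s < 2)%N -> weight (side_weight s) m = sum4 (exp_at m s).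
Proof.
move=> lt_s; rewrite /weight big_mxvec_index /side_weight.
rewrite (bigD1 (inord s)) //= [X in (_ + X)%N]big1 => [|t ts]; last first.
  apply: big1 => l _; rewrite mxvecE mxE (_ : (t == s :> nat) = false) //.
  by apply: contraNF ts => /eqP <-; rewrite inord_val.
rewrite addn0 (sum_ord4 (fun l => _)) /sum4 /exp_at !mxvecE !mxE !inordK //.
by rewrite eqxx !mul1n.
Qed.

Definition var_weight (e f : 'I_(2 * 4)) : nat := f == e.

Lemma weight_var e m : weight (var_weight e) m = m e.
Proof.
rewrite /weight (bigD1 e) //= /var_weight eqxx mul1n big1 ?addn0 // => f.
by move/negPf->.
Qed.

(** Lifts a linear combination term by term through the monomial map while keeping a linear property
    P, such as being homogeneous of a given degree. *)
Lemma coord_map_lift (K : comNzRingType) (P : uv_ring K -> Prop)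
    (r : seq 'X_{1..2 * 4}) (c : 'X_{1..2 * 4} -> K)
    (E : 'X_{1..2 * 4} -> {mpoly K[2 * 4]}) :
  P 0 -> (forall a f g, P f -> P g -> P (a *: f + g)) ->
  (forall n, n \in r -> exists2 g, P g & coord_map g = E n) ->
  exists2 g, P g & coord_map g = \sum_(n <- r) c n *: E n.
Proof.
move=> P0 PD; elim: r => [_|n r IHr ex]; first by exists 0; rewrite ?coord_map0 ?big_nil.
have [|g Pg Eg] := IHr; first by move=> m rm; apply: ex; rewrite inE rm orbT.
have [h Ph Eh] := ex n (mem_head _ _); exists (c n *: h + g); first exact: PD.
by rewrite coord_map_additive coord_mapZ Eg Eh big_cons.
Qed.

(** * Lifting Q (N (x) N), generation and independence *)

Section Generators.
Variables (K : numFieldType) (Q : {mpoly K[2 * 4]}).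
Hypothesis Q_sides : forall m s, Q@_m != 0 -> (s < 2)%N -> sum4 (exp_at m s) = 2%N.
Hypothesis Q_squares : forall s l, (s < 2)%N -> (l < 4)%N ->
  exists2 m, Q@_m != 0 & exp_at m s l = 2%N.

Lemma Q_neq0 : Q != 0.
Proof.
have [m + _] := @Q_squares 0%N 0%N isT isT.
by apply: contraNneq => ->; rewrite mcoeff0.
Qed.

(** A monomial of Q has degree 2 on each side, hence exponent at most 2 in each variable. It thus
    takes an element of the cone for q = 2 to the cone for q = 0, where every exponent lifts to a
    monomial of the prescribed degree. *)
Lemma generator_exists x : x \in gen_pairs ->
  exists g, is_multihomog (gen_degree x) g /\ coord_map g = Q * 'X_[gen_exponent x].
Proof.
move=> gx; pose P g := is_multihomog (K := K) (gen_degree x) g.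
have [||n Qn|g Pg Eg] := @coord_map_lift _ P (msupp Q) (fun n => Q@_n)
    (fun n => 'X_[n + gen_exponent x]).
- exact: is_multihomog0.
- by move=> a f g Pf Pg; apply: is_multihomogD => //; apply: is_multihomogZ.
- have [|m [Dm En]] := @mnm_lift (gen_degree x) (n + gen_exponent x)%MM.
    move=> s lt_s; have cone := gen_pair_cone s gx.
    have Qn0 : Q@_n != 0 by rewrite -mcoeff_msupp.
    rewrite (@eq_in_cone _ _ _ (entry (pick_side x.1.1 x.2.1 s))
      (fun i => exp_at n s i + entry (pick_side x.1.2 x.2.2 s) i)%N) => [|i lt_i].
      move: cone (Q_sides Qn0 lt_s); rewrite /in_cone /all4 /sum4.
      move: (entry _) (entry _) (exp_at n s) => d a b /= + E; clear -E.
      move: E; move: (d 0%N) (d 1%N) (d 2%N) (d 3%N) (a 0%N) (a 1%N) (a 2%N) (a 3%N)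
        (b 0%N) (b 1%N) (b 2%N) (b 3%N) => ? ? ? ? ? ? ? ? ? ? ? ? ? /andP[/eqP ? /and5P[*]].
      by apply/andP; split; [lia | rewrite andbT; apply/and4P; split; lia].
    by rewrite exp_atD exp_at_gen // deg_at_gen.
  by exists 'X_[m]; rewrite ?coord_mapX ?En // /P -Dm is_multihomogX.
exists g; split=> //; rewrite Eg [in RHS](mpolyE Q) mulr_suml.
by apply: eq_bigr => n _; rewrite mpolyXD scalerAl.
Qed.

Section GeneratorSeq.
Variable big_gen : gen_pair -> uv_ring K.
Hypothesis big_homog : forall x, x \in gen_pairs ->
  is_multihomog (gen_degree x) (big_gen x).
Hypothesis coord_big : forall x, x \in gen_pairs ->
  coord_map (big_gen x) = Q * 'X_[gen_exponent x].

Definition gen_seq := binomials K ++ [seq big_gen x | x <- gen_pairs].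

(** The converse of the lifting. Weighting one side gives |a| = |d| - 2. Weighting a single variable
    x_l gives the inequality at l: the image of f has degree at most |d| - d_l in x_l, and Q takes
    away 2 of it. *)
Lemma factor_in_cone d (f : uv_ring K) H n : is_multihomog d f ->
  coord_map f = Q * H -> H@_n != 0 ->
  forall s, (s < 2)%N -> in_cone 2 (deg_at d s) (exp_at n s).
Proof.
move=> homf fE Hn s lt_s.
have cone m : (coord_map f)@_m != 0 -> in_cone 0 (deg_at d s) (exp_at m s).
  case/mcoeff_coord_map_neq0 => m' m'f <-.
  by rewrite -((is_multihomogP _ _ homf) m') ?cone_of_mnm // -mcoeff_msupp.
have sumE : (weight (side_weight s) n + 2)%N = sum4 (deg_at d s).
  apply: weight_factor (esym fE) Q_neq0 _ _ _ Hn => m mE.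
    by rewrite weight_side // Q_sides.
  by rewrite weight_side //; case/andP: (cone m mE); rewrite addn0 => /eqP.
rewrite weight_side // in sumE; rewrite /in_cone sumE eqxx.
apply/allP => l; rewrite mem_iota /= => lt_l.
have [m0 Qm0 m0l] := Q_squares lt_s lt_l.
pose e := mxvec_index (inord s : 'I_2) (inord l : 'I_4).
have := weight_factor_le (w := var_weight e) (b := (sum4 (deg_at d s) - deg_at d s l)%N)
  (esym fE) Qm0 _ Hn.
rewrite !weight_var -/(exp_at m0 s l) -/(exp_at n s l) m0l => le_n.
have {}le_n : (2 + exp_at n s l <= sum4 (deg_at d s) - deg_at d s l)%N.
  apply: le_n => m /cone/andP[_ /allP/(_ l)]; rewrite mem_iota => /(_ lt_l).
  by rewrite weight_var -/(exp_at m s l) addn0; move: (exp_at m s l) (deg_at d s l) (sum4 _); clear; lia.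
by move: le_n; move: (exp_at n s l) (deg_at d s l) (sum4 _); clear; lia.
Qed.

Lemma big_in_gen x : x \in gen_pairs -> in_ideal_of gen_seq (big_gen x).
Proof. by move=> gx; apply: mem_in_ideal_of; rewrite mem_cat map_f ?orbT. Qed.

Lemma binomials_in_gen (f : uv_ring K) :
  in_ideal_of (binomials K) f -> in_ideal_of gen_seq f.
Proof.
by apply: in_ideal_of_trans => g bg; apply: mem_in_ideal_of; rewrite mem_cat bg.
Qed.

(** Each Q x^n with x^n in H is the image of a monomial times a generator. Their combination differs
    from f by an element of the kernel, which the binomials generate. *)
Lemma homog_factor_in_gen d (f : uv_ring K) H :
  is_multihomog d f -> coord_map f = Q * H -> in_ideal_of gen_seq f.
Proof.
move=> homf fE; pose P g := is_multihomog d g /\ in_ideal_of gen_seq g.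
have [||n Hn|g [homg Ig] Eg] := @coord_map_lift _ P (msupp H) (fun n => H@_n)
    (fun n => Q * 'X_[n]).
- by split; [apply: is_multihomog0 | apply: in_ideal_of0].
- move=> a g h [Pg Ig] [Ph Ih]; split.
    by apply: is_multihomogD => //; apply: is_multihomogZ.
  by apply: in_ideal_ofD => //; rewrite -mul_mpolyC; apply: in_ideal_ofM.
- have Hn0 : H@_n != 0 by rewrite -mcoeff_msupp.
  have cone := factor_in_cone homf fE Hn0.
  pose R s (pl : (seq nat * seq nat) * seq code) :=
    [/\ pl.1 \in module_gens, all (on_side s) pl.2 & forall i, (i < 4)%N ->
      deg_at d s i = (entry pl.1.1 i + rows pl.2 i)%N /\
      exp_at n s i = (entry pl.1.2 i + cols pl.2 i)%N].
  have /(nat2_choice (([::], [::]), [::]))[pl Rpl] :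
      forall s, (s < 2)%N -> exists pl, R s pl.
    by move=> s lt_s; have [p [l Dpl]] := module_codes lt_s (cone s lt_s); exists (p, l).
  pose x : gen_pair := ((pl 0%N).1, (pl 1%N).1).
  have gx : x \in gen_pairs.
    by rewrite mem_gen_pairs; have [-> _ _] := Rpl 0%N isT; have [-> _ _] := Rpl 1%N isT.
  have sl s : (s < 2)%N -> all (on_side s) (pl s).2 by move/Rpl => [].
  pose m := mon (merge_codes (fun s => (pl s).2)).
  have pick1 s : (s < 2)%N -> pick_side x.1.1 x.2.1 s = (pl s).1.1.
    by case: s => [|[|]].
  have pick2 s : (s < 2)%N -> pick_side x.1.2 x.2.2 s = (pl s).1.2.
    by case: s => [|[|]].
  have Dd : d = degD (multidegree m) (gen_degree x).
    apply: eq_deg_at => s i lt_s lt_i; rewrite deg_atD deg_at_gen // pick1 //.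
    have [-> _] := merge_codesP lt_s lt_i sl; rewrite addnC.
    by have [_ _ /(_ i lt_i)[]] := Rpl s lt_s.
  have Dn : n = (coord_mnm m + gen_exponent x)%MM.
    apply: eq_exp_at => s i lt_s lt_i; rewrite exp_atD exp_at_gen // pick2 //.
    have [_ ->] := merge_codesP lt_s lt_i sl; rewrite addnC.
    by have [_ _ /(_ i lt_i)[]] := Rpl s lt_s.
  exists ('X_[m] * big_gen x); last first.
    by rewrite coord_mapM coord_mapX coord_big // Dn mpolyXD mulrCA.
  split; last exact/in_ideal_ofM/big_in_gen.
  by rewrite Dd; apply: is_multihomogM; [apply: is_multihomogX | apply: big_homog].
rewrite -[f](subrK g); apply: in_ideal_ofD Ig; apply: binomials_in_gen.
apply: (@coord_map_kernel _ d); first exact: is_multihomogB.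
rewrite coord_mapB fE Eg [in Q * H](mpolyE H) mulr_sumr -sumrB big1 // => n _.
by rewrite scalerAr subrr.
Qed.

Lemma binomial_codesP b : b \in binomial_codes ->
  [/\ all valid b.1, all valid b.2,
      exists2 s, (s < 2)%N & all (on_side s) b.1, same_fiber (mon b.1) (mon b.2)
    & uniq b.1].
Proof.
have /allP : all (fun b => [&& all valid b.1, all valid b.2,
    has (fun s => all (on_side s) b.1) (iota 0 2),
    perm_eq [seq c.1 | c <- b.1] [seq c.1 | c <- b.2],
    perm_eq [seq (c.1.1, c.2) | c <- b.1] [seq (c.1.1, c.2) | c <- b.2]
    & uniq b.1]) binomial_codes by vm_compute.
move=> codesP /codesP /and5P[v1 v2 /hasP[s s2 s_b] rw /andP[cl u]]; split=> //.
  by exists s; rewrite // mem_iota in s2.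
exact: same_fiber_cat.
Qed.

Lemma coord_map_binomial b : b \in binomial_codes -> coord_map (code_binomial K b) = 0.
Proof.
case/binomial_codesP => _ _ _ [_ e] _.
by rewrite /code_binomial coord_mapB !coord_mapX e subrr.
Qed.

Lemma is_multihomog_binomial b : b \in binomial_codes ->
  is_multihomog (multidegree (mon b.1)) (code_binomial K b).
Proof.
case/binomial_codesP => _ _ _ [e _] _; apply: is_multihomogB; first exact: is_multihomogX.
by rewrite e is_multihomogX.
Qed.

Lemma gen_seq_cases g : g \in gen_seq ->
  (exists2 b, b \in binomial_codes & g = code_binomial K b) \/
  (exists2 x, x \in gen_pairs & g = big_gen x).
Proof. by rewrite mem_cat => /orP[]/mapP[x]; [left | right]; exists x. Qed.

Lemma gen_seq_homog : homogeneous_seq gen_seq.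
Proof.
move=> g /gen_seq_cases[][x gx ->]; first by eexists; apply: is_multihomog_binomial.
by eexists; apply: big_homog.
Qed.

Lemma gen_seq_generates :
  generates gen_seq (fun f => forall d, exists H, coord_map (component d f) = Q * H).
Proof.
move=> f; split=> [[c ->] d|Jf]; last first.
  rewrite [f]sum_component; apply: in_ideal_of_sum => d _ _; have [H fE] := Jf d.
  exact: homog_factor_in_gen (is_multihomog_component d f) fE.
rewrite component_sum coord_map_sum.
have ex (i : 'I_(size gen_seq)) : exists H,
    coord_map (component d (c i * gen_seq`_i)) = Q * H.
  have gi := mem_nth 0 (ltn_ord i); have [e home] := gen_seq_homog gi.
  rewrite (componentM _ _ home) coord_mapM; case: (gen_seq_cases gi) => -[x gx ->].
    by exists 0; rewrite coord_map_binomial // !mulr0.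
  by rewrite coord_big // mulrCA; eexists.
have /fin_all_exists[H HE] := ex; exists (\sum_i H i).
by rewrite mulr_sumr; apply: eq_bigr => i _; apply: HE.
Qed.

Lemma mcoeff_mulX_eq0 (R : comNzRingType) n (c : {mpoly R[n]}) p m :
  ~~ (p <= m)%MM -> (c * 'X_[p])@_m = 0.
Proof.
move=> npm; apply: memN_msupp_eq0; apply: contra npm => /msuppM_le.
by case/allpairsP => -[m1 m2] /= [_ +]; rewrite msuppX inE => /eqP-> ->; apply: lem_addl.
Qed.

Lemma binomial_codes_uniq : uniq binomial_codes.
Proof. by vm_compute. Qed.

Lemma mon_not_le (l l' : seq code) : all valid l -> all valid l' ->
  has (fun c => c \notin l') l -> ~~ (mon l <= mon l')%MM.
Proof.
move=> vl vl' /hasP[c lc l'c]; apply/negP => /mnm_lepP/(_ (edge c)).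
have vc := allP vl c lc; rewrite !monE // (count_memPn l'c).
by rewrite leqNgt -has_count has_pred1 lc.
Qed.

(** The monomial [mon b.1] serves as a marker for b: it is divisible by neither monomial of any
    other binomial, nor by [mon b.2]. *)
Lemma binomial_leading b b' (c : uv_ring K) :
  b \in binomial_codes -> b' \in binomial_codes ->
  (c * code_binomial K b')@_(mon b.1) = if b' == b then c@_0%MM else 0.
Proof.
move=> Bb Bb'.
have /allP/(_ b Bb)/allP/(_ b' Bb')/andP[h1 h2] :
  all (fun b : seq code * seq code => all (fun b' : seq code * seq code =>
    ((b' == b) || has (fun c => c \notin b.1) b'.1) && has (fun c => c \notin b.1) b'.2)
    binomial_codes) binomial_codes by vm_compute.
have [v1 v2 _ _ _] := binomial_codesP Bb; have [v1' v2' _ _ _] := binomial_codesP Bb'.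
rewrite /code_binomial mulrBr mcoeffB [X in _ - X]mcoeff_mulX_eq0 ?subr0; last first.
  exact: mon_not_le.
case: eqP h1 => [->|_] /= h1; last by rewrite mcoeff_mulX_eq0 // mon_not_le.
by rewrite -[X in _@_X]addm0 mcoeffMX.
Qed.

(** The marker has degree 0 on the side opposite to s, where the degree of [big_gen x] is
    positive. *)
Lemma big_leading b x (c : uv_ring K) : b \in binomial_codes -> x \in gen_pairs ->
  (c * big_gen x)@_(mon b.1) = 0.
Proof.
move=> Bb gx; have [_ _ [s lt_s sb] _ _] := binomial_codesP Bb.
have := mcoeff_component (multidegree (mon b.1)) (c * big_gen x) (mon b.1).
rewrite eqxx (componentM _ _ (big_homog gx)) => <-.
rewrite ifN ?mul0r ?mcoeff0 //; apply/negP => /le_degP le_d.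
have /allP : all (fun p => has (fun i => 0 < entry p.1 i)%N (iota 0 4)) module_gens.
  by vm_compute.
move=> /(_ _ (gen_pair_side (1 - s) gx))/hasP[i + di]; rewrite mem_iota /= => lt_i.
have lt_t : (1 - s < 2)%N by rewrite ltnS leq_subr.
have := le_d (node (inord (1 - s)) (inord i)).
rewrite -!/(deg_at _ _ _) deg_at_gen // (deg_at_mon lt_t lt_i sb).
rewrite ifN; last by case: s lt_s {sb lt_t le_d di} => [|[|]].
by move: di; rewrite /pick_side; case: ifP => _; rewrite leqn0 lt0n => /negPf->.
Qed.

Lemma module_gens_irredundant p p' : p \in module_gens -> p' \in module_gens ->
  (forall i, i < 4 -> entry p'.1 i <= entry p.1 i)%N ->
  (forall i, i < 4 -> entry p'.2 i <= entry p.2 i)%N ->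
  in_cone 0 (fun i => entry p.1 i - entry p'.1 i)%N
            (fun i => entry p.2 i - entry p'.2 i)%N -> p' = p.
Proof.
move=> gp gp' led lea cone.
have /allP/(_ p gp)/allP/(_ p' gp') :
  all (fun p : seq nat * seq nat => all (fun p' : seq nat * seq nat =>
   [&& all4 (fun i => entry p'.1 i <= entry p.1 i)%N,
       all4 (fun i => entry p'.2 i <= entry p.2 i)%N
     & in_cone 0 (fun i => entry p.1 i - entry p'.1 i)%N
            (fun i => entry p.2 i - entry p'.2 i)%N] ==> (p' == p))
   module_gens) module_gens by vm_compute.
rewrite cone andbT => /implyP pp; apply/eqP/pp/andP.
by split; apply/allP => i; rewrite mem_iota; [apply: led | apply: lea].
Qed.

(** A contribution of x' to the exponent of x would need a monomial whose degree and image are the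
    differences of the two. It would make one generator of N a multiple of another on each side. *)
Lemma gen_pairs_irredundant x x' (f : uv_ring K) :
  x \in gen_pairs -> x' \in gen_pairs ->
  (coord_map (if le_deg (gen_degree x') (gen_degree x)
     then component (degB (gen_degree x) (gen_degree x')) f else 0)
     * 'X_[gen_exponent x'])@_(gen_exponent x) = if x' == x then f@_0%MM else 0.
Proof.
move=> gx gx'; case: eqP => [->|ne].
  rewrite le_deg_refl degB_refl component0_coef -[X in _@_X]addm0 mcoeffMX.
  by rewrite /coord_map comp_mpolyC mcoeffC eqxx mulr1.
apply/eqP; apply/negPn/negP => nz; case: ne.
have [le_e|] := boolP (gen_exponent x' <= gen_exponent x)%MM; last first.
  by move=> /mcoeff_mulX_eq0 E; rewrite E eqxx in nz.
rewrite -{1}(submK le_e) addmC mcoeffMX in nz.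
have [m] := mcoeff_coord_map_neq0 nz.
case: ifP => [le_d mf|_]; last by rewrite msupp0.
have degm : multidegree m = degB (gen_degree x) (gen_degree x').
  by apply: (is_multihomogP _ _ (is_multihomog_component _ f)); rewrite -mcoeff_msupp.
move=> expm; have gens_eq s : (s < 2)%N ->
    pick_side x'.1 x'.2 s = pick_side x.1 x.2 s.
  move=> lt_s; have pick1 (y : gen_pair) :
      pick_side y.1.1 y.2.1 s = (pick_side y.1 y.2 s).1.
    by rewrite /pick_side; case: (s == _).
  have pick2 (y : gen_pair) : pick_side y.1.2 y.2.2 s = (pick_side y.1 y.2 s).2.
    by rewrite /pick_side; case: (s == _).
  apply: module_gens_irredundant; try exact: gen_pair_side.
  - move=> i lt_i; have /le_degP/(_ (node (inord s) (inord i))) := le_d.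
    by rewrite -!/(deg_at _ _ _) !deg_at_gen // !pick1.
  - move=> i lt_i; have /mnm_lepP/(_ (mxvec_index (inord s) (inord i))) := le_e.
    by rewrite -!/(exp_at _ _ _) !exp_at_gen // !pick2.
  rewrite -(@eq_in_cone _ (deg_at (multidegree m) s) (exp_at (coord_mnm m) s)).
    exact: cone_of_mnm.
  move=> i lt_i; rewrite degm expm deg_atB exp_atB !deg_at_gen // !exp_at_gen //.
  by rewrite !pick1 !pick2.
have := gens_eq 0%N isT; have := gens_eq 1%N isT; rewrite /pick_side /=.
by case: x x' {gx gx' nz le_e le_d mf degm expm gens_eq} => [p q] [p' q'] /= -> ->.
Qed.

Lemma gen_pairs_uniq : uniq gen_pairs.
Proof. by vm_compute. Qed.

(** For a binomial, the coefficient of the relation at its marker is the constant term sought. For a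
    lift, the relation is first mapped to Q (N (x) N). *)
Lemma gen_seq_free : nakayama_free gen_seq.
Proof.
move=> c rel0 i lt_i; pose nb := size binomial_codes.
have sz_gen : size gen_seq = (nb + size gen_pairs)%N by rewrite size_cat !size_map.
pose bi j := nth ([::], [::]) binomial_codes j.
pose xi j := nth (([::], [::]), ([::], [::])) gen_pairs (j - nb).
have genE j : (j < size gen_seq)%N -> gen_seq`_j =
    if (j < nb)%N then code_binomial K (bi j) else big_gen (xi j).
  move=> lt_j; rewrite nth_cat size_map; case: ifP => [lt_jb|/negbT].
    by rewrite (nth_map ([::], [::])).
  rewrite -leqNgt => le_j; rewrite (nth_map (([::], [::]), ([::], [::]))) //.
  by rewrite -(ltn_add2l nb) subnKC // -sz_gen.
have memb j : (j < nb)%N -> bi j \in binomial_codes by apply: mem_nth.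
have memx j : (j < size gen_seq)%N -> (j < nb)%N = false -> xi j \in gen_pairs.
  move=> lt_j /negbT; rewrite -leqNgt => le_j; apply: mem_nth.
  by rewrite -(ltn_add2l nb) subnKC // -sz_gen.
have [lt_ib|ge_ib] := boolP (i < nb)%N.
  have := congr1 (mcoeff (mon (bi i).1)) rel0; rewrite mcoeff0 raddf_sum /= => rel.
  rewrite -rel (bigD1 (Ordinal lt_i)) //= genE // lt_ib binomial_leading ?memb //.
  rewrite eqxx big1 ?addr0 // => j ne; rewrite genE //; case: ifP => lt_j.
    rewrite binomial_leading ?memb // ifN //; apply: contra ne => /eqP/eqP.
    by rewrite nth_uniq ?binomial_codes_uniq // -val_eqE.
  by rewrite big_leading ?memb ?memx.
have i_nb := negbTE ge_ib; pose d := gen_degree (xi i).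
have := congr1 (fun f => coord_map (component d f)) rel0.
rewrite component0 component_sum coord_map_sum coord_map0 => rel.
(* The image of the j-th term divided by Q, which is zero for the binomials. Its coefficient at the
   exponent of x_i isolates the constant term of c_i. *)
pose h (j : 'I_(size gen_seq)) : {mpoly K[2 * 4]} := if (j < nb)%N then 0 else
  coord_map (if le_deg (gen_degree (xi j)) d
     then component (degB d (gen_degree (xi j))) (c j) else 0)
     * 'X_[gen_exponent (xi j)].
have hE (j : 'I_(size gen_seq)) : coord_map (component d (c j * gen_seq`_j)) = Q * h j.
  rewrite genE // /h; case: ifP => lt_j.
    rewrite (componentM _ _ (is_multihomog_binomial (memb _ lt_j))) coord_mapM.
    by rewrite coord_map_binomial ?memb // !mulr0.
  have gx := memx _ (ltn_ord j) lt_j.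
  by rewrite (componentM _ _ (big_homog gx)) coord_mapM coord_big // mulrCA.
have /eqP : Q * \sum_j h j = 0.
  by rewrite mulr_sumr -[RHS]rel; apply: eq_bigr => j _; rewrite hE.
rewrite mulf_eq0 (negPf Q_neq0) /= => /eqP /(congr1 (mcoeff (gen_exponent (xi i)))).
rewrite mcoeff0 raddf_sum /= => rel'.
rewrite -rel' (bigD1 (Ordinal lt_i)) //= big1 ?addr0 => [|j ne]; rewrite /h.
  by rewrite i_nb gen_pairs_irredundant ?memx // eqxx.
case: ifP => lt_j; first by rewrite mcoeff0.
rewrite gen_pairs_irredundant ?memx // ifN //; apply: contra ne => /eqP/eqP.
have lt_sub k : (k < size gen_seq)%N -> (k < nb)%N = false -> (k - nb < size gen_pairs)%N.
  move=> lt_k /negbT; rewrite -leqNgt => le_k.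
  by rewrite -(ltn_add2l nb) subnKC // -sz_gen.
have := nth_uniq (([::], [::]), ([::], [::])) (lt_sub j (ltn_ord j) lt_j)
  (lt_sub i lt_i i_nb) gen_pairs_uniq.
move=> -> /eqP E; apply/eqP/val_inj => /=.
by rewrite -(@subnK nb j) ?E ?subnK // leqNgt ?i_nb ?lt_j.
Qed.

End GeneratorSeq.
End Generators.

(** * Camera centers and the transformed quadric *)


Section Centers.
Variable R : comNzRingType.
Implicit Types (A : 'I_4 -> 'M[R]_(3, 4)) (B : 'M[R]_(3, 4)).

(* Cramer: the signed maximal minors of B form a vector of its kernel. *)
Definition camera_center B : 'cV[R]_4 :=
  \col_j cofactor (col_mx (0 : 'rV_4) B : 'M_(1 + 3)) 0 j.

Definition camera_centers A : 'M[R]_4 := \matrix_(j, i) camera_center (A i) j 0.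

Lemma mul_camera_center B : B *m camera_center B = 0.
Proof.
apply/matrixP => k j; rewrite !mxE ord1 {j}.
pose M : 'M_(1 + 3) := col_mx (row k B) B.
(* Row k of B times the vector of minors is the expansion of a determinant in which row k of B
   occurs twice. *)
transitivity (\det M).
  rewrite (expand_det_row _ 0); apply: eq_bigr => j _; rewrite mxE; congr (_ * _).
    by rewrite /M mxE; case: splitP => // i _; rewrite mxE.
  rewrite /cofactor; congr (_ * \det _); apply/matrixP => a b.
  by rewrite !mxE; case: splitP => // i; rewrite ord1.
apply: (determinant_alternate (i1 := lshift 3 0) (i2 := rshift 1 k)).
  by rewrite -val_eqE.
by move=> j; rewrite (col_mxEu (row k B)) (col_mxEd (row k B)) mxE.
Qed.

Lemma mul_camera_centers A i : col i (A i *m camera_centers A) = 0.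
Proof.
rewrite -(mul_camera_center (A i)); apply/colP => j; rewrite !mxE; apply: eq_bigr => k _.
by rewrite !mxE.
Qed.

End Centers.

Lemma map_camera_centers (R S : comNzRingType) (phi : {rmorphism R -> S})
    (A : 'I_4 -> 'M[R]_(3, 4)) :
  map_mx phi (camera_centers A) = camera_centers (fun i => map_mx phi (A i)).
Proof.
apply/matrixP => j i; rewrite !mxE -cofactor_map_mx; congr (cofactor _ _ _).
by rewrite map_col_mx map_mx0.
Qed.

Definition generic_cameras (R : comNzRingType) (i : 'I_4) :
    'M[{mpoly R[4 * (3 * 4)]}]_(3, 4) :=
  \matrix_(j, l) 'X_(mxvec_index i (mxvec_index j l)).

Lemma meval_generic_cameras (R : comNzRingType) (A : 'I_4 -> 'M[R]_(3, 4)) :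
  (\det (camera_centers (generic_cameras R))).@[camera_entries A 0] = \det (camera_centers A).
Proof.
rewrite -det_map_mx map_camera_centers; congr (\det _); apply/matrixP => j i; rewrite !mxE.
congr (cofactor (col_mx _ _) _ _); apply/matrixP => k l.
by rewrite !mxE /= mevalXU /camera_entries mxvecE mxE mxvecE.
Qed.

(** The cameras forgetting one coordinate have the unit vectors as centers up to sign. They witness
    that the genericity condition is not void. *)
Lemma coordinate_centers (R : comNzRingType) :
  \det (camera_centers (fun i : 'I_4 => \matrix_(j < 3, l < 4) (lift i j == l)%:R : 'M[R]_(3, 4)))
    != 0.
Proof.
set A := fun i : 'I_4 => _.
have off i j : j != i -> camera_center (A i) j 0 = 0.
  rewrite eq_sym => /unlift_some[k -> _].
  have /matrixP/(_ k 0) := mul_camera_center (A i).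
  rewrite [X in X = _ -> _]mxE [X in _ = X -> _]mxE (bigD1 (lift i k)) //=.
  rewrite [A i k _]mxE eqxx mul1r big1 ?addr0 // => l ne.
  by rewrite [A i k _]mxE eq_sym (negPf ne) mul0r.
have on i : camera_center (A i) i 0 = (-1) ^+ i.
  rewrite mxE /cofactor add0n (_ : row' _ _ = 1%:M) ?det1 ?mulr1 //.
  apply/matrixP => a b; rewrite !mxE; case: splitP => [a'|a' Da]; first by rewrite ord1.
  rewrite mxE (inj_eq lift_inj) (_ : a' = a) //; apply: val_inj.
  by move: Da; rewrite /= /bump /= => -[].
have -> : camera_centers A = diag_mx (\row_i (-1) ^+ i).
  apply/matrixP => j i; rewrite [LHS]mxE [RHS]mxE.
  have [->|ne] := eqVneq j i; last by rewrite off.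
  by rewrite on mxE.
(* The determinant is a product of signs, so its square is 1. *)
rewrite det_diag; apply/eqP => /(congr1 (fun x => x * x)); rewrite mul0r.
rewrite -big_split big1 => [/eqP|i _]; first by rewrite oner_eq0.
by rewrite /= !mxE -expr2 sqrr_sign.
Qed.

Section WeightHomogeneous.
Variables (K : comNzRingType) (n : nat) (w : 'I_n -> nat).
Implicit Types p q : {mpoly K[n]}.

Definition weight_homog k p := forall m, p@_m != 0 -> weight w m = k.

Lemma weight_homogD k p q : weight_homog k p -> weight_homog k q -> weight_homog k (p + q).
Proof.
move=> hp hq m; rewrite mcoeffD; have [->|/hp//] := eqVneq p@_m 0.
by rewrite add0r; apply: hq.
Qed.

Lemma weight_homogN k p : weight_homog k p -> weight_homog k (- p).
Proof. by move=> hp m; rewrite mcoeffN oppr_eq0; apply: hp. Qed.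

Lemma weight_homogM k l p q :
  weight_homog k p -> weight_homog l q -> weight_homog (k + l) (p * q).
Proof.
move=> hp hq m; rewrite -mcoeff_msupp => /msuppM_le/allpairsP[[m1 m2] /= [m1p m2q ->]].
rewrite mcoeff_msupp in m1p; rewrite mcoeff_msupp in m2q.
rewrite -(hp m1 m1p) -(hq m2 m2q) /weight -big_split; apply: eq_bigr => e _.
by rewrite mnmDE mulnDr.
Qed.

Lemma weight_homogX e : weight_homog (w e) 'X_e.
Proof.
move=> m; rewrite mcoeffX; case: (U_(e)%MM =P m) => [<- _|_]; last by rewrite eqxx.
rewrite /weight (bigD1 e) //= mnm1E eqxx muln1 big1 ?addn0 // => f ne.
by rewrite mnm1E eq_sym (negPf ne) muln0.
Qed.

Lemma weight_homog_sum k (I : Type) (r : seq I) (F : I -> {mpoly K[n]}) :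
  (forall i, weight_homog k (F i)) -> weight_homog k (\sum_(i <- r) F i).
Proof.
move=> hF; elim/big_ind: _ => [m|p q|//]; first by rewrite mcoeff0 eqxx.
exact: weight_homogD.
Qed.

Lemma weight_homogZ k a p : weight_homog k p -> weight_homog k (a *: p).
Proof.
move=> hp m; rewrite mcoeffZ => ap; apply: hp.
by apply: contraNneq ap => ->; rewrite mulr0.
Qed.

End WeightHomogeneous.

Lemma rigidQ_sides (K : comNzRingType) (w : 'I_(2 * 4) -> nat) a b
    (X Y : 'cV[{mpoly K[2 * 4]}]_4) :
  (forall i, weight_homog w a (X i 0)) -> (forall i, weight_homog w b (Y i 0)) ->
  weight_homog w (2 * a + 2 * b) (rigidQ X Y).
Proof.
move=> hX hY; rewrite /rigidQ.
have hXY i j : weight_homog w (a + b) (X i 0 * Y j 0) by apply: weight_homogM.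
have hXX i j : weight_homog w (a + b) (Y i 0 * X j 0).
  by rewrite mulrC; apply: hXY.
have sq p : weight_homog w (a + b) p -> weight_homog w (2 * a + 2 * b) (p ^+ 2).
  by move=> hp; rewrite (_ : (2 * a + 2 * b = (a + b) + (a + b))%N); [apply: weight_homogM | lia].
rewrite -exprMn; apply: weight_homogD; last by apply: weight_homogN; apply: sq.
by apply: weight_homogD; [apply: weight_homogD|]; apply: sq;
  apply: weight_homogD => //; apply: weight_homogN.
Qed.

Section TransformedQuadric.
Variables (K : numFieldType) (C : 'M[K]_4).
Local Notation Q := (block_subst (fun=> C) (rigid_poly K)).

Lemma rigid_substE : Q = rigidQ (\col_i block_form (fun=> C) 0 i) (\col_i block_form (fun=> C) 1 i).
Proof.
have substN p : block_subst (fun=> C) (- p) = - block_subst (fun=> C) p.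
  by rewrite -!scaleN1r block_substZ.
rewrite /rigid_poly /rigidQ !mxE !expr2 !(block_substD, block_substM, substN).
by rewrite /Xv /Yv !block_substXU.
Qed.

Lemma rigid_subst_sides m s : Q@_m != 0 -> (s < 2)%N -> sum4 (exp_at m s) = 2%N.
Proof.
move=> Qm lt_s; rewrite -weight_side //.
have form (t : 'I_2) (i : 'I_4) :
    weight_homog (side_weight s) (t == s :> nat) (block_form (fun=> C) t i).
  apply: weight_homog_sum => j; apply: weight_homogZ.
  suff <- : side_weight s (mxvec_index t j) = (t == s :> nat) by apply: weight_homogX.
  by rewrite /side_weight mxvecE mxE.
move: Qm; rewrite rigid_substE.
have := @rigidQ_sides _ (side_weight s) ((0 : 'I_2) == s :> nat) ((1 : 'I_2) == s :> nat)
  (\col_i block_form (fun=> C) 0 i) (\col_i block_form (fun=> C) 1 i) => hQ.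
move/(hQ _ _ m) => -> => [|i|i]; try by rewrite mxE.
by case: s lt_s {form hQ} => [|[|]].
Qed.

End TransformedQuadric.

Lemma rigidQ_sym (K : comNzRingType) (X Y : 'cV[K]_4) : rigidQ X Y = rigidQ Y X.
Proof. by rewrite /rigidQ; ring. Qed.

(** For c_3 nonzero, Y = e_0 gives c_3^2. For c_3 = 0, Y = e_3 gives c_0^2 + c_1^2 + c_2^2, and the
    order of K is what keeps this sum of squares from vanishing. *)
Lemma rigidQ_nonzero (K : realFieldType) (c : 'cV[K]_4) :
  c != 0 -> exists Y, rigidQ c Y != 0.
Proof.
move=> c0; have [c3|c3] := eqVneq (c 3 0) 0.
  exists (delta_mx 3 0); rewrite /rigidQ !mxE /= c3.
  rewrite !(mulr1, mul1r, mulr0, mul0r, subr0, expr0n) /=; apply: contraNneq c0 => E.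
  have [e0 e1 e2] : [/\ c 0 0 = 0, c 1 0 = 0 & c 2 0 = 0].
    move/eqP: E; rewrite !paddr_eq0 ?addr_ge0 ?sqr_ge0 // !sqrf_eq0.
    by case/andP => /andP[/eqP-> /eqP->] /eqP->.
  apply/eqP/colP => i; rewrite mxE.
  have : i \in [:: 0; 1; 2; 3 : 'I_4].
    by case: i => -[|[|[|[|//]]]] lt_i; rewrite !inE -!val_eqE.
  by rewrite !inE => /or4P[] /eqP->.
exists (delta_mx 0 0); rewrite /rigidQ !mxE /=.
by rewrite !(mulr1, mul1r, mulr0, mul0r, subr0, sub0r, expr0n, addr0, sqrrN) /=
  ?mulr0 ?addr0 ?subr0 sqrf_eq0.
Qed.

(** If no monomial of Q contained the square of the l-th variable on the side s, each would contain
    another variable of that side. Then Q would vanish at e_l for all points on the other side, and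
    the original quadric at the l-th column of C. *)
Lemma rigid_subst_squares (K : realFieldType) (C : 'M[K]_4) s l :
  C \in unitmx -> (s < 2)%N -> (l < 4)%N ->
  exists2 m, (block_subst (fun=> C) (rigid_poly K))@_m != 0 & exp_at m s l = 2%N.
Proof.
move=> unitC lt_s lt_l; set Q := block_subst _ _.
have [/hasP[m mQ /eqP ml]|/hasPn noQ] :=
    boolP (has (fun m => exp_at m s l == 2%N) (msupp Q)).
  by exists m; rewrite // -mcoeff_msupp.
pose l' : 'I_4 := inord l; pose s' : 'I_2 := inord s.
have [Y] : exists Y, rigidQ (col l' C) Y != 0.
  apply: rigidQ_nonzero; apply: contraTneq unitC => C0.
  apply/negP => unitC'; have := mulKmx unitC' (delta_mx l' 0 : 'cV_4).
  rewrite -colE C0 mulmx0 => /colP/(_ l'); rewrite !mxE !eqxx => /eqP.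
  by rewrite eq_sym oner_eq0.
(* The coordinates with respect to C of the l-th column of C on the side s, and of Y on the other
   side. *)
case/eqP; pose P : 'M[K]_(2, 4) := \matrix_(t, j) if t == s' then (j == l')%:R
  else (invmx C *m Y) j 0.
have evQ : Q.@[mxvec P 0] = 0.
  rewrite mevalE big_seq big1 // => m mQ; rewrite big_mxvec_index.
  have Qm : Q@_m != 0 by rewrite -mcoeff_msupp.
  have [j jl mj] : exists2 j : 'I_4, j != l' & m (mxvec_index s' j) != 0%N.
    have := rigid_subst_sides Qm lt_s; have := noQ m mQ.
    have [j [k [p d4]]] : exists j k p, distinct4 l j k p.
      by case: (l) lt_l => [|[|[|[|//]]]] _;
        by [exists 1%N, 2%N, 3%N|exists 0%N, 2%N, 3%N|exists 0%N, 1%N, 3%N|exists 0%N, 1%N, 2%N].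
    have [[_ ltj ltk ltp] [[lj lk lp _ _] _]] := distinct4P d4.
    rewrite (sum4_distinct _ d4) => ne sumE.
    have nz i : (i < 4)%N -> l != i -> exp_at m s i != 0%N ->
        exists2 j : 'I_4, j != l' & m (mxvec_index s' j) != 0%N.
      by move=> lti li mi; exists (inord i); rewrite // -val_eqE /= !inordK // eq_sym.
    have [mj|mj] := eqVneq (exp_at m s j) 0%N; last exact: nz mj.
    have [mk|mk] := eqVneq (exp_at m s k) 0%N; last exact: nz mk.
    have [mp|mp] := eqVneq (exp_at m s p) 0%N; last exact: nz mp.
    by move: sumE ne; rewrite mj mk mp !addn0 => ->.
  rewrite (bigD1 s') //= (bigD1 j) //= mxvecE mxE eqxx (negPf jl) expr0n (negPf mj).
  by rewrite !mul0r mulr0.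
have evP : Q.@[mxvec P 0] = rigidQ (C *m (row 0 P)^T) (C *m (row 1 P)^T).
  rewrite meval_block_subst_id -[rigid_poly K]map_mpoly_id (meval_rigid_poly idfun).
  by rewrite !rowK !trmx_mul !trmxK.
have rowl : C *m (row s' P)^T = col l' C.
  rewrite colE; congr (_ *m _); apply/colP => j; rewrite !mxE eqxx.
  by rewrite andbT.
have rowo t : t != s' -> C *m (row t P)^T = Y.
  move=> ts; rewrite -[RHS](mulKVmx unitC); congr (_ *m _); apply/colP => j.
  by rewrite mxE mxE mxE (negPf ts).
rewrite -evQ evP; case: (ord2P s') => Ds; rewrite {}Ds in rowl rowo *.
  by rewrite rowl rowo.
by rewrite rowl rowo // rigidQ_sym.
Qed.

(** * Counting degrees *)


(** The multidegree as a list of naturals, computed from the codes, so that the count of degrees can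
    be evaluated. *)
Definition code_degree (b : seq code * seq code) : seq nat :=
  [seq count_mem (s, i) [seq c.1 | c <- b.1] | s <- iota 0 2, i <- iota 0 4].

Definition all_degrees : seq (seq nat) :=
  [seq code_degree b | b <- binomial_codes] ++ [seq x.1.1 ++ x.2.1 | x <- gen_pairs].

Lemma deg_at_nth (d : 8.-tuple nat) s i : (s < 2)%N -> (i < 4)%N ->
  deg_at d s i = nth 0%N d (4 * s + i).
Proof.
move=> lt_s lt_i; rewrite /deg_at (tnth_nth 0%N); congr (nth _ _ _).
rewrite /node; case: s lt_s => [|[|//]] _.
  by rewrite (_ : inord 0 = 0) /= ?inordK //; apply: val_inj; rewrite /= inordK.
by rewrite (_ : inord 1 = 1) /= ?inordK //; apply: val_inj; rewrite /= inordK.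
Qed.

Lemma tuple_deg_at (d : 8.-tuple nat) :
  tval d = [seq deg_at d s i | s <- iota 0 2, i <- iota 0 4].
Proof.
rewrite /= !deg_at_nth //; case: d => d /= /eqP.
by case: d => [|a0 [|a1 [|a2 [|a3 [|a4 [|a5 [|a6 [|a7 [|]]]]]]]]].
Qed.

Lemma deg_at_mon_count l s i : all valid l -> (s < 2)%N -> (i < 4)%N ->
  deg_at (multidegree (mon l)) s i = count_mem (s, i) [seq c.1 | c <- l].
Proof.
move=> + lt_s lt_i; elim: l => [_|c l IHl /= /andP[vc vl]].
  by rewrite /mon big_nil multidegree0 /deg_at tnth_mktuple.
by rewrite mon_cons multidegreeD deg_atD IHl // /deg_at multidegree_edge // !inordK.
Qed.

Definition degrees : seq (8.-tuple nat) :=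
  [seq multidegree (mon b.1) | b <- binomial_codes] ++ [seq gen_degree x | x <- gen_pairs].

Lemma degreesE : [seq tval d | d <- degrees] = all_degrees.
Proof.
rewrite map_cat -!map_comp; congr (_ ++ _); apply/eq_in_map => x.
  case/binomial_codesP => v1 _ _ _ _; change (tval (multidegree (mon x.1)) = code_degree x).
  by rewrite tuple_deg_at /code_degree /= !deg_at_mon_count.
move=> gx; have size4 s : size (pick_side x.1 x.2 s).1 = 4%N.
  have /allP : all (fun p : seq nat * seq nat => size p.1 == 4%N) module_gens by vm_compute.
  by move/(_ _ (gen_pair_side s gx))/eqP.
transitivity (tval (gen_degree x)) => //; rewrite tuple_deg_at /= !deg_at_gen //=.
have := size4 0%N; have := size4 1%N.
rewrite /pick_side /=; case: x {gx size4} => [[d a] [d' a']] /=.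
case: d => [|d0 [|d1 [|d2 [|d3 [|]]]]] //; by case: d' => [|? [|? [|? [|? [|]]]]].
Qed.

Definition same_up_to_symmetry_seq (v w : seq nat) : bool :=
     perm_eq (take 4 v) (take 4 w) && perm_eq (drop 4 v) (drop 4 w)
  || perm_eq (take 4 v) (drop 4 w) && perm_eq (drop 4 v) (take 4 w).

(** All 3^8 lists with entries below 3 are tested. This covers every degree symmetric to an entry of
    the table, as the entries there are at most 2. *)
Lemma degrees_table : all (fun w => all (fun ec : 8.-tuple nat * nat =>
    if same_up_to_symmetry_seq w ec.1 then count_mem w all_degrees == ec.2 else true)
  degree_table) (words 8 3).
Proof. by vm_compute. Qed.

(** The zero found in each half of a degree is the camera that the generator leaves out on that
    side. *)
Lemma degrees_in_table : all (fun w =>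
  has (fun ec : 8.-tuple nat * nat => same_up_to_symmetry_seq w ec.1) degree_table
    && ((0%N \in take 4 w) && (0%N \in drop 4 w))) all_degrees.
Proof. by vm_compute. Qed.

Lemma table_entries : all (fun ec : 8.-tuple nat * nat => all (fun x => x < 3)%N ec.1)
  degree_table.
Proof. by vm_compute. Qed.

Lemma count_degrees (d e : 8.-tuple nat) c :
  same_up_to_symmetry d e -> (e, c) \in degree_table -> count_mem d degrees = c.
Proof.
move=> de tab; have := de; rewrite /same_up_to_symmetry => de'.
have wd : tval d \in words 8 3.
  rewrite mem_words size_tuple eqxx /= -(cat_take_drop 4 d) all_cat.
  have /= := allP table_entries _ tab; rewrite -(cat_take_drop 4 e) all_cat.
  by case/andP => a1 a2; case/orP: de' => /andP[/perm_all-> /perm_all->]; rewrite ?a1 ?a2.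
have /allP/(_ _ wd)/allP/(_ _ tab) := degrees_table.
rewrite [same_up_to_symmetry_seq _ _]de -[(e, c).2]/c => /eqP <-.
by rewrite -degreesE count_map; apply: eq_count => x /=; rewrite -val_eqE.
Qed.

Lemma degrees_sound d : d \in degrees ->
  (exists e c, same_up_to_symmetry d e /\ (e, c) \in degree_table) /\
  (forall s, (s < 2)%N -> exists2 i, (i < 4)%N & deg_at d s i = 0%N).
Proof.
move=> dD; have wd : tval d \in all_degrees by rewrite -degreesE map_f.
have /allP/(_ _ wd)/andP[/hasP[[e c] tab de] /andP[z0 z1]] := degrees_in_table.
split=> [|s lt_s]; first by exists e, c.
case: s lt_s => [|[|//]] _.
  have lt_i : (index 0%N (take 4 d) < 4)%N.
    by have := z0; rewrite -index_mem size_take size_tuple.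
  exists (index 0%N (take 4 d)); rewrite // deg_at_nth //.
  by rewrite -(nth_take 0%N lt_i) nth_index.
have lt_i : (index 0%N (drop 4 d) < 4)%N.
  by have := z1; rewrite -index_mem size_drop size_tuple.
by exists (index 0%N (drop 4 d)); rewrite // deg_at_nth // -nth_drop nth_index.
Qed.

Lemma size_degrees : size degrees = 1176%N.
Proof. by rewrite -(size_map val) degreesE; vm_compute. Qed.

Lemma not_involved (K : nzRingType) d (g : uv_ring K) s i :
  is_multihomog d g -> deg_at d s i = 0%N ->
  involves g (node (inord s) (inord i)) = false.
Proof.
move=> homg d0; apply/negbTE/hasPn => m mg; apply/existsPn => j; rewrite negbK.
have := allP homg m mg => /eqP degm; move: d0.
rewrite -degm /deg_at multidegreeE => /eqP; rewrite sum_nat_eq0 => /forallP/(_ j).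
exact.
Qed.

Lemma card_involved (K : nzRingType) (g : uv_ring K) (f : 'I_4 -> 'I_(4 + 4)) i :
  involves g (f i) = false -> (#|[set i : 'I_4 | involves g (f i)]| <= 3)%N.
Proof.
move=> gi; apply: (@leq_trans #|[set~ i]|); last by rewrite cardsC1 card_ord.
by apply/subset_leq_card/subsetP => j; rewrite !inE; apply: contraTneq => ->; rewrite gi.
Qed.

(** * Return to the original image coordinates *)

Section Transfer.
Variables (K : numFieldType) (M N : 'I_(4 + 4) -> 'M[K]_3).
Hypotheses (MN : forall k, M k *m N k = 1%:M) (NM : forall k, N k *m M k = 1%:M).
Implicit Types G : seq (uv_ring K).

Lemma in_ideal_of_block_subst L G (f : uv_ring K) :
  in_ideal_of G f -> in_ideal_of [seq block_subst L g | g <- G] (block_subst L f).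
Proof.
move=> [c ->]; exists (fun i => block_subst L (c i)).
rewrite size_map block_subst_sum; apply: eq_bigr => i _.
by rewrite block_substM (nth_map 0).
Qed.

Lemma in_ideal_of_block_substE G (f : uv_ring K) :
  in_ideal_of [seq block_subst N g | g <- G] f <-> in_ideal_of G (block_subst M f).
Proof.
split=> [/(in_ideal_of_block_subst M)|/(in_ideal_of_block_subst N)].
  by rewrite mapK //; apply: block_substK.
by rewrite block_substK.
Qed.

Lemma nakayama_free_block_subst G :
  nakayama_free G -> nakayama_free [seq block_subst N g | g <- G].
Proof.
move=> freeG c rel0 i; rewrite size_map => lt_i; rewrite -(mcoeff0_block_subst M).
apply: (freeG (fun i => block_subst M (c i))) => //.
have := congr1 (block_subst M) rel0; rewrite block_subst0 block_subst_sum size_map => E.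
by rewrite -[RHS]E; apply: eq_bigr => j _; rewrite block_substM (nth_map 0) // block_substK.
Qed.

End Transfer.

(** * Cameras with linearly independent centers *)

Theorem proposition4 (R : realType) :
  holds_generically (fun A : 'I_4 -> 'M[R]_(3, 4) =>
    (forall i, \rank (A i) = 3%N) ->
    (exists G : seq (uv_ring R), minimal_generators G (rigid_multiview_ideal A)) /\
    (forall G : seq (uv_ring R), minimal_generators G (rigid_multiview_ideal A) ->
      [/\ size G = 1176%N,
          forall g, g \in G ->
            (#|[set i : 'I_4 | involves g (lshift 4 i)]| <= 3)%N /\
            (#|[set i : 'I_4 | involves g (rshift 4 i)]| <= 3)%N,
          forall g, g \in G -> exists d e c,
            [/\ is_multihomog d g, same_up_to_symmetry d e
              & (e, c) \in degree_table]
        & forall d e c, same_up_to_symmetry d e -> (e, c) \in degree_table ->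
            count (is_multihomog d) G = c])).
Proof.
(* A single polynomial describes the exceptional cameras: its vanishing means that the four centers
   are linearly dependent. *)
exists [:: \det (camera_centers (generic_cameras R))]; split.
  exists (fun i => \matrix_(j, l) (lift i j == l)%:R) => /(_ _ (mem_head _ _)).
  rewrite meval_generic_cameras => /eqP; apply/negP; exact: coordinate_centers.
move=> A genA rankA; pose C := camera_centers A.
have unitC : C \in unitmx.
  rewrite unitmxE unitfE; apply/eqP => det0; apply: genA => p; rewrite inE => /eqP->.
  by rewrite meval_generic_cameras.
pose G i : 'M[R]_3 := col' i (A i *m C).
have ACE i : A i *m C = G i *m row' i 1%:M.
  have /colP colAC := mul_camera_centers A i; apply/matrixP => k l.
  rewrite [RHS]mxE; have [->|li] := eqVneq l i.
    have := colAC k; rewrite mxE => ->; rewrite mxE big1 // => j _.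
    by rewrite !mxE eq_sym (negPf (neq_lift _ _)) mulr0.
  rewrite eq_sym in li; have [j -> _] := unlift_some li.
  rewrite (bigD1 j) //= big1 ?addr0 => [|j' ne].
    by rewrite !mxE eqxx mulr1.
  by rewrite !mxE (inj_eq lift_inj) (negPf ne) mulr0.
(* The rank of A_i survives multiplication by the invertible C, and A_i C factors through the 3 x 3
   matrix G_i. *)
have unitG i : G i \in unitmx.
  have rankAC : \rank (A i *m C) = 3%N by rewrite mxrankMfree ?row_free_unit.
  have : (3 <= \rank (G i))%N.
    by apply: leq_trans (mxrankM_maxl (G i) (row' i 1%:M)); rewrite -ACE rankAC.
  by rewrite -row_full_unit col_leq_rank.
pose Q := block_subst (fun=> C) (rigid_poly R).
have Q_sides m s : Q@_m != 0 -> (s < 2)%N -> sum4 (exp_at m s) = 2%N.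
  exact: rigid_subst_sides.
have Q_squares s l : (s < 2)%N -> (l < 4)%N -> exists2 m, Q@_m != 0 & exp_at m s l = 2%N.
  exact: rigid_subst_squares.
have [big_gen bigP] := seq_choice 0 (fun x => @generator_exists _ Q Q_sides x).
have big_homog x (gx : x \in gen_pairs) := (bigP x gx).1.
have coord_big x (gx : x \in gen_pairs) := (bigP x gx).2.
pose M := G \o cam; pose N k := invmx (G (cam k)).
have MN k : M k *m N k = 1%:M by exact/mulmxV/unitG.
have NM k : N k *m M k = 1%:M by exact/mulVmx/unitG.
pose G0 := [seq block_subst N g | g <- gen_seq big_gen].
have gen0 : generates G0 (rigid_multiview_ideal A).
  move=> f; rewrite in_ideal_of_block_substE // (rigid_idealP unitC unitG ACE).
  rewrite (gen_seq_generates Q_sides Q_squares big_homog coord_big).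
  by split=> Jf d; have [H HE] := Jf d; exists H; rewrite -HE component_block_subst.
have free0 : nakayama_free G0.
  exact/nakayama_free_block_subst/(gen_seq_free Q_squares).
have d0 : 8.-tuple nat := [tuple 0%N | k < 8].
have size0 : size G0 = size degrees by rewrite !(size_map, size_cat).
have deg0 i : (i < size G0)%N -> is_multihomog (nth d0 degrees i) G0`_i.
  rewrite size_map => lt_i; rewrite (nth_map 0) //; apply: is_multihomog_block_subst.
  rewrite !nth_cat !size_map; case: ifP => [lt_ib|/negbT].
    rewrite !(nth_map ([::], [::])) //; apply/is_multihomog_binomial/mem_nth.
    exact: lt_ib.
  rewrite -leqNgt => le_i; have lt_i' : (i - size binomial_codes < size gen_pairs)%N.
    by rewrite -(ltn_add2l (size binomial_codes)) subnKC.
  rewrite !(nth_map (([::], [::]), ([::], [::]))) //.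
  exact/big_homog/mem_nth.
have hom0 : homogeneous_seq G0.
  by move=> g /(nthP 0)[i lt_i <-]; exists (nth d0 degrees i); apply: deg0.
have count0 P : (\sum_(i < size G0 | P (mdegree_of G0`_i)) 1)%N = count P degrees.
  rewrite -sum1_count (big_nth d0) big_mkord -size0; apply: eq_bigl => i.
  by rewrite (mdegree_ofP (nakayama_free_neq0 free0 (ltn_ord i)) (deg0 i (ltn_ord i))).
split.
  by exists G0; split=> //; apply: nakayama_free_minimal.
move=> H minH; have freeH := minimal_generators_free minH.
have [homH genH _] := minH.
(* Any minimal sequence H has the degrees of the explicit sequence [G0], with multiplicities; the
   four claims are read off from this. *)
have countH P : (\sum_(i < size H | P (mdegree_of H`_i)) 1)%N = count P degrees.
  by rewrite -count0; apply: minimal_generators_count freeH genH hom0 free0 gen0.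
have degH g : g \in H -> exists2 d, d \in degrees & is_multihomog d g.
  move=> Hg; have [d homg] := homH g Hg; exists d => //.
  (* A degree occurs in [degrees] because g itself makes its count in H positive. *)
  rewrite -has_pred1 has_count -countH -(count_homogE _ homH freeH) -has_count.
  by apply/hasP; exists g.
split.
- by rewrite -size_degrees -(count_predT degrees) -(countH predT) sum1_card card_ord.
- move=> g /degH[d /degrees_sound[_ zero] homg].
  have [i _ i0] := zero 0%N isT; have [j _ j0] := zero 1%N isT.
  have s0 : inord 0 = 0 :> 'I_2 by apply: val_inj; rewrite /= inordK.
  have s1 : inord 1 = 1 :> 'I_2 by apply: val_inj; rewrite /= inordK.
  split.
    apply: (@card_involved _ _ (lshift 4) (inord i)).
    by have := not_involved homg i0; rewrite s0.
  apply: (@card_involved _ _ (@rshift 4 4) (inord j)).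
  by have := not_involved homg j0; rewrite s1.
- move=> g /degH[d /degrees_sound[[e [c [de tab]]] _] homg].
  by exists d, e, c.
move=> d e c de tab; rewrite (count_homogE d homH freeH) (countH (pred1 d)).
exact: count_degrees de tab.
Qed.
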